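(* Let $X\subset\mathbb P^{n+1}$ be a smooth hypersurface of degree $d\geq 4$ over $\mathbb C$, and let $g\in\mathrm{Aut}(X)$ be a linear automorphism of order $d-1$. (1) If $n=2$, then $\mathrm{Fix}(g)$ contains a curve $C'$ which is not a smooth rational curve if and only if $X$ has an inner Galois point $p$ such that $g$ is an automorphism belonging to the Galois point $p$. (2) If $n\geq 3$, then $\mathrm{Fix}(g)$ has codimension $1$ in $X$ if and only if $X$ has an inner Galois point $p$ such that $g$ is an automorphism belonging to the Galois point $p$.
   Context: We work over $\mathbb C$; $\mathbb C(Y)$ denotes the function field of an irreducible variety $Y$. For a smooth hypersurface $X\subset\mathbb P^{n+1}$ and a point $p\in\mathbb P^{n+1}$, let $\pi_p:X\dashrightarrow H$ be the projection with center $p$ onto a hyperplane $H\cong\mathbb P^n$ not containing $p$. It induces a field extension $\pi_p^*:\mathbb C(H)\hookrightarrow\mathbb C(X)$; write $K_p$ for the image of $\mathbb C(H)$ (it does not depend on the choice of $H$). One has $[\mathbb C(X):K_p]=d-1$ if $p\in X$ and $d$ if $p\notin X$. The point $p$ is called a Galois point for $X$ if $\mathbb C(X)/K_p$ is a Galois extension; it is an inner Galois point if moreover $p\in X$, and an outer Galois point if moreover $p\notin X$. An automorphism $g$ of $X$ is linear if there is an automorphism $h$ of $\mathbb P^{n+1}$ with $h(X)=X$ and $h|_X=g$. If $p$ is a Galois point of $X$, an automorphism $g$ of $X$ is called an automorphism belonging to the Galois point $p$ if $g$ (through its induced action on $\mathbb C(X)$) generates the Galois group of $\mathbb C(X)/K_p$.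 For an automorphism $g$ of $X$, $\mathrm{Fix}(g)=\{x\in X\mid g(x)=x\}$. *)

(* Defs.v *)
From HB Require Import structures.
From mathcomp Require Import all_boot all_order all_algebra all_field.
From mathcomp Require Export boolp classical_sets reals.
From mathcomp Require Export complex.
From mathcomp Require Export mpoly.

Set Implicit Arguments.
Unset Strict Implicit.
Unset Printing Implicit Defensive.

Import GRing.Theory Num.Theory.
Local Open Scope ring_scope.
Local Open Scope classical_set_scope.

(* Classical algebraic geometry in P^N over an algebraically closed field K of
   characteristic 0, in the language of points and homogeneous coordinates. *)

Section ProjectiveSpace.
Variables (K : numClosedFieldType) (N : nat).

Definition nzvec := {v : 'rV[K]_N.+1 | v != 0}.

Definition collinear (u v : nzvec) : bool := (val u == val v)%MS.

Lemma collinear_equiv : equiv_class_of collinear.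
Proof.
split=> [u|u v|v u w]; rewrite /collinear.
- by rewrite submx_refl.
- by rewrite andbC.
- by move=> /eqmxP uv /eqmxP vw; apply/eqmxP => *; apply: eqmx_trans uv vw.
Qed.

Canonical collinear_rel := EquivRelPack collinear_equiv.

Definition pspace := {eq_quot collinear}%qT.

HB.instance Definition _ : EqQuotient _ collinear pspace := EqQuotient.on pspace.
HB.instance Definition _ := Choice.on pspace.

Definition ppoint (v : nzvec) : pspace := (\pi_pspace v)%qT.

(* A chosen vector of homogeneous coordinates.  Everything below that is
   phrased with [pcoord] only involves homogeneous conditions, and hence does
   not depend on the choice. *)
Definition pcoord (p : pspace) : 'rV[K]_N.+1 := val (repr p).

Definition veval (P : {mpoly K[N.+1]}) (v : 'rV[K]_N.+1) : K := P.@[v 0].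

Definition heval (P : {mpoly K[N.+1]}) (p : pspace) : K := veval P (pcoord p).

Definition closed_set (Z : set pspace) : Prop :=
  exists2 S : set {mpoly K[N.+1]},
    (forall P, S P -> exists k, P \is k.-homog) &
    forall p, Z p <-> (forall P, S P -> heval P p = 0).

Definition irreducible_set (Z : set pspace) : Prop :=
  Z !=set0 /\
  forall Z1 Z2, closed_set Z1 -> closed_set Z2 ->
    Z `<=` Z1 `|` Z2 -> Z `<=` Z1 \/ Z `<=` Z2.

Definition irr_closed (Z : set pspace) : Prop :=
  closed_set Z /\ irreducible_set Z.

(* Krull dimension. *)
Definition dim_is (Z : set pspace) (k : nat) : Prop :=
  let chain (m : nat) := exists W : nat -> set pspace,
    (forall i, (i <= m)%N -> irr_closed (W i) /\ W i `<=` Z) /\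
    (forall i, (i < m)%N -> W i `<` W i.+1) in
  chain k /\ ~ chain k.+1.

Definition chain_above (X Z0 : set pspace) (m : nat) : Prop :=
  exists W : nat -> set pspace,
    [/\ W 0%N = Z0,
        forall i, (i <= m)%N -> irr_closed (W i) /\ W i `<=` X &
        forall i, (i < m)%N -> W i `<` W i.+1].

(* The codimension of an irreducible closed [Z0] in [X] is the supremum of the
   [m] such that [chain_above X Z0 m]; the codimension of a closed [Z] in [X]
   is the infimum of the codimensions of the irreducible closed subsets of
   [Z]. *)
Definition codim_is (Z X : set pspace) (k : nat) : Prop :=
  [/\ Z `<=` X,
      forall Z0, irr_closed Z0 -> Z0 `<=` Z -> chain_above X Z0 k &
      exists Z0, [/\ irr_closed Z0, Z0 `<=` Z & ~ chain_above X Z0 k.+1]].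

(* The homogeneous ideal of [Z], as the ideal of the affine cone over [Z]: as K
   is infinite, a polynomial vanishes on a line through the origin if and only
   if its homogeneous components do. *)
Definition vanishing (Z : set pspace) : {pred {mpoly K[N.+1]}} :=
  fun P => `[< forall v : nzvec, Z (ppoint v) -> veval P (val v) = 0 >].

Record projvar := ProjVar {
  pvset :> set pspace;
  projvarP : irr_closed pvset
}.

End ProjectiveSpace.

Section VanishingIdeal.
Variables (K : numClosedFieldType) (N : nat).
Local Notation nzvec := (nzvec K N).
Local Notation pspace := (pspace K N).

Lemma pcoord_ppoint (v : nzvec) :
  exists2 a : K, a != 0 & pcoord (ppoint v) = a *: val v.
Proof.
have : (repr (ppoint v) = v %[mod pspace])%qT by rewrite reprK.
move=> /eqmodP /= /andP[/sub_rVP [a ha] _]; exists a => //.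
apply: contraNneq (valP (repr (ppoint v))) => a0.
by rewrite ha a0 scale0r.
Qed.

Lemma ppointZ (u v : nzvec) (a : K) :
  a != 0 -> val u = a *: val v -> ppoint u = ppoint v.
Proof.
move=> a0 e; apply/eqmodP => /=; rewrite /collinear e.
by apply/andP; split; rewrite (eqmx_scale _ a0) submx_refl.
Qed.

(* The restriction of [P] to the line spanned by [v], as a polynomial in the
   scaling parameter. *)
Definition linepoly (P : {mpoly K[N.+1]}) (v : 'rV[K]_N.+1) : {poly K} :=
  \sum_(k < msize P) veval (pihomog mdeg k P) v *: 'X^k.

Lemma homog_scale k (P : {mpoly K[N.+1]}) (t : K) (v : 'rV[K]_N.+1) :
  P \is k.-homog -> veval P (t *: v) = t ^+ k * veval P v.
Proof.
move=> /dhomogP hP; rewrite /veval !mevalE mulr_sumr; apply: eq_big_seq => m /hP /= mk.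
rewrite mulrCA; congr (_ * _).
under eq_bigr do rewrite mxE exprMn.
rewrite big_split /= -mk mdegE; congr (_ * _).
by rewrite -expr_sum.
Qed.

Lemma linepolyE P v t : (linepoly P v).[t] = veval P (t *: v).
Proof.
rewrite [in RHS](@pihomog_partitionE _ _ mdeg (msize P) P) //.
rewrite /veval raddf_sum /= horner_sum; apply: eq_bigr => k _.
by rewrite -/(veval _ _) (homog_scale _ _ (pihomogP _ _ _)) !hornerE mulrC.
Qed.

Lemma linepoly0 (P : {mpoly K[N.+1]}) v :
  (forall t, t != 0 -> veval P (t *: v) = 0) -> linepoly P v = 0.
Proof.
move=> h; apply: (@roots_geq_poly_eq0 _ _
  [seq k.+1%:R | k <- iota 0 (size (linepoly P v))]).
- apply/allP => _ /mapP[k _ ->]; apply/rootP.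
  by rewrite linepolyE h // pnatr_eq0.
- rewrite map_inj_uniq ?iota_uniq // => i j /eqP.
  by rewrite eqr_nat => /eqP[].
- by rewrite size_map size_iota.
Qed.

Lemma linepoly_coef P v (k : nat) : (linepoly P v)`_k = veval (pihomog mdeg k P) v.
Proof.
rewrite coef_sum; under eq_bigr do rewrite coefZ coefXn.
have [kP|kP] := ltnP k (msize P).
  rewrite (bigD1 (Ordinal kP)) //= eqxx mulr1 big1 ?addr0 // => i.
  by rewrite -val_eqE eq_sym => /negbTE /= ->; rewrite mulr0.
rewrite big1 => [|i _].
  suff -> : pihomog mdeg k P = 0 by rewrite /veval meval0.
  rewrite pihomogE big_seq_cond big1 // => m /andP[/msize_mdeg_lt mP /eqP e].
  by move: mP; rewrite e ltnNge kP.
by rewrite gtn_eqF ?mulr0 // (leq_trans (ltn_ord i)).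
Qed.

Lemma line_closed (P : {mpoly K[N.+1]}) :
  closed_set [set p : pspace | linepoly P (pcoord p) = 0].
Proof.
exists [set Q | exists k, Q = pihomog mdeg k P].
  by move=> _ [k ->]; exists k; apply: pihomogP.
move=> p; split=> [/= h _ [k ->]|h].
  by rewrite /heval -linepoly_coef h coef0.
by apply/polyP => k; rewrite coef0 linepoly_coef; apply: h; exists k.
Qed.

Variable Y : projvar K N.

Lemma vanishing_idealr : idealr_closed (vanishing Y).
Proof.
split.
- by apply/asboolP => v _; rewrite /veval meval0.
- apply/asboolP => h; have [_ [[p Yp] _]] := projvarP Y.
  have := h (repr p); rewrite /ppoint reprK /veval meval1 => /(_ Yp) /eqP.
  by rewrite oner_eq0.
- move=> A P Q /asboolP hP /asboolP hQ; apply/asboolP => v Yv.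
  by rewrite /veval mevalD mevalM -!/(veval _ _) hP // hQ // mulr0 addr0.
Qed.

Lemma vanishing_lineP (P : {mpoly K[N.+1]}) :
  (forall p, pvset Y p -> linepoly P (pcoord p) = 0) -> P \in vanishing Y.
Proof.
move=> h; apply/asboolP => v Yv.
have [a a0 e] := pcoord_ppoint v.
have := linepolyE P (pcoord (ppoint v)) a^-1.
by rewrite h // horner0 e scalerA mulVf // scale1r.
Qed.

Lemma vanishing_prime : prime_idealr_closed (vanishing Y).
Proof.
move=> P Q /asboolP PQ; have [_ [_ irr]] := projvarP Y.
case: (irr _ _ (line_closed P) (line_closed Q)) => [p Yp /=|h|h]; last 2 first.
- by rewrite vanishing_lineP.
- by rewrite [Q \in _]vanishing_lineP ?orbT.
suff /eqP : linepoly P (pcoord p) * linepoly Q (pcoord p) = 0.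
  by rewrite mulf_eq0 => /orP[] /eqP; [left|right].
have -> : linepoly P (pcoord p) * linepoly Q (pcoord p) =
          linepoly (P * Q) (pcoord p).
  apply/eqP; rewrite -subr_eq0; apply/eqP.
  set q := _ - _.
  apply: (@roots_geq_poly_eq0 _ _ [seq k.+1%:R | k <- iota 0 (size q)]).
  - apply/allP => _ /mapP[k _ ->]; apply/rootP.
    by rewrite /q hornerD hornerN hornerM !linepolyE /veval mevalM subrr.
  - rewrite map_inj_uniq ?iota_uniq // => i j /eqP.
    by rewrite eqr_nat => /eqP[].
  - by rewrite size_map size_iota.
apply: linepoly0 => t t0.
have nz : t *: pcoord p != 0 by rewrite scaler_eq0 negb_or t0 (valP (repr p)).
pose u : nzvec := exist (fun v : 'rV[K]_N.+1 => v != 0) _ nz.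
have -> : t *: pcoord p = val u by [].
apply: PQ; rewrite (@ppointZ u (repr p) t t0) //.
by rewrite /ppoint reprK.
Qed.

HB.instance Definition _ :=
  isIdealr.Build {mpoly K[N.+1]} (vanishing Y) vanishing_idealr.
HB.instance Definition _ :=
  isPrimeIdealrClosed.Build {mpoly K[N.+1]} (vanishing Y) vanishing_prime.

End VanishingIdeal.

Section Subfield.
Variables (F : fieldType) (S : divringClosed F).

Record subfield_type := Subfield { subfield_val : F; _ : subfield_val \in S }.
HB.instance Definition _ := [isSub for subfield_val].
HB.instance Definition _ := [Choice of subfield_type by <:].
HB.instance Definition _ := [SubChoice_isSubComUnitRing of subfield_type by <:].
HB.instance Definition _ :=
  [SubComUnitRing_isSubIntegralDomain of subfield_type by <:].
HB.instance Definition _ := [SubIntegralDomain_isSubField of subfield_type by <:].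

End Subfield.

Section FunctionField.
Variables (K : numClosedFieldType) (N : nat) (Y : projvar K N).

(* The homogeneous coordinate ring K[x_0, ..., x_N] / I(Y). *)
Definition coordring := {ideal_quot (vanishing Y)}.

HB.instance Definition _ := GRing.ComNzRing.on coordring.

Definition coord_unit : {pred coordring} := fun x => `[< exists y, y * x = 1 >].
Definition coord_inv (x : coordring) : coordring :=
  if pselect (exists y, y * x = 1) is left h then projT1 (cid h) else x.

Lemma coord_mulVx : {in coord_unit, left_inverse 1 coord_inv *%R}.
Proof.
move=> x /asboolP xu; rewrite /coord_inv; case: pselect => // h.
by case: (cid h).
Qed.
Lemma coord_unitPl (x y : coordring) : y * x = 1 -> coord_unit x.
Proof. by move=> e; apply/asboolP; exists y. Qed.
Lemma coord_invr_out : {in [predC coord_unit], coord_inv =1 id}.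
Proof.
move=> x /asboolPn xu; rewrite /coord_inv; by case: pselect.
Qed.

HB.instance Definition _ := GRing.ComNzRing_hasMulInverse.Build coordring
  coord_mulVx coord_unitPl coord_invr_out.
HB.instance Definition _ := GRing.ComUnitRing_isIntegral.Build coordring
  (@Quotient.rquot_IdomainAxiom _ (vanishing Y)).

Definition coord_pi (P : {mpoly K[N.+1]}) : coordring :=
  (\pi_{ideal_quot (vanishing Y)} P)%qT.

Definition coord_class (P : {mpoly K[N.+1]}) : {fraction coordring} :=
  FracField.tofrac (coord_pi P).

Definition form_quotient (z : {fraction coordring}) (P Q : {mpoly K[N.+1]}) :
    Prop :=
  exists k, [/\ P \is k.-homog, Q \is k.-homog, Q \notin vanishing Y &
                z = coord_class P / coord_class Q].

Definition degree0 : {pred {fraction coordring}} :=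
  fun z => `[< exists P Q, form_quotient z P Q >].

Lemma coord_class_eq0 P : (coord_class P == 0) = (P \in vanishing Y).
Proof.
rewrite /coord_class tofrac_eq0.
have -> : (0 : coordring) = coord_pi 0 by rewrite /coord_pi rmorph0.
by rewrite /coord_pi -Quotient.idealrBE subr0.
Qed.

Lemma coord_classM P Q : coord_class (P * Q) = coord_class P * coord_class Q.
Proof. by rewrite /coord_class -tofracM /coord_pi rmorphM. Qed.
Lemma coord_classB P Q : coord_class (P - Q) = coord_class P - coord_class Q.
Proof. by rewrite /coord_class -tofracB /coord_pi rmorphB. Qed.
Lemma coord_class1 : coord_class 1 = 1.
Proof. by rewrite /coord_class /coord_pi rmorph1 -tofrac1. Qed.
Lemma coord_class0 : coord_class 0 = 0.
Proof. by rewrite /coord_class /coord_pi rmorph0 -tofrac0. Qed.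

Lemma degree0_divring : divring_closed degree0.
Proof.
have one_notin : 1 \notin vanishing Y by rewrite -coord_class_eq0 coord_class1 oner_eq0.
split.
- apply/asboolP; exists 1, 1, 0%N; split=> //; rewrite ?dhomog1 //.
  by rewrite coord_class1 divr1.
- move=> _ _ /asboolP[P [Q [k [hP hQ Q0 ->]]]] /asboolP[P' [Q' [k' [hP' hQ' Q'0 ->]]]].
  apply/asboolP; exists (P * Q' - P' * Q), (Q * Q'), (k + k')%N; split.
  + by apply: rpredB; [exact: dhomogM | rewrite addnC; exact: dhomogM].
  + exact: dhomogM.
  + by rewrite -coord_class_eq0 coord_classM mulf_neq0 ?coord_class_eq0.
  + rewrite coord_classB !coord_classM -mulNr addf_div ?coord_class_eq0 //.
    by rewrite mulNr.
- move=> _ _ /asboolP[P [Q [k [hP hQ Q0 ->]]]] /asboolP[P' [Q' [k' [hP' hQ' Q'0 ->]]]].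
  apply/asboolP; have [P'0|P'0] := boolP (P' \in vanishing Y).
    exists 0, 1, 0%N; split=> //; rewrite ?dhomog0 ?dhomog1 //.
    move: P'0; rewrite -coord_class_eq0 => /eqP ->.
    by rewrite mul0r invr0 mulr0 coord_class0 mul0r.
  exists (P * Q'), (Q * P'), (k + k')%N; split.
  + exact: dhomogM.
  + exact: dhomogM.
  + by rewrite -coord_class_eq0 coord_classM mulf_neq0 ?coord_class_eq0.
  + by rewrite !coord_classM invf_div mulf_div.
Qed.

HB.instance Definition _ :=
  GRing.isDivringClosed.Build {fraction coordring} degree0 degree0_divring.

(* The function field of [Y]: the degree 0 part of the homogeneous
   localisation of the coordinate ring of [Y]. *)
Definition funfield := subfield_type degree0.
HB.instance Definition _ := GRing.Field.on funfield.

Definition ratfun_eq (f : funfield) (P Q : {mpoly K[N.+1]}) : Prop :=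
  form_quotient (subfield_val f) P Q.

Definition ratfun_const (f : funfield) (c : K) : Prop :=
  ratfun_eq f c%:MP 1.

Definition ratfun_value (f : funfield) (y : pspace K N) (c : K) : Prop :=
  exists P Q, [/\ ratfun_eq f P Q, heval Q y != 0 & c = heval P y / heval Q y].

End FunctionField.

Section Morphisms.
Variables (K : numClosedFieldType).

(* Near each point of [Y], the map [f] is given by forms of the same degree
   without common zero. *)
Definition is_morphism (N M : nat) (Y : set (pspace K N)) (Z : set (pspace K M))
    (f : pspace K N -> pspace K M) : Prop :=
  (forall y, Y y -> Z (f y)) /\
  forall y, Y y -> exists k (P : 'I_M.+1 -> {mpoly K[N.+1]}) (U : set (pspace K N)),
    [/\ forall i, P i \is k.-homog, closed_set (~` U), U y &
        forall z, Y z -> U z ->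
          \row_i heval (P i) z != 0 /\
          (pcoord (f z) == \row_i heval (P i) z)%MS].

Variable N : nat.
Implicit Types (X : projvar K N) (Y : set (pspace K N)).

(* The values of [g] outside [Y] are irrelevant. *)
Definition automorphism Y (g : pspace K N -> pspace K N) : Prop :=
  is_morphism Y Y g /\
  exists g', [/\ is_morphism Y Y g', forall y, Y y -> g' (g y) = y &
                 forall y, Y y -> g (g' y) = y].

Definition linear_automorphism Y (g : pspace K N -> pspace K N) : Prop :=
  automorphism Y g /\
  exists h, [/\ automorphism setT h, h @` Y = Y & forall y, Y y -> h y = g y].

Definition automorphism_order Y (g : pspace K N -> pspace K N) (m : nat) : Prop :=
  [/\ (0 < m)%N, forall y, Y y -> iter m g y = y &
      forall j, (0 < j < m)%N -> ~ (forall y, Y y -> iter j g y = y)].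

Definition fixed_set Y (g : pspace K N -> pspace K N) : set (pspace K N) :=
  [set y | Y y /\ g y = y].

(* [tau] is f |-> f \o g: if f is regular at g(y), with value c, then so is
   tau(f) at y.  As g is a morphism and a rational function is determined by
   its values on a dense open set, this determines [tau]. *)
Definition induced_by X (g : pspace K N -> pspace K N)
    (tau : {rmorphism funfield X -> funfield X}) : Prop :=
  forall f y c, pvset X y -> ratfun_value f (g y) c -> ratfun_value (tau f) y c.

(* Jacobian criterion.  The gradient condition forces [F] to be squarefree, so
   that [d] is the degree of [Y]. *)
Definition smooth_hypersurface (d : nat) (Y : set (pspace K N)) : Prop :=
  exists F : {mpoly K[N.+1]},
    [/\ F \is d.-homog, F != 0, Y = [set p | heval F p = 0] &
        forall p, Y p -> exists i, heval F^`M(i) p != 0].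

(* The tangent space at [y] to the affine cone over [Y]; for a smooth point
   its dimension is one more than that of [Y]. *)
Definition cone_tangent Y (y : pspace K N) (v : 'rV[K]_N.+1) : Prop :=
  forall P, P \in vanishing Y -> \sum_i heval P^`M(i) y * v 0 i = 0.

(* Smoothness of a set of dimension [r]. *)
Definition smooth_set Y (r : nat) : Prop :=
  forall y, Y y -> exists2 B : 'M[K]_(r.+1, N.+1), row_free B &
    forall v, cone_tangent Y y v <-> (v <= B)%MS.

Definition rational_curve X : Prop :=
  exists phi : {rmorphism {fraction {poly K}} -> funfield X},
    bijective phi /\
    forall c, ratfun_const (phi (FracField.tofrac c%:P)) c.

Definition smooth_rational_curve X : Prop :=
  smooth_set X 1 /\ rational_curve X.

End Morphisms.

Section Galois.
Variables (L : fieldType) (k : set L).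

Definition poly_over (q : {poly L}) : Prop := forall i, k q`_i.

Definition min_poly_over (x : L) (q : {poly L}) : Prop :=
  [/\ q \is monic, poly_over q, root q x &
      forall r, poly_over r -> r != 0 -> root r x -> (size q <= size r)%N].

Definition algebraic_ext : Prop := forall x, exists q, min_poly_over x q.

Definition normal_ext : Prop := forall x q, min_poly_over x q ->
  exists s : seq L, q = \prod_(a <- s) ('X - a%:P).

Definition separable_ext : Prop := forall x q, min_poly_over x q ->
  separable_poly q.

Definition galois_ext : Prop := [/\ algebraic_ext, normal_ext & separable_ext].

Definition in_galois_group (s : {rmorphism L -> L}) : Prop :=
  bijective s /\ forall x, k x -> s x = x.

Definition generates_galois_group (t : {rmorphism L -> L}) : Prop :=
  in_galois_group t /\
  forall s : {rmorphism L -> L}, in_galois_group s ->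
    exists m, (forall x, s x = iter m t x) \/ (forall x, iter m t (s x) = x).

End Galois.

Section GaloisPoints.
Variables (K : numClosedFieldType) (N : nat).
Implicit Types (X : projvar K N) (p : pspace K N).

(* The projection x |-> l(p) x - l(x) p with center p onto the hyperplane
   l = 0, where l is the linear form with coefficients [l] and l(p) <> 0: the
   line through x and p meets the hyperplane in this point. *)
Definition projection_form p (l : 'cV[K]_N.+1) (j : 'I_N.+1) : {mpoly K[N.+1]} :=
  (pcoord p *m l) 0 0 *: 'X_j - (\sum_i l i 0 *: 'X_i) * (pcoord p 0 j)%:MP.

Definition pull_projection p (l : 'cV[K]_N.+1) (P : {mpoly K[N.+1]}) :=
  P \mPo [tuple projection_form p l j | j < N.+1].

(* The image K_p of the function field of the hyperplane H = {l = 0} under the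
   pull-back along the projection X --> H; an element of this function field is
   a quotient of forms [P / Q].  It does not depend on [l]. *)
Definition projection_subfield X p : set (funfield X) :=
  [set f | exists (l : 'cV[K]_N.+1) k (P Q : {mpoly K[N.+1]}),
    [/\ (pcoord p *m l) 0 0 != 0, P \is k.-homog, Q \is k.-homog &
        ratfun_eq f (pull_projection p l P) (pull_projection p l Q)]].

Arguments projection_subfield : clear implicits.

Definition galois_point X p : Prop := galois_ext (projection_subfield X p).

Definition inner_galois_point X p : Prop := pvset X p /\ galois_point X p.

Definition belongs_to_galois_point X p (g : pspace K N -> pspace K N) : Prop :=
  galois_point X p /\
  exists2 tau : {rmorphism funfield X -> funfield X},
    induced_by g tau & generates_galois_group (projection_subfield X p) tau.

End GaloisPoints.

(* Main.v *)
(* By unique factorization of polynomials an automorphism of projective space is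
   linear, so g is given by a matrix A; an irreducible closed set of fixed points
   lies in an eigenspace of A.  If no eigenspace of A is a hyperplane, then a
   fixed set of this kind has codimension at least 2 in X, resp. is a line or a
   point if X is a surface.  Otherwise A = lam + l p is a homology with axis
   l = 0 and center p, and the invariance of the equation F of X under A, of
   order d - 1, forces F = l^(d-1) L + G with L and G forms in the coordinates of
   the projection from p.  Hence p lies on X, and C(X) is the Kummer extension of
   K_p generated by l / L, whose Galois group is generated by g.  Conversely, if
   g belongs to p then v A lies on the line through v and p for all v on X; this
   is a condition of degree 2 < d, so it holds for all v, and A is a homology.
   The fixed locus of a homology contains the smooth section G = 0 of X by the
   axis.  It has codimension 1, and for a surface X it is a plane curve of degree
   at least 4, which has no rational parametrisation b: the gradient of G along b
   is proportional to the cross product of b and b', whose degree is smaller. *)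

From HB Require Import structures.
Require Import Defs.
From mathcomp Require Import all_boot all_order all_algebra all_field.
From mathcomp Require Import ring zify.
From mathcomp Require Import boolp classical_sets reals complex.
Set Implicit Arguments.
Unset Strict Implicit.
Unset Printing Implicit Defensive.
Import Order.TTheory GRing.Theory Num.Theory.
Local Open Scope ring_scope.
Local Open Scope classical_set_scope.

(** * Unique factorization of polynomials *)

(** Dimension is defined by chains of irreducible closed sets, so an upper bound on a chain has to
    be proved by hand, and this is done only for explicit hyperplane and plane sections. A longer
    chain contains an irreducible set on which some polynomial outside the ideal of the larger
    members vanishes; eliminating one variable against the equation leaves a nonzero relation in
    fewer variables, and one of its prime factors still vanishes because vanishing ideals are prime.
    The same elimination proves the Nullstellensatz for a single prime polynomial: it shows that F
    generates the ideal of X, so that a nonzero form vanishing on X has degree at least d. That F is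
    prime comes from smoothness, since two factors of positive degree in at least three coordinates
    have a common zero, where all derivatives of the product vanish. The degree enters through 2 < d
    for forms of degree 2 on X, through 2(d - 1) > d, which leaves only the exponents 0 and d - 1
    along the center, and through d - 1 >= 2, which lets the section by the axis inherit
    smoothness. *)

Section Divisibility.
Variable R : idomainType.
Implicit Types a b c p q : R.

Definition dvdr a b := exists c, b = c * a.

Definition prime_elt p := [/\ p != 0, p \isn't a GRing.unit &
  forall b c, dvdr p (b * c) -> dvdr p b \/ dvdr p c].

(** The factors are prime, not merely irreducible: uniqueness is thereby built in, and induction on
    this predicate replaces arguments with multiplicities. *)
Inductive factored : R -> Prop :=
| FactoredUnit u : u \is a GRing.unit -> factored u
| FactoredMul p a : prime_elt p -> factored a -> factored (p * a).

Lemma dvdr_refl a : dvdr a a. Proof. by exists 1; rewrite mul1r. Qed.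

Lemma dvdr_mull a b c : dvdr a b -> dvdr a (c * b).
Proof. by case=> d ->; exists (c * d); rewrite mulrA. Qed.

Lemma dvdr_mulr a b c : dvdr a b -> dvdr a (b * c).
Proof. by rewrite mulrC; apply: dvdr_mull. Qed.

Lemma dvdr_trans a b c : dvdr a b -> dvdr b c -> dvdr a c.
Proof. by move=> ab [d ->]; apply: dvdr_mull. Qed.

Lemma dvdrD a b c : dvdr a b -> dvdr a c -> dvdr a (b + c).
Proof. by move=> [x ->] [y ->]; exists (x + y); rewrite mulrDl. Qed.

Lemma dvdrN a b : dvdr a b -> dvdr a (- b).
Proof. by move=> [x ->]; exists (- x); rewrite mulNr. Qed.

Lemma dvdr0 a : dvdr a 0. Proof. by exists 0; rewrite mul0r. Qed.

Lemma dvdr_unit a u : u \is a GRing.unit -> dvdr a u -> a \is a GRing.unit.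
Proof. by move=> uu [c e]; move: uu; rewrite e unitrM => /andP[]. Qed.

Lemma unit_neq0 (u : R) : u \is a GRing.unit -> u != 0.
Proof. by apply: contraTneq => ->; rewrite unitr0. Qed.

Lemma factored_neq0 a : factored a -> a != 0.
Proof.
by elim=> [u /unit_neq0 //|p b [p0 _ _] _ b0]; rewrite mulf_neq0.
Qed.

Lemma factoredM a b : factored a -> factored b -> factored (a * b).
Proof.
elim=> [u uu|p c pp _ ih] fb; last by rewrite -mulrA; apply: FactoredMul (ih fb).
elim: fb => [v vu|p c pp _ ih]; first by apply: FactoredUnit; rewrite unitrM uu.
by rewrite mulrCA; apply: FactoredMul.
Qed.

Lemma prime_factored p : prime_elt p -> factored p.
Proof.
by move=> pp; rewrite -[p]mulr1; apply: FactoredMul => //; apply: FactoredUnit (unitr1 _).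
Qed.

Lemma prime_dvd_prime p q : prime_elt p -> prime_elt q -> dvdr p q -> dvdr q p.
Proof.
move=> [p0 pu _] [q0 _ qP] [c e].
have [|[d ed]|//] := qP c p; first by rewrite -e; apply: dvdr_refl.
case/negP: pu; move: e; rewrite ed -{1}[q]mul1r mulrAC => /(mulIf q0) e.
by apply/unitrP; exists d; rewrite -e mulrC -e.
Qed.

(* If a prime power of [a] had no room in some [c i], it would be a common
   divisor of [a] and all the [c i]. *)
Lemma dvdr_cofactor (I : Type) a b (c : I -> R) : factored a ->
  (forall i, dvdr a (b * c i)) ->
  (forall p, prime_elt p -> dvdr p a -> exists i, ~ dvdr p (c i)) ->
  dvdr a b.
Proof.
move=> fa; elim: fa b => [u uu|p {}a pp _ ih] b h nc.
  by exists (b / u); rewrite divrK.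
have [i ni] := nc _ pp (dvdr_mulr _ (dvdr_refl p)).
have [_ _ pP] := pp; have p0 : p != 0 by case: pp.
have : dvdr p b.
  have := h i; move=> /(dvdr_trans (dvdr_mulr _ (dvdr_refl p))) /pP [] //.
case=> b' e; have [||d ed] := ih b'.
- move=> j; have [d e'] := h j; exists d; apply: (mulfI p0).
  by move: e'; rewrite e => e'; rewrite mulrA [p * b']mulrC e'; ring.
- by move=> q qp qa; apply: nc => //; apply: dvdr_mull.
- by exists d; rewrite e ed; ring.
Qed.

End Divisibility.

Definition factorial_domain (R : idomainType) := forall a : R, a != 0 -> factored a.

Section GaussLemma.
Variable R : idomainType.
Hypothesis Rfact : factorial_domain R.
Implicit Types (p c : R) (f g h : {poly R}).

Lemma dvdr_polyC p f : dvdr p%:P f <-> forall i, dvdr p f`_i.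
Proof.
split=> [[g ->] i|h]; first by rewrite coefMC; exists g`_i.
have {h} [g h] := choice h.
exists (\poly_(i < size f) g i); apply/polyP => i.
rewrite coefMC coef_poly; case: ltnP => [_|si]; first exact: h.
by rewrite mul0r nth_default.
Qed.

(** Gauss's lemma. If [i] and [j] are the first indices at which [p] fails to divide a coefficient
    of [f] and of [g], then every other term of the coefficient [i + j] of [f * g] has a factor of
    smaller index and is divisible by [p]. *)
Lemma prime_polyC p : prime_elt p -> prime_elt p%:P.
Proof.
move=> [p0 pu pP]; split; first by rewrite polyC_eq0.
  by rewrite poly_unitE size_polyC p0 coefC.
move=> f g /dvdr_polyC pfg.
have [pf|nf] := pselect (forall i, dvdr p f`_i); first by left; apply/dvdr_polyC.
have [pg|ng] := pselect (forall i, dvdr p g`_i); first by right; apply/dvdr_polyC.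
have ex (h : {poly R}) : ~ (forall i, dvdr p h`_i) ->
    exists i, ~ dvdr p h`_i /\ forall j, (j < i)%N -> dvdr p h`_j.
  move=> nh; have {nh} : exists i, `[< ~ dvdr p h`_i >].
    by apply: contrapT => H; apply: nh => i; apply: contrapT => ni; apply: H; exists i; apply/asboolP.
  move=> H; case: (ex_minnP H) => i /asboolP ni mi; exists i; split => // j ji.
  apply: contrapT => nj; have := mi j; rewrite leqNgt ji => H'.
  by have := H' (asboolT nj).
have [i [ni li]] := ex _ nf; have [j [nj lj]] := ex _ ng.
have := pfg (i + j)%N; rewrite coefM.
have ij : (i < (i + j).+1)%N by rewrite ltnS leq_addr.
rewrite (bigD1 (Ordinal ij)) //= addKn => H.
have H2 : dvdr p (\sum_(k < (i + j).+1 | k != Ordinal ij) f`_k * g`_(i + j - k)).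
  elim/big_ind: _ => [|x y|k nk]; [exact: dvdr0|exact: dvdrD|].
  have [ki|ki] := ltnP k i; first by apply: dvdr_mulr; apply: li.
  apply: dvdr_mull; apply: lj.
  have {}ki : (i < k)%N by rewrite ltn_neqAle ki andbT eq_sym.
  by rewrite ltn_subLR ?ltn_add2r // -ltnS ltn_ord.
have : dvdr p (f`_i * g`_j).
  by have := dvdrD H (dvdrN H2); rewrite addrK.
by case/pP.
Qed.

Lemma factored_polyC c : factored c -> factored c%:P.
Proof.
elim=> [u uu|p a pp _ ih]; last by rewrite polyCM; apply: FactoredMul (prime_polyC pp) ih.
by apply: FactoredUnit; rewrite poly_unitE size_polyC coefC /= uu andbT eqb1 unit_neq0.
Qed.

Definition primitive f := forall p, prime_elt p -> ~ dvdr p%:P f.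

(** The prime factors of [c] are cancelled one at a time: each divides [k * f] but not the primitive
    [f], hence divides [k]. *)
Lemma primitive_cancel c f g k : c != 0 -> primitive f -> c *: g = k * f -> dvdr f g.
Proof.
move=> /Rfact fc pf; elim: fc g k => [u uu|p a pp _ ih] g k e.
  by exists (u^-1 *: k); rewrite -scalerAl -e scalerA mulVr // scale1r.
have [_ _ /(_ k f) pP] := prime_polyC pp.
case: pP => [|[k' ek]|/(pf _ pp)//].
  by rewrite -e -mul_polyC polyCM -mulrA; apply: dvdr_mulr (dvdr_refl _).
apply: (ih g k'); have p0 : p%:P != 0 by rewrite polyC_eq0; case: pp.
by apply: (mulfI p0); rewrite mulrA [p%:P * k']mulrC -ek -e -!mul_polyC polyCM mulrA.
Qed.

(** The relation [%|] is divisibility up to a nonzero scalar, as over the fraction field. There the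
    Euclidean argument makes [f] prime, and primitivity turns this into divisibility in
    [{poly R}]. *)
Lemma irreducible_primitive_prime f : irreducible_poly f -> primitive f -> prime_elt f.
Proof.
move=> irrf pf; have f0 : f != 0 by rewrite -size_poly_gt0 ltnW // irrf.1.
split=> // [|g h [k e]].
  by rewrite poly_unitE; apply/negP => /andP[/eqP s1 _]; have := irrf.1; rewrite s1.
have key x : f %| x -> dvdr f x.
  by move=> /Pdiv.Idomain.dvdpP [[c k'] /= c0 e']; apply: primitive_cancel e'.
have fgh : f %| g * h by rewrite e dvdp_mull.
have [fg|nfg] := boolP (f %| g); first by left; apply: key.
right; apply: key; rewrite -(Gauss_dvdpr _ (_ : coprimep f g)) //.
by rewrite irreducible_poly_coprime.
Qed.

(** A constant dividing [f] divides its leading coefficient, so only the primes in a factorisation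
    of [lead_coef f] have to be tried. In the induction [a] is the part still to be tried, and [b]
    collects primes already known not to divide the polynomial. *)
Lemma content_primitive f : f != 0 ->
  exists c g, [/\ c != 0, f = c *: g & primitive g].
Proof.
move=> f0; have lf : lead_coef f != 0 by rewrite lead_coef_eq0.
suff key a : factored a -> forall f b, f != 0 -> lead_coef f = b * a ->
    (forall q, prime_elt q -> dvdr q%:P f -> ~ dvdr q b) ->
    exists c g, [/\ c != 0, f = c *: g & primitive g].
  apply: (key _ (Rfact lf) f 1) => //; first by rewrite mul1r.
  by move=> q [_ /negP qu _] _ /(dvdr_unit (unitr1 _)).
have dvdl q h : dvdr q%:P h -> dvdr q (lead_coef h).
  by move=> /dvdr_polyC; apply.
elim=> {f f0 lf a} [u uu|p a pp _ ih] f b f0 e nb.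
  exists 1, f; split; rewrite ?oner_neq0 ?scale1r // => q qp qf.
  apply: (nb q qp qf); have := dvdl _ _ qf; rewrite e => -[c ec].
  by exists (c / u); rewrite mulrAC -ec mulrK.
have p0 : p != 0 by case: pp.
have [[f' ef]|npf] := pselect (dvdr p%:P f).
  have f'0 : f' != 0 by apply: contraNneq f0 => f'0; rewrite ef f'0 mul0r.
  have [||q qp qf|c [g [c0 eg gp]]] := ih f' b => //.
  - apply: (mulIf p0); rewrite -[in LHS](lead_coefC p) -lead_coefM -ef e; ring.
  - by apply: nb => //; rewrite ef; apply: dvdr_mulr.
  - exists (p * c), g; split=> //; first by rewrite mulf_neq0.
    by rewrite ef eg -!mul_polyC polyCM; ring.
apply: (ih f (b * p)) => //; first by rewrite e mulrA.
move=> q qp qf qbp; have [_ _ qP] := qp; case: (qP _ _ qbp); first exact: nb qf.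
move=> /(prime_dvd_prime qp pp) [d ed]; apply: npf.
by apply: dvdr_trans qf; exists d%:P; rewrite -polyCM -ed.
Qed.

(** A factorisation over the fraction field, cleared of denominators by [c], descends to [R]: by
    Gauss's lemma each prime of [c] divides one of the two factors and can be cancelled there. The
    sizes are recorded for the induction on the degree. *)
Lemma primitive_split c f g h : c != 0 -> c *: f = g * h ->
  exists g' h', [/\ f = g' * h', size g' = size g & size h' = size h].
Proof.
move=> /Rfact fc; elim: fc g h => [u uu|p a pp _ ih] g h e.
  exists (u^-1 *: g), h; split=> //; last by rewrite size_scale // unit_neq0 ?unitrV.
  by rewrite -scalerAl -e scalerA mulVr // scale1r.
have [_ _ /(_ g h) pP] := prime_polyC pp.
have p0 : p != 0 by case: pp.
have pP0 : p%:P != 0 by rewrite polyC_eq0.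
have szp k : size (k * p%:P) = size k by rewrite mulrC mul_polyC size_scale.
case: pP => [|[k ek]|[k ek]].
- by rewrite -e -mul_polyC polyCM -mulrA; apply: dvdr_mulr (dvdr_refl _).
- have [|g' [h' [-> sg sh]]] := ih k h.
    by apply: (mulfI pP0); rewrite mulrA [p%:P * k]mulrC -ek -e -!mul_polyC polyCM mulrA.
  by exists g', h'; split; rewrite // ek szp.
- have [|g' [h' [-> sg sh]]] := ih g k.
    by apply: (mulfI pP0); rewrite mulrCA [p%:P * k]mulrC -ek -e -!mul_polyC polyCM mulrA.
  by exists g', h'; split; rewrite // ek szp.
Qed.

Lemma factorial_poly : factorial_domain {poly R}.
Proof.
move=> f; have [n] := ubnP (size f); elim: n f => // n ih f; rewrite ltnS => sf f0.
have [/size1_polyC e|s1] := leqP (size f) 1.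
  by move: f0; rewrite e polyC_eq0 => /Rfact /factored_polyC.
have [c [g [c0 e gp]]] := content_primitive f0.
rewrite e -mul_polyC; apply: factoredM; first exact/factored_polyC/Rfact.
have sg : size g = size f by rewrite e size_scale.
have g0 : g != 0 by rewrite -size_poly_gt0 sg ltnW.
have [irr|nirr] := pselect (irreducible_poly g).
  exact/prime_factored/irreducible_primitive_prime.
have [q [q1 qg nqg]] : exists q : {poly R}, [/\ size q != 1, q %| g & ~~ (q %= g)].
  apply: contrapT => H; apply: nirr; split; first by rewrite sg.
  by move=> q q1 qg; apply: contrapT => /negP nqg; apply: H; exists q.
have [[c' k] /= c'0 ek] := Pdiv.Idomain.dvdpP _ _ qg.
have [k' [q' [eg sk sq]]] := primitive_split c'0 ek.
have q0 : q != 0 by apply: contraTneq qg => ->; rewrite dvd0p.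
have kq0 : k' * q' != 0 by rewrite -eg.
move: (kq0); rewrite mulf_eq0 negb_or => /andP[k'0 q'0].
have sgk : size g = (size k' + size q').-1 by rewrite eg size_mul.
have sq1 : (1 < size q')%N by rewrite sq ltn_neqAle eq_sym q1 size_poly_gt0.
have sqg : (size q < size g)%N.
  by rewrite ltn_neqAle dvdp_leq // andbT; apply: contra nqg => s; rewrite -dvdp_size_eqp.
rewrite eg; apply: factoredM; apply: ih => //.
  apply: leq_trans sf; rewrite -sg sgk.
  by case: (size q') sq1 => [|[|m]] // _; rewrite !addnS /= ltnS leq_addr.
by apply: leq_trans sf; rewrite sq -sg.
Qed.

End GaussLemma.

Section MpolyMorphisms.
Variables (A S : comNzRingType) (n : nat).

Lemma mpoly_morph_ext (f g : {rmorphism {mpoly A[n]} -> S}) :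
  (forall c, f c%:MP = g c%:MP) -> (forall i, f 'X_i = g 'X_i) -> f =1 g.
Proof.
move=> fC fX P; rewrite (mpolyE P) !rmorph_sum; apply: eq_bigr => m _.
rewrite -mul_mpolyC !rmorphM fC mpolyXE_id !rmorph_prod; congr (_ * _).
by apply: eq_bigr => i _; rewrite !rmorphXn fX.
Qed.

End MpolyMorphisms.

Section LastVariable.
Variables (A : comNzRingType) (n : nat).

(** The inverse of [muni]. This isomorphism carries unique factorization and primality between
    polynomials in several variables and polynomials in the last one. *)
Definition unmuni : {rmorphism {poly {mpoly A[n]}} -> {mpoly A[n.+1]}} :=
  horner_morph (fun p : {mpoly A[n]} => mulrC 'X_ord_max (mwiden p)).

Lemma ord_maxVwiden (i : 'I_n.+1) :
  i = ord_max \/ exists j : 'I_n, i = widen_ord (leqnSn n) j.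
Proof.
have [ni|] := ltnP i n; first by right; exists (Ordinal ni); apply: val_inj.
by move=> ni; left; apply/val_inj/eqP; rewrite eqn_leq ni -ltnS ltn_ord.
Qed.

Lemma muni_last : muni ('X_ord_max : {mpoly A[n.+1]}) = 'X.
Proof.
rewrite muniE msuppX big_seq1 mcoeffX eqxx scale1r mnm1E eqxx expr1.
rewrite (_ : [multinom _ | i < n] = 0%MM) ?mpolyX0 ?scale1r //.
by apply/mnmP => i; rewrite !mnmE -val_eqE /= gtn_eqF.
Qed.

Lemma muni_widen (i : 'I_n) :
  muni ('X_(widen_ord (leqnSn n) i) : {mpoly A[n.+1]}) = ('X_i)%:P.
Proof.
rewrite muniE msuppX big_seq1 mcoeffX eqxx scale1r mnm1E -val_eqE /= ltn_eqF //.
rewrite expr0 alg_polyC; congr ('X_[_]%:P).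
by apply/mnmP => j; rewrite !mnmE -!val_eqE.
Qed.

Lemma muniK : cancel (@muni n A) unmuni.
Proof.
apply: (@mpoly_morph_ext _ _ _ (unmuni \o @muni n A) idfun) => [c|i] /=.
  by rewrite muniC horner_morphC /= mwidenC.
case: (ord_maxVwiden i) => [->|[j ->]]; first by rewrite muni_last horner_morphX.
by rewrite muni_widen horner_morphC /= mwidenX mnmwiden1.
Qed.

Lemma unmuniK : cancel unmuni (@muni n A).
Proof.
move=> q; elim/poly_ind: q => [|q c ih]; first by rewrite !rmorph0.
rewrite rmorphD rmorphM /= horner_morphX horner_morphC rmorphD rmorphM.
rewrite [X in X * _]ih [X in _ * X]muni_last; congr (_ + _).
apply: (@mpoly_morph_ext _ _ _ (@muni n A \o @mwiden n A) (@polyC _)) => [a|i] /=.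
  by rewrite mwidenC muniC.
by rewrite mwidenX mnmwiden1 muni_widen.
Qed.

Lemma meval_muni (v : 'I_n.+1 -> A) P :
  P.@[v] = (map_poly (meval (fun i : 'I_n => v (widen_ord (leqnSn n) i))) (muni P)).[v ord_max].
Proof.
set w := fun i : 'I_n => _.
pose ev : {rmorphism {poly {mpoly A[n]}} -> A} :=
  horner_morph (fun p : {mpoly A[n]} => mulrC (v ord_max) p.@[w]).
apply: (@mpoly_morph_ext _ _ _ (meval v) (ev \o @muni n A)) => [c|i] /=.
  by rewrite mevalC muniC horner_morphC /= mevalC.
rewrite mevalXU; case: (ord_maxVwiden i) => [->|[j ->]].
  by rewrite muni_last horner_morphX.
by rewrite muni_widen horner_morphC /= mevalXU.
Qed.

Definition extend_last (v : 'I_n -> A) (b : A) (i : 'I_n.+1) : A :=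
  if insub (val i) is Some j then v j else b.

Lemma meval_extend (v : 'I_n -> A) b P :
  P.@[extend_last v b] = (map_poly (meval v) (muni P)).[b].
Proof.
rewrite meval_muni /extend_last /= insubF ?ltnn //; congr (_.[_]).
apply: eq_map_poly => c; apply: meval_eq => i /=.
by rewrite insubT //= => lt; congr v; apply: val_inj.
Qed.

End LastVariable.

Section Isomorphism.
Variables (A S : idomainType) (f : {rmorphism A -> S}) (g : {rmorphism S -> A}).
Hypotheses (fK : cancel f g) (gK : cancel g f).

Lemma iso_prime p : prime_elt p -> prime_elt (f p).
Proof.
have dvd b c : dvdr (f b) c -> dvdr b (g c).
  by move=> [d ->]; exists (g d); rewrite rmorphM fK.
move=> [p0 pu pP]; split.
- by apply: contraNneq p0 => e; rewrite -[p]fK e rmorph0.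
- by apply: contraNN pu => /(rmorph_unit g); rewrite fK.
- move=> b c /dvd; rewrite rmorphM => /pP [] [d e]; [left|right];
  by exists (f d); rewrite -rmorphM -e gK.
Qed.

Lemma iso_factorial : factorial_domain A -> factorial_domain S.
Proof.
move=> Af a a0; rewrite -[a]gK.
have : g a != 0 by apply: contraNneq a0 => e; rewrite -[a]gK e rmorph0.
move/Af; elim=> [u uu|p b pp _ ih]; first exact/FactoredUnit/rmorph_unit.
by rewrite rmorphM; apply: FactoredMul (iso_prime pp) ih.
Qed.

End Isomorphism.

Lemma mpoly0C (A : nzRingType) (P : {mpoly A[0]}) : P = (P@_0)%:MP.
Proof.
by apply/mpolyP => m; rewrite mcoeffC [m](_ : _ = 0%MM) ?eqxx ?mulr1 //; apply/mnmP => -[].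
Qed.

Lemma factorial_mpoly (F : fieldType) n : factorial_domain {mpoly F[n]}.
Proof.
elim: n => [|n ih].
  move=> P P0; apply: FactoredUnit.
  have e := mpoly0C P.
  have c0 : P@_0 != 0 by apply: contraNneq P0 => c0; rewrite e c0.
  apply/unitrP; exists (P@_0)^-1%:MP.
  by rewrite {2 3}e -!mpolyCM mulVf ?mulfV.
by apply: (iso_factorial (@unmuniK F n) (@muniK F n)); apply: factorial_poly.
Qed.

Section Elimination.
Variable R : idomainType.
Implicit Types p q : {poly R}.

(** A prime of positive degree that does not divide [p] is coprime to [p] over the fraction field:
    it cannot divide a nonzero constant, so denominators do no harm. The Bezout relation cleared of
    denominators has the eliminant [r] on the right. *)
Lemma prime_elimination q p : prime_elt q -> (1 < size q)%N -> ~ dvdr q p ->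
  exists (u w : {poly R}) (r : R), r != 0 /\ u * q + w * p = r%:P.
Proof.
move=> qp sq nqp; have [q0 _ qP] := qp.
have key x : q %| x -> dvdr q x.
  move=> /Pdiv.Idomain.dvdpP [[c k] /= c0 e].
  have : dvdr q (c%:P * x) by rewrite mul_polyC; exists k.
  case/qP => // -[d ed]; have := c0; rewrite -polyC_eq0 ed mulf_eq0 negb_or.
  move=> /andP[d0 _]; have := congr1 (fun p : {poly R} => size p) ed.
  rewrite size_polyC c0 size_mul // => H.
  by move: sq H; case: (size q) => [|[|s]] //=; rewrite !addnS -size_poly_gt0 in d0 *; case: (size d) d0.
have cop : coprimep q p.
  have dq := dvdp_gcdl q p; have dp := dvdp_gcdr q p; rewrite coprimep_def.
  set d := gcdp q p in dq dp *.
  have [[c k] /= c0 e] := Pdiv.Idomain.dvdpP _ _ dq.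
  have d0 : d != 0 by apply: contraTneq dq => ->; rewrite dvd0p.
  have : dvdr q (k * d) by rewrite -e -mul_polyC; exists c%:P.
  case/qP => [[k' ek]|[k' ek]].
    have ec : c%:P = k' * d.
      by apply: (mulIf q0); rewrite mul_polyC e ek; ring.
    have : size (k' * d) == 1 by rewrite -ec size_polyC c0.
    by rewrite size_mul_eq1 => /andP[].
  by case: nqp; apply: key; apply: dvdp_trans dp; rewrite ek dvdp_mull.
have [[u w] /= e] := Bezout_coprimepP _ _ cop.
have := e; rewrite -size_poly_eq1 => /eqP s1.
exists u, w, (u * q + w * p)`_0.
have ee : u * q + w * p = ((u * q + w * p)`_0)%:P by apply: size1_polyC; rewrite s1.
by split=> //; rewrite -polyC_eq0 -ee -size_poly_eq0 s1.
Qed.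

Lemma eliminant_root (S : comNzRingType) (phi : {rmorphism R -> S}) b q p
    (u w : {poly R}) (r : R) : u * q + w * p = r%:P ->
  (map_poly phi q).[b] = 0 -> (map_poly phi p).[b] = 0 -> phi r = 0.
Proof.
move=> e qb pb; have := congr1 (fun x => (map_poly phi x).[b]) e.
rewrite rmorphD hornerD !rmorphM !hornerM qb pb !mulr0 addr0.
by rewrite map_polyC hornerC.
Qed.

End Elimination.

Lemma polyX_prime (A : idomainType) : prime_elt ('X : {poly A}).
Proof.
have dvdX (q : {poly A}) : dvdr 'X q <-> q`_0 = 0.
  split=> [[c ->]|q0]; first by rewrite coefMX.
  exists (\poly_(i < (size q).-1) q`_i.+1); apply/polyP => -[|i]; rewrite coefMX //=.
  by rewrite coef_poly; case: ltnP => // si; rewrite nth_default //; case: (size q) si.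
split; rewrite ?polyX_eq0 ?poly_unitE ?size_polyX //.
by move=> b c /dvdX; rewrite coef0M => /eqP; rewrite mulf_eq0 => /orP[] /eqP /dvdX; [left|right].
Qed.

Section MuniPrime.
Variables (R : idomainType) (n : nat).
Implicit Types f P : {mpoly R[n.+1]}.

Lemma muni_dvdr f P : dvdr (muni f) (muni P) -> dvdr f P.
Proof.
move=> [c e]; exists (unmuni _ _ c); apply: (can_inj (@muniK _ _)).
by rewrite muniM unmuniK.
Qed.

Lemma muni_prime f : prime_elt f -> prime_elt (muni f).
Proof. exact: (iso_prime (@muniK R n) (@unmuniK R n)). Qed.

Lemma prime_last_variable : prime_elt ('X_ord_max : {mpoly R[n.+1]}).
Proof.
rewrite -[X in prime_elt X]muniK muni_last.
exact: (iso_prime (@unmuniK R n) (@muniK R n) (polyX_prime _)).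
Qed.

End MuniPrime.

(** * The Nullstellensatz for one prime polynomial *)

Section Nullstellensatz.
Variable K : numClosedFieldType.

Lemma poly_nonroot (q : {poly K}) : q != 0 -> exists b, q.[b] != 0.
Proof.
move=> q0; apply: contrapT => H; case/eqP: q0.
apply: (@roots_geq_poly_eq0 _ _ [seq k%:R | k <- iota 0 (size q)]).
- apply/allP => _ /mapP[k _ ->]; apply/rootP/eqP; apply: contrapT => /negP nz.
  by apply: H; exists k%:R.
- by rewrite map_inj_uniq ?iota_uniq // => i j /eqP; rewrite eqr_nat => /eqP.
- by rewrite size_map size_iota.
Qed.

Lemma mpoly_nonroot n (P : {mpoly K[n]}) : P != 0 -> exists v, P.@[v] != 0.
Proof.
elim: n P => [|n ih] P P0.
  exists (fun=> 0); apply: contraNneq P0.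
  have e := mpoly0C P.
  by rewrite e mevalC => ->.
have q0 : muni P != 0 by apply: contraNneq P0 => e; rewrite -[P]muniK e rmorph0.
have lP : lead_coef (muni P) != 0 by rewrite lead_coef_eq0.
have [v vP] := ih _ lP.
have [b bP] : exists b, (map_poly (meval v) (muni P)).[b] != 0.
  apply: poly_nonroot; rewrite -lead_coef_eq0 lead_coef_map_eq //.
by exists (extend_last v b); rewrite meval_extend.
Qed.

(** If the last variable occurs in [f], the other coordinates are chosen off the zeros of the
    eliminant and of the leading coefficient: then [f] has a root in the last variable, and [P]
    cannot vanish there. If it does not occur, the induction applies to a coefficient of [P] that
    [f] does not divide. *)
Lemma hypersurface_nullstellensatz n (f P : {mpoly K[n]}) :
  prime_elt f -> ~ dvdr f P -> exists v, f.@[v] = 0 /\ P.@[v] != 0.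
Proof.
elim: n f P => [|n ih] f P fp nfP.
  have [f0 /negP fu _] := fp; case: fu.
  have e := mpoly0C f.
  have c0 : f@_0 != 0 by apply: contraNneq f0 => c0; rewrite e c0.
  by apply/unitrP; exists (f@_0)^-1%:MP; rewrite {2 3}e -!mpolyCM mulVf ?mulfV.
have qp := muni_prime fp.
have nqp : ~ dvdr (muni f) (muni P) by move=> /muni_dvdr.
have q0 : muni f != 0 by case: qp.
have [sq|sq] := leqP (size (muni f)) 1.
  have ef := size1_polyC sq; set c := (muni f)`_0 in ef.
  have cp : prime_elt c.
    move: qp; rewrite ef => -[c0 cu cP]; split.
    - by rewrite -polyC_eq0.
    - by apply: contraNN cu => cu; exact: (rmorph_unit (@polyC _) cu).
    - move=> a b [d e]; have [|h|h] := cP a%:P b%:P.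
      + by exists d%:P; rewrite -!polyCM e.
      + by left; have := (dvdr_polyC _ _).1 h 0%N; rewrite coefC.
      + by right; have := (dvdr_polyC _ _).1 h 0%N; rewrite coefC.
  have [i ni] : exists i, ~ dvdr c (muni P)`_i.
    apply: contrapT => H; apply: nqp; rewrite ef; apply/dvdr_polyC => i.
    by apply: contrapT => ni; apply: H; exists i.
  have [v [v0 vP]] := ih _ _ cp ni.
  have [b bP] : exists b, (map_poly (meval v) (muni P)).[b] != 0.
    apply: poly_nonroot; apply: contraNneq vP => /(congr1 (fun p : {poly K} => p`_i)).
    by rewrite coef_map coef0 => ->.
  exists (extend_last v b); rewrite !meval_extend; split=> //.
  by rewrite ef map_polyC hornerC /= v0.
have [u [w [r [r0 e]]]] := prime_elimination qp sq nqp.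
have lr0 : lead_coef (muni f) * r != 0 by rewrite mulf_neq0 // lead_coef_eq0.
have [v] := mpoly_nonroot lr0; rewrite mevalM mulf_eq0 negb_or => /andP[vl vr].
have [b /rootP rb] : exists b, root (map_poly (meval v) (muni f)) b.
  by apply/closed_rootP; rewrite size_map_poly_id0 // gtn_eqF.
exists (extend_last v b); rewrite !meval_extend; split=> //.
apply: contraNneq vr => pb.
by rewrite (eliminant_root e rb pb).
Qed.

End Nullstellensatz.

(** * Forms and points of projective space *)

Section Forms.
Variable K : numClosedFieldType.

Lemma poly_ext_nz (p q : {poly K}) : (forall t, t != 0 -> p.[t] = q.[t]) -> p = q.
Proof.
move=> h; apply/eqP; rewrite -subr_eq0; set r := p - q; apply/eqP.
apply: (@roots_geq_poly_eq0 _ _ [seq k.+1%:R | k <- iota 0 (size r)]).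
- apply/allP => _ /mapP[k _ ->]; apply/rootP.
  by rewrite hornerD hornerN h ?pnatr_eq0 // subrr.
- by rewrite map_inj_uniq ?iota_uniq // => i j /eqP; rewrite eqr_nat => /eqP[].
- by rewrite size_map size_iota.
Qed.

Lemma mpoly_ring_ind (A : comNzRingType) n (S : {mpoly A[n]} -> Prop) :
  (forall c, S c%:MP) -> (forall i, S 'X_i) ->
  (forall P Q, S P -> S Q -> S (P + Q)) -> (forall P Q, S P -> S Q -> S (P * Q)) ->
  forall P, S P.
Proof.
move=> SC SX SD SM P; rewrite (mpolyE P).
elim/big_ind: _ => [|//|m _]; first by rewrite -mpolyC0.
rewrite -mul_mpolyC mpolyXE_id; apply: (SM) => //.
elim/big_ind: _ => [|//|i _]; first by rewrite -mpolyC1.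
by elim: (m i) => [|k ih]; rewrite ?expr0 ?exprS -?mpolyC1 //; apply: (SM).
Qed.

Lemma veval_ext N (P Q : {mpoly K[N.+1]}) : (forall v, veval P v = veval Q v) -> P = Q.
Proof.
move=> h; apply/eqP; rewrite -subr_eq0; apply/eqP/eqP; apply: contrapT => /negP nz.
have [v] := mpoly_nonroot nz; rewrite mevalB.
have e R : R.@[v] = veval R (\row_i v i).
  by rewrite /veval; apply: meval_eq => i; rewrite mxE.
by rewrite !e h subrr eqxx.
Qed.

Lemma veval_neq0 N (P : {mpoly K[N.+1]}) : P != 0 -> exists v, veval P v != 0.
Proof.
move=> /mpoly_nonroot [v vP]; exists (\row_i v i).
by rewrite /veval (@meval_eq _ _ _ v) // => i; rewrite mxE.
Qed.

Lemma nullstellensatz_row N (f P : {mpoly K[N.+1]}) : prime_elt f -> ~ dvdr f P ->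
  exists v, veval f v = 0 /\ veval P v != 0.
Proof.
move=> fp nf; have [v [v0 vP]] := hypersurface_nullstellensatz fp nf.
exists (\row_i v i).
by rewrite /veval !(@meval_eq _ _ (fun i => (\row_i v i) 0 i) v) // => i; rewrite mxE.
Qed.

Lemma mpoly_unit_const n (P : {mpoly K[n]}) : P \is a GRing.unit -> exists2 c, c != 0 & P = c%:MP.
Proof.
rewrite qualifE /= => /andP[/eqP e u]; exists P@_0 => //.
by apply: contraTneq u => ->; rewrite unitr0.
Qed.

Lemma mpolyC_unit n (c : K) : c != 0 -> (c%:MP : {mpoly K[n]}) \is a GRing.unit.
Proof.
by move=> c0; apply/unitrP; exists c^-1%:MP; rewrite -!mpolyCM mulVf ?mulfV.
Qed.

Lemma homog0_const n (P : {mpoly K[n]}) : P \is 0.-homog -> P = (P@_0)%:MP.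
Proof.
move=> h; apply/mpolyP => m; rewrite mcoeffC eq_sym.
have [->|m0] := eqVneq m 0%MM; first by rewrite mulr1.
by rewrite mulr0 (dhomog_nemf_coeff h) //= mdeg_eq0.
Qed.

Lemma homogC n (c : K) : (c%:MP : {mpoly K[n]}) \is 0.-homog.
Proof. by rewrite -[c%:MP]mulr1 mul_mpolyC; apply: dhomogZ; apply: dhomog1. Qed.

Lemma homogX n (i : 'I_n) : ('X_i : {mpoly K[n]}) \is 1.-homog.
Proof. by rewrite dhomogX /= mdeg1. Qed.

Section FixedN.
Variable N : nat.
Implicit Types (P Q : {mpoly K[N.+1]}) (u v : 'rV[K]_N.+1).

Lemma vevalD P Q v : veval (P + Q) v = veval P v + veval Q v.
Proof. exact: mevalD. Qed.
Lemma vevalB P Q v : veval (P - Q) v = veval P v - veval Q v.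
Proof. exact: mevalB. Qed.
Lemma vevalN P v : veval (- P) v = - veval P v.
Proof. exact: mevalN. Qed.
Lemma vevalM P Q v : veval (P * Q) v = veval P v * veval Q v.
Proof. exact: mevalM. Qed.
Lemma vevalZ c P v : veval (c *: P) v = c * veval P v.
Proof. exact: mevalZ. Qed.
Lemma vevalXn P k v : veval (P ^+ k) v = veval P v ^+ k.
Proof. exact: (rmorphXn (meval (v 0))). Qed.
Lemma vevalC c v : veval c%:MP v = c.
Proof. exact: mevalC. Qed.
Lemma veval1 v : veval 1 v = 1.
Proof. exact: meval1. Qed.
Lemma veval0 v : veval 0 v = 0.
Proof. exact: meval0. Qed.
Lemma vevalX i v : veval 'X_i v = v 0 i.
Proof. exact: mevalXU. Qed.
Lemma veval_sum I (r : seq I) (p : pred I) (F : I -> {mpoly K[N.+1]}) v :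
  veval (\sum_(i <- r | p i) F i) v = \sum_(i <- r | p i) veval (F i) v.
Proof. exact: (rmorph_sum (meval (v 0))). Qed.

Lemma homog_char d P :
  (forall t v, t != 0 -> veval P (t *: v) = t ^+ d * veval P v) -> P \is d.-homog.
Proof.
move=> h; suff -> : P = pihomog mdeg d P by apply: pihomogP.
apply: veval_ext => v; rewrite -linepoly_coef.
suff -> : linepoly P v = veval P v *: 'X^d by rewrite coefZ coefXn eqxx mulr1.
by apply: poly_ext_nz => t t0; rewrite linepolyE h // !hornerE mulrC.
Qed.

Lemma homog_eval0 d P : P \is d.-homog -> (0 < d)%N -> veval P 0 = 0.
Proof.
by move=> h d0; have := homog_scale 0 0 h; rewrite scale0r expr0n gtn_eqF // mul0r.
Qed.

(** On a line through the origin where [P * Q] is not zero, the restrictions of [P] and [Q] multiply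
    to a monomial, so each is a monomial. Two nonzero homogeneous components of [P] would both be
    nonzero on some such line. *)
Lemma factor_homog d P Q : P * Q != 0 -> P * Q \is d.-homog ->
  exists e, (e <= d)%N /\ P \is e.-homog.
Proof.
move=> PQ0 h; have [v0 ev0] := veval_neq0 PQ0.
have lineM v : linepoly P v * linepoly Q v = veval (P * Q) v *: 'X^d.
  apply: poly_ext_nz => t _; rewrite hornerM !linepolyE -vevalM (homog_scale _ _ h).
  by rewrite !hornerE mulrC.
have mono v : veval (P * Q) v != 0 -> exists2 e, (e <= d)%N & forall k, k != e -> veval (pihomog mdeg k P) v = 0.
  move=> ev; have : linepoly P v %| ('X - 0%:P) ^+ d.
    rewrite subr0 -(dvdpZr _ _ ev) -lineM; exact: dvdp_mulr.
  move/dvdp_exp_XsubCP => [e ed] /eqpP[[a b] /= /andP[a0 b0] eq].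
  exists e => // k ke; rewrite -linepoly_coef; apply: (mulfI a0).
  by rewrite -coefZ eq subr0 coefZ coefXn (negbTE ke) !mulr0.
have [e ed he] := mono _ ev0; exists e; split => //.
suff hk k : k != e -> pihomog mdeg k P = 0.
  suff -> : P = pihomog mdeg e P by apply: pihomogP.
  apply: veval_ext => v; rewrite -{1}[v]scale1r -linepolyE -linepoly_coef.
  rewrite {1}(_ : linepoly P v = (linepoly P v)`_e *: 'X^e) ?hornerE ?expr1n ?mulr1 //.
  apply/polyP => k; rewrite coefZ coefXn; have [->|ke] := eqVneq k e; first by rewrite mulr1.
  by rewrite mulr0 linepoly_coef hk // veval0.
move=> ke; apply/eqP; apply: contrapT => /negP pk.
have pe : pihomog mdeg e P != 0.
  apply: contraNneq ev0 => pe; rewrite vevalM -[v0]scale1r -linepolyE.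
  rewrite (_ : linepoly P v0 = 0) ?horner0 ?mul0r //; apply/polyP => j.
  rewrite coef0 linepoly_coef; have [->|/he//] := eqVneq j e.
  by rewrite pe veval0.
have [v] := veval_neq0 (mulf_neq0 (mulf_neq0 pk pe) PQ0).
rewrite !(vevalM (_ * _)) mulf_eq0 negb_or => /andP[]; rewrite vevalM mulf_eq0 negb_or.
move=> /andP[vk ve] /mono [j _ hj].
have kj : k = j by apply/eqP; apply: contraNT vk => /hj ->.
have ej : e = j by apply/eqP; apply: contraNT ve => /hj ->.
by move: ke; rewrite kj ej eqxx.
Qed.

Lemma mderiv_homog d P i : P \is d.-homog -> P^`M(i) \is d.-1.-homog.
Proof.
move=> h; rewrite (mpolyE P) raddf_sum /= big_seq; apply: rpred_sum => m mP.
rewrite mderivZ mderivX; apply: rpredZ.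
have [->|mi] := posnP (m i); first by rewrite scale0r rpred0.
apply: rpredZ; rewrite dhomogX /= -(dhomogP _ _ _ h _ mP) /=.
have /submK {2}<- : (U_(i) <= m)%MM.
  by apply/mnm_lepP => j; rewrite mnm1E; case: eqP => // <-.
by rewrite mdegD mdeg1 addn1.
Qed.

End FixedN.

Section LinearSubstitution.
Variables m n : nat.
Implicit Types (B : 'M[K]_(m.+1, n.+1)) (P : {mpoly K[n.+1]}).

Definition lsub B : {rmorphism {mpoly K[n.+1]} -> {mpoly K[m.+1]}} :=
  comp_mpoly [tuple \sum_i B i j *: 'X_i | j < n.+1].

Lemma veval_lsub B P v : veval (lsub B P) v = veval P (v *m B).
Proof.
rewrite /veval /lsub /= comp_mpoly_meval; apply: meval_eq => j.
rewrite tnth_mktuple mxE; rewrite (rmorph_sum (meval (v 0))).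
by apply: eq_bigr => i _; rewrite [LHS]mevalZ mevalXU mulrC.
Qed.

Lemma lsub_homog d B P : P \is d.-homog -> lsub B P \is d.-homog.
Proof.
move=> h; apply: homog_char => t v _.
by rewrite !veval_lsub -scalemxAl (homog_scale _ _ h).
Qed.

End LinearSubstitution.

Lemma lsub_comp m n k (B : 'M[K]_(m.+1, n.+1)) (C : 'M[K]_(n.+1, k.+1)) P :
  lsub B (lsub C P) = lsub (B *m C) P.
Proof. by apply: veval_ext => v; rewrite !veval_lsub mulmxA. Qed.

Lemma lsub1 n (P : {mpoly K[n.+1]}) : lsub 1%:M P = P.
Proof. by apply: veval_ext => v; rewrite veval_lsub mulmx1. Qed.

Section Curve.
Variable n : nat.
Implicit Types (a : 'I_n -> {poly K}) (P : {mpoly K[n]}).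

Definition along a : {rmorphism {mpoly K[n]} -> {poly K}} := mmap (@polyC K) a.

Lemma alongC a c : along a c%:MP = c%:P. Proof. exact: mmapC. Qed.

Lemma alongX a i : along a 'X_i = a i.
Proof. by rewrite /along /= mmapX mmap1U. Qed.

Lemma horner_along a P t : (along a P).[t] = P.@[fun i => (a i).[t]].
Proof.
apply: (@mpoly_morph_ext _ _ _ (horner_eval t \o along a) (meval (fun i => (a i).[t]))) => [c|i] /=.
  by rewrite mmapC /horner_eval hornerC mevalC.
by rewrite mmapX mmap1U /horner_eval mevalXU.
Qed.

Lemma deriv_along a P : (along a P)^`() = \sum_i along a P^`M(i) * (a i)^`().
Proof.
elim/mpoly_ring_ind: P => [c|i|P Q hP hQ|P Q hP hQ].
- rewrite alongC derivC big1 // => i _; by rewrite mderivC rmorph0 mul0r.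
- rewrite alongX (bigD1 i) //= big1 ?addr0 => [|j ji].
    have e : (U_(i) - U_(i))%MM = 0%MM :> 'X_{1..n} by apply/mnmP => j; rewrite !mnmE subnn.
    by rewrite mderivX mnm1E eqxx scale1r e mpolyX0 rmorph1 mul1r.
  by rewrite mderivX mnm1E eq_sym (negbTE ji) scale0r rmorph0 mul0r.
- rewrite rmorphD derivD hP hQ -big_split; apply: eq_bigr => i _.
  by rewrite mderivD rmorphD mulrDl.
- rewrite rmorphM derivM hP hQ mulr_suml mulr_sumr -big_split; apply: eq_bigr => i _ /=.
  by rewrite mderivM rmorphD !rmorphM /=; ring.
Qed.

End Curve.

(** Euler's identity, by differentiating [t ^+ d * veval P v] along the line through [v] at
    [t = 1]. *)
Lemma euler_homog N d (P : {mpoly K[N.+1]}) (v : 'rV[K]_N.+1) : P \is d.-homog ->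
  \sum_i v 0 i * veval P^`M(i) v = d%:R * veval P v.
Proof.
move=> h; pose a i := v 0 i *: 'X : {poly K}.
have ha t : (fun i => (a i).[t]) =1 (t *: v) 0 by move=> i; rewrite !hornerE mxE mulrC.
have e : along a P = veval P v *: 'X^d.
  apply: poly_ext_nz => t _; rewrite horner_along (meval_eq _ (ha _)).
  by rewrite -/(veval _ _) (homog_scale _ _ h) !hornerE mulrC.
have := congr1 (fun q => q^`().[1]) e; rewrite deriv_along horner_sum.
rewrite derivZ derivXn !hornerE hornerMn hornerXn expr1n mulr_natr mulr_natl => <-.
apply: eq_bigr => i _; rewrite hornerM horner_along (meval_eq _ (ha _)) scale1r.
by rewrite /a derivZ derivX hornerZ hornerC mulr1 mulrC.
Qed.

Lemma deriv_line N (P : {mpoly K[N.+1]}) (y u : 'rV[K]_N.+1) :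
  exists q : {poly K}, (forall t, q.[t] = veval P (y + t *: u)) /\
    q^`().[0] = \sum_i veval P^`M(i) y * u 0 i.
Proof.
pose a i := (y 0 i)%:P + u 0 i *: 'X : {poly K}.
have ha t : (fun i => (a i).[t]) =1 (y + t *: u) 0.
  by move=> i; rewrite !hornerE !mxE [t * _]mulrC.
exists (along a P); split=> [t|]; first by rewrite horner_along (meval_eq _ (ha _)).
rewrite deriv_along horner_sum; apply: eq_bigr => i _.
rewrite hornerM horner_along (meval_eq _ (ha _)) scale0r addr0.
by rewrite derivD derivC derivZ derivX add0r hornerZ hornerC mulr1.
Qed.

End Forms.

Arguments lsub : simpl never.
Arguments along : simpl never.

Lemma mpolyXU_neq0 (A : nzRingType) n (i : 'I_n) : 'X_i != 0 :> {mpoly A[n]}.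
Proof.
apply/eqP => /(congr1 (mcoeff U_(i)%MM)).
by rewrite mcoeffX eqxx mcoeff0 => /eqP; rewrite oner_eq0.
Qed.

Section Points.
Variables (K : numClosedFieldType) (N : nat).
Local Notation pspace := (pspace K N).
Local Notation nzvec := (nzvec K N).
Implicit Types (p q : pspace) (u v : 'rV[K]_N.+1) (P : {mpoly K[N.+1]}).

Lemma ones_neq0 : (const_mx 1 : 'rV[K]_N.+1) != 0.
Proof. by apply/eqP => /rowP /(_ 0); rewrite !mxE => /eqP; rewrite oner_eq0. Qed.

(* A junk point when [v = 0]. *)
Definition pof v : pspace :=
  ppoint (insubd (exist (fun v : 'rV[K]_N.+1 => v != 0) _ ones_neq0 : nzvec) v).

Lemma pcoord_neq0 p : pcoord p != 0. Proof. exact: valP (repr p). Qed.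

Lemma pcoord_pof v : v != 0 -> exists2 a, a != 0 & pcoord (pof v) = a *: v.
Proof.
move=> v0; rewrite /pof; have [a a0 ->] := pcoord_ppoint (insubd (exist (fun v : 'rV[K]_N.+1 => v != 0) _ ones_neq0 : nzvec) v).
by exists a => //; rewrite insubdK.
Qed.

Lemma pof_val (u : nzvec) : pof (val u) = ppoint u.
Proof.
apply: (ppointZ (oner_neq0 _)).
by rewrite scale1r insubdK // -topredE /= (valP u).
Qed.

Lemma pofZ a v : a != 0 -> v != 0 -> pof (a *: v) = pof v.
Proof.
move=> a0 v0; apply: (ppointZ a0); rewrite !insubdK //.
by rewrite -topredE /= scaler_eq0 negb_or a0.
Qed.

Lemma pof_pcoord p : pof (pcoord p) = p.
Proof.
rewrite -[RHS]reprK; apply: (ppointZ (oner_neq0 _)).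
by rewrite scale1r insubdK // -topredE /= pcoord_neq0.
Qed.

Lemma pof_inj u v : u != 0 -> v != 0 -> pof u = pof v -> exists2 a, a != 0 & u = a *: v.
Proof.
move=> u0 v0 e; have [a a0 ea] := pcoord_pof u0; have [b b0 eb] := pcoord_pof v0.
exists (a^-1 * b); first by rewrite mulf_neq0 ?invr_eq0.
by rewrite -scalerA -eb -e ea scalerA mulVf ?scale1r.
Qed.

Lemma pof_ind (S : pspace -> Prop) : (forall v, v != 0 -> S (pof v)) -> forall p, S p.
Proof. by move=> h p; rewrite -(pof_pcoord p); apply: h; apply: pcoord_neq0. Qed.

Lemma homog_eq0Z d P a v : P \is d.-homog -> a != 0 ->
  (veval P (a *: v) == 0) = (veval P v == 0).
Proof. by move=> h a0; rewrite (homog_scale _ _ h) mulf_eq0 expf_eq0 (negbTE a0) andbF. Qed.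

Lemma heval_pof d P v : P \is d.-homog -> v != 0 -> (heval P (pof v) == 0) = (veval P v == 0).
Proof. by move=> h v0; have [a a0 e] := pcoord_pof v0; rewrite /heval e (homog_eq0Z _ h). Qed.

Lemma vanishingP (Z : set pspace) P :
  reflect (forall v, v != 0 -> Z (pof v) -> veval P v = 0) (P \in vanishing Z).
Proof.
apply: (iffP (asboolP _)) => h.
  move=> v v0; have := h (exist (fun v : 'rV[K]_N.+1 => v != 0) v v0).
  by rewrite -pof_val.
by move=> v; rewrite -pof_val; exact: (h _ (valP v)).
Qed.

Lemma vanishing_homog (Z : set pspace) d P : P \is d.-homog ->
  (P \in vanishing Z <-> forall p, Z p -> heval P p = 0).
Proof.
move=> h; split=> [/vanishingP H p Zp|H].
  by apply: H; rewrite ?pcoord_neq0 ?pof_pcoord.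
by apply/vanishingP => v v0 /H /eqP; rewrite (heval_pof h) // => /eqP.
Qed.

Lemma veval_ext_nz (P Q : {mpoly K[N.+1]}) : (forall v, v != 0 -> veval P v = veval Q v) -> P = Q.
Proof.
move=> h; have X0 : 'X_ord0 != 0 :> {mpoly K[N.+1]} by exact: mpolyXU_neq0.
apply: (mulfI X0); apply: veval_ext => v; rewrite !vevalM vevalX.
by have [->|/h ->//] := eqVneq v 0; rewrite mxE !mul0r.
Qed.

Lemma closed_sep (Z : set pspace) p : closed_set Z -> ~ Z p ->
  exists d P, [/\ P \is d.-homog, forall q, Z q -> heval P q = 0 & heval P p != 0].
Proof.
move=> [S Sh ZS] nZ; apply: contrapT => H; apply: nZ; apply/ZS => P SP.
have [d hP] := Sh _ SP; apply/eqP; apply: contrapT => /negP nz; apply: H.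
by exists d, P; split=> // q /ZS; apply.
Qed.

Lemma closed_setU (Z1 Z2 : set pspace) : closed_set Z1 -> closed_set Z2 -> closed_set (Z1 `|` Z2).
Proof.
move=> c1 c2.
exists [set P | (exists d, P \is d.-homog) /\ forall q, (Z1 `|` Z2) q -> heval P q = 0].
  by move=> P [].
move=> p; split=> [Zp P [_ h]|h]; first exact: h.
apply: contrapT => nZ.
have n1 : ~ Z1 p by move=> z; apply: nZ; left.
have n2 : ~ Z2 p by move=> z; apply: nZ; right.
have [d1 [P1 [h1 v1 z1]]] := closed_sep c1 n1; have [d2 [P2 [h2 v2 z2]]] := closed_sep c2 n2.
have : heval (P1 * P2) p = 0.
  apply: h; split=> [|q]; first by exists (d1 + d2)%N; apply: dhomogM.
  by rewrite /heval vevalM -!/(heval _ _) => -[/v1|/v2] ->; rewrite ?mul0r ?mulr0.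
by rewrite /heval vevalM => /eqP; rewrite mulf_eq0 (negbTE z1) (negbTE z2).
Qed.

Lemma closed_setI (Z1 Z2 : set pspace) : closed_set Z1 -> closed_set Z2 -> closed_set (Z1 `&` Z2).
Proof.
move=> [S1 h1 e1] [S2 h2 e2]; exists (S1 `|` S2) => [P [/h1|/h2]//|p].
split=> [[/e1 a1 /e2 a2] P [/a1|/a2]//|h].
by split; [apply/e1 => P SP|apply/e2 => P SP]; apply: h; [left|right].
Qed.

Lemma closed_set0 : closed_set (set0 : set pspace).
Proof.
exists [set 1] => [P ->|p]; first by exists 0%N; apply: dhomog1.
split=> [//|/(_ 1 erefl)]; rewrite /heval veval1 => /eqP; rewrite oner_eq0 //.
Qed.

Lemma irreducible_big (I : eqType) (s : seq I) (F : I -> set pspace) (Z : set pspace) :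
  irreducible_set Z -> (forall i, i \in s -> closed_set (F i)) ->
  (forall p, Z p -> exists2 i, i \in s & F i p) -> exists2 i, i \in s & Z `<=` F i.
Proof.
move=> [[z Zz] irr] cF cov.
suff H (t : seq I) : (forall i, i \in t -> closed_set (F i)) ->
    closed_set [set p | exists2 i, i \in t & F i p].
  elim: s cF cov => [|i s ih] cF cov; first by have [] := cov _ Zz.
  have [||p /cov [j]|h|h] := irr (F i) [set p | exists2 i, i \in s & F i p].
  - by apply: cF; rewrite mem_head.
  - by apply: H => j js; apply: cF; rewrite inE js orbT.
  - by rewrite inE => /orP[/eqP ->|js] Fp; [left|right; exists j].
  - by exists i; rewrite ?mem_head.
  - have [|//|j js Zj] := ih; first by move=> j js; apply: cF; rewrite inE js orbT.
    by exists j; rewrite // inE js orbT.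
elim: t => [|i t ih] cFt.
  rewrite (_ : [set _ | _] = set0); first exact: closed_set0.
  by apply/seteqP; split=> p [].
rewrite (_ : [set _ | _] = F i `|` [set p | exists2 i, i \in t & F i p]).
  apply: closed_setU; first by apply: cFt; rewrite mem_head.
  by apply: ih => j jt; apply: cFt; rewrite inE jt orbT.
apply/seteqP; split=> p /=.
  by move=> [j]; rewrite inE => /orP[/eqP ->|jt] Fp; [left|right; exists j].
move=> [Fp|[j jt Fp]]; first by exists i; rewrite ?mem_head.
by exists j; rewrite // inE jt orbT.
Qed.

Definition linset k (B : 'M[K]_(k, N.+1)) : set pspace := [set p | (pcoord p <= B)%MS].

Definition linform (l : 'cV[K]_N.+1) : {mpoly K[N.+1]} := \sum_i l i 0 *: 'X_i.

Lemma veval_linform l v : veval (linform l) v = (v *m l) 0 0.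
Proof. by rewrite veval_sum mxE; apply: eq_bigr => i _; rewrite vevalZ vevalX mulrC. Qed.

Lemma linform_homog l : linform l \is 1.-homog.
Proof. by apply: rpred_sum => i _; apply: rpredZ; apply: homogX. Qed.

Lemma pof_linset k (B : 'M[K]_(k, N.+1)) v : v != 0 -> linset B (pof v) <-> (v <= B)%MS.
Proof.
by move=> v0; have [a a0 e] := pcoord_pof v0; rewrite /linset /= e (eqmx_scale _ a0).
Qed.

Lemma linset_closed k (B : 'M[K]_(k, N.+1)) : closed_set (linset B).
Proof.
have vE v j : veval (linform (col j (cokermx B))) v = (v *m cokermx B) 0 j.
  by rewrite veval_linform !mxE; apply: eq_bigr => i _; rewrite !mxE.
exists [set P | exists j, P = linform (col j (cokermx B))].
  by move=> _ [j ->]; exists 1%N; apply: linform_homog.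
move=> p; rewrite /linset /= submxE; split=> [/eqP e _ [j ->]|h].
  by rewrite /heval vE e mxE.
by apply/eqP/rowP => j; rewrite [RHS]mxE -vE; apply: h; exists j.
Qed.

Lemma point_closed p : closed_set [set p].
Proof.
rewrite (_ : [set p] = linset (pcoord p)); first exact: linset_closed.
apply/seteqP; split=> q /=; first by move=> ->; rewrite /linset /=.
rewrite /linset /= => /sub_rVP [a e]; rewrite -(pof_pcoord q) -(pof_pcoord p) e.
apply: pofZ; last exact: pcoord_neq0.
by apply: contraNneq (pcoord_neq0 q) => a0; rewrite e a0 scale0r.
Qed.

Lemma point_irr_closed p : irr_closed [set p].
Proof.
split; first exact: point_closed.
split; first by exists p.
by move=> Z1 Z2 _ _ h; case: (h p erefl) => z; [left|right] => q ->.
Qed.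

End Points.

(** * Automorphisms of projective space *)

Section GlobalForms.
Variables (K : numClosedFieldType) (N M : nat) (h : pspace K N -> pspace K M).
Hypothesis h_morphism : is_morphism setT setT h.
Implicit Types (P Q : 'I_M.+1 -> {mpoly K[N.+1]}).

Definition local_forms k P (U : set (pspace K N)) (y : pspace K N) :=
  [/\ forall i, P i \is k.-homog, closed_set (~` U), U y &
      forall z, U z -> \row_i heval (P i) z != 0 /\
        (pcoord (h z) == \row_i heval (P i) z)%MS].

Definition proportional P Q := forall i j, P i * Q j = P j * Q i.

(** Only proportionality to all local representations is kept, without a domain where [P] represents
    [h]; this is stable under division by a common factor. *)
Definition generic_forms k P :=
  [/\ forall i, P i \is k.-homog, exists i, P i != 0 &
      forall k' Q U y, local_forms k' Q U y -> proportional P Q].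

Lemma exists_local_forms y : exists k P U, local_forms k P U y.
Proof.
have [k [P [U [hP cU Uy hz]]]] := h_morphism.2 y I.
by exists k, P, U; split=> // z; apply: hz.
Qed.

(** Two nonempty open sets of projective space meet. Concretely, the identity is multiplied by forms
    [s] and [s'] vanishing on the two complements, and is then checked where both are nonzero. *)
Lemma local_forms_proportional k P U y k' Q U' y' :
  local_forms k P U y -> local_forms k' Q U' y' -> proportional P Q.
Proof.
move=> [hP cU Uy PU] [hQ cU' Uy' QU] i j.
have [d [s [hs sU sy]]] := closed_sep cU (fun f : (~` U) y => f Uy).
have [d' [s' [hs' sU' sy']]] := closed_sep cU' (fun f : (~` U') y' => f Uy').
have s0 : s != 0 by apply: contraNneq sy => ->; rewrite /heval veval0.
have s'0 : s' != 0 by apply: contraNneq sy' => ->; rewrite /heval veval0.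
apply: (mulfI (mulf_neq0 s0 s'0)); apply: veval_ext_nz => v v0.
rewrite !(vevalM (s * s')) !(vevalM s s').
have [->|sv] := eqVneq (veval s v) 0; first by rewrite !mul0r.
have [->|sv'] := eqVneq (veval s' v) 0; first by rewrite mulr0 !mul0r.
congr (_ * _); have Uv : U (pof v).
  by apply: contrapT => /sU /eqP; rewrite (heval_pof hs) // (negbTE sv).
have Uv' : U' (pof v).
  by apply: contrapT => /sU' /eqP; rewrite (heval_pof hs') // (negbTE sv').
have [Pz /eqmxP eP] := PU _ Uv; have [Qz /eqmxP eQ] := QU _ Uv'.
have : (\row_i heval (P i) (pof v) <= \row_i heval (Q i) (pof v))%MS by rewrite -eP eQ.
move=> /sub_rVP [c e].
have eE l : heval (P l) (pof v) = c * heval (Q l) (pof v).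
  by have /rowP /(_ l) := e; rewrite !mxE.
have [a a0 ev] := pcoord_pof v0.
have := eE i; have := eE j; rewrite /heval ev !(homog_scale _ _ (hP _)) !(homog_scale _ _ (hQ _)).
move=> ej ei; have ak : a ^+ k != 0 by rewrite expf_neq0.
rewrite !vevalM; apply: (mulfI ak); rewrite !mulrA ei ej; ring.
Qed.

Lemma local_forms_generic k P U y : local_forms k P U y -> generic_forms k P.
Proof.
move=> lP; have [hP cU Uy PU] := lP; split=> //.
  have [nz _] := PU _ Uy; apply: contrapT => H; case/eqP: nz; apply/rowP => i.
  rewrite !mxE; have [->|nz] := eqVneq (P i) 0; first by rewrite /heval veval0.
  by case: H; exists i.
by move=> k' Q U' y'; apply: local_forms_proportional lP.
Qed.

(** Descent on the degree [k]: a common prime factor is itself a form, of positive degree because it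
    is not a unit, and dividing by it leaves forms of smaller degree. *)
Lemma reduced_generic_forms : exists k P, generic_forms k P /\
  forall q, prime_elt q -> exists i, ~ dvdr q (P i).
Proof.
have [k [P [U lP]]] := exists_local_forms (pof (const_mx 1)).
have := local_forms_generic lP; elim/ltn_ind: k P {U lP} => k ih P gP.
have [red|nred] := pselect (forall q, prime_elt q -> exists i, ~ dvdr q (P i)).
  by exists k, P.
have [q [qp qP]] : exists q, prime_elt q /\ forall i, dvdr q (P i).
  apply: contrapT => H; apply: nred => q qp; apply: contrapT => Hq; apply: H.
  by exists q; split=> // i; apply: contrapT => nd; apply: Hq; exists i.
have [c ec] := choice qP; have [hP [i Pi0] propP] := gP.
have [q0 qu _] := qp.
have [e [ek hq]] : exists e, (e <= k)%N /\ q \is e.-homog.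
  by apply: (@factor_homog _ _ k q (c i)); rewrite mulrC -ec.
have e0 : (0 < e)%N.
  rewrite lt0n; apply: contraNneq qu => e0; rewrite e0 in hq.
  rewrite (homog0_const hq); apply: mpolyC_unit.
  by apply: contraNneq q0 => q0; rewrite (homog0_const hq) q0.
apply: (ih (k - e)%N _ c); first by rewrite ltn_subrL e0 (leq_trans e0).
split.
- move=> j; have [->|cj] := eqVneq (c j) 0; first exact: rpred0.
  have cq0 : c j * q != 0 by rewrite mulf_neq0.
  have [e' [_ hc]] : exists e', (e' <= k)%N /\ c j \is e'.-homog.
    by apply: (@factor_homog _ _ k (c j) q); rewrite -?ec // ec.
  have := dhomog_uniq cq0 (dhomogM hc hq); rewrite -ec => /(_ _ (hP j)) <-.
  by rewrite addnK.
- by exists i; apply: contraNneq Pi0 => ci; rewrite ec ci mul0r.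
- move=> k' Q U y lQ j l; apply: (mulfI q0).
  by have := propP _ _ _ _ lQ j l; rewrite !ec => E; rewrite !mulrA ![q * _]mulrC E.
Qed.

(** Reduced forms divide every local representation: [P i] divides [P j * Q i] for all [j], and no
    prime divides all the [P j]. Thus [Q = R * P] near any given point, and where the [Q j] have no
    common zero neither have the [P j]. *)
Lemma global_forms : exists k P, (forall i, P i \is k.-homog) /\
  forall v : 'rV[K]_N.+1, v != 0 -> \row_i veval (P i) v != 0 /\ h (pof v) = pof (\row_i veval (P i) v).
Proof.
have [k [P [[hP [i Pi0] propP] red]]] := reduced_generic_forms.
exists k, P; split=> // v v0; have [k' [Q [U lQ]]] := exists_local_forms (pof v).
have pPQ := propP _ _ _ _ lQ; have [hQ cU Uv QU] := lQ.
have [R eR] : dvdr (P i) (Q i).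
  apply: (@dvdr_cofactor _ _ (P i) (Q i) P); first exact: factorial_mpoly.
    by move=> j; rewrite mulrC -pPQ; apply: dvdr_mulr (dvdr_refl _).
  by move=> q qp _; apply: red.
have {}eR j : Q j = R * P j.
  by apply: (mulfI Pi0); rewrite pPQ eR; ring.
have [Qz /eqmxP eQ] := QU _ Uv.
have [a a0 ev] := pcoord_pof v0.
have e1 : \row_j heval (Q j) (pof v) = (veval R (a *: v) * a ^+ k) *: \row_j veval (P j) v.
  by apply/rowP => j; rewrite !mxE eR /heval vevalM ev (homog_scale _ _ (hP j)) mulrA.
have nz : \row_j veval (P j) v != 0 by apply: contraNneq Qz => z; rewrite e1 z scaler0.
have c0 : veval R (a *: v) * a ^+ k != 0 by apply: contraNneq Qz => z; rewrite e1 z scale0r.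
split=> //; rewrite -(pofZ c0 nz) -e1 -[LHS]pof_pcoord.
have : (pcoord (h (pof v)) <= \row_j heval (Q j) (pof v))%MS by rewrite eQ.
move=> /sub_rVP [b eb]; rewrite eb; apply: pofZ => //.
by apply: contraNneq (pcoord_neq0 (h (pof v))) => b0; rewrite eb b0 scale0r.
Qed.

End GlobalForms.

Section LinearForms.
Variable K : numClosedFieldType.

Lemma homog1_linform N (P : {mpoly K[N.+1]}) : P \is 1.-homog ->
  P = linform (\col_i veval P (delta_mx 0 i)).
Proof.
move=> h; have c i : exists c, P^`M(i) = c%:MP.
  by exists P^`M(i)@_0; apply: homog0_const; have := mderiv_homog i h.
have {c} [c ec] := choice c.
have e v : veval P v = \sum_i v 0 i * c i.
  rewrite -[LHS]mul1r -(euler_homog v h); apply: eq_bigr => i _.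
  by rewrite ec vevalC.
apply: veval_ext => v; rewrite veval_linform mxE e; apply: eq_bigr => i _.
rewrite !mxE e (bigD1 i) //= big1 ?addr0 => [|j ji].
  by rewrite mxE !eqxx mul1r.
by rewrite mxE (negbTE ji) andbF mul0r.
Qed.

(* For forms [S i] with [S(v)] a nonzero multiple of [v], restrict to the line
   through the first and last coordinate points: [S_0] has no zero on the chart
   [(1, t)] and [S_last] none on [(s, 1)], so both are constant there. *)
Lemma identity_forms_degree N m (S : 'I_N.+2 -> {mpoly K[N.+2]}) :
  (forall i, S i \is m.-homog) ->
  (forall v : 'rV[K]_N.+2, v != 0 -> exists2 c : K, c != 0 & \row_i veval (S i) v = c *: v) -> m = 1%N.
Proof.
move=> hS hv; pose e0 : 'rV[K]_N.+2 := delta_mx 0 ord0; pose e1 : 'rV[K]_N.+2 := delta_mx 0 ord_max.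
have cE (i : 'I_N.+2) (u w : 'rV[K]_N.+2) : u 0 i = 1 -> w 0 i = 0 ->
    exists2 c, c != 0 & forall t, veval (S i) (u + t *: w) = c.
  move=> ui wi; have [q [qE _]] := deriv_line (S i) u w.
  have nr t : ~~ root q t.
    have nz : (u + t *: w) 0 i != 0 by rewrite !mxE ui wi mulr0 addr0 oner_neq0.
    have v0 : u + t *: w != 0 by apply: contraNneq nz => ->; rewrite mxE.
    have [c c0 /rowP /(_ i)] := hv _ v0.
    by rewrite mxE [RHS]mxE /root qE => ->; rewrite mulf_neq0.
  have sq : size q = 1%N.
    by apply/eqP; apply: contrapT => /negP /closed_rootP [t]; apply/negP.
  have /size1_polyC eq : (size q <= 1)%N by rewrite sq.
  exists q`_0; first by rewrite -polyC_eq0 -eq -size_poly_eq0 sq.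
  by move=> t; rewrite -qE eq hornerC coefC.
have e00 : e0 0 ord0 = 1 by rewrite mxE !eqxx.
have e01 : e0 0 ord_max = 0 by rewrite mxE eqxx.
have e10 : e1 0 ord0 = 0 by rewrite mxE eqxx.
have e11 : e1 0 ord_max = 1 by rewrite mxE !eqxx.
have [c c0 cP] := cE ord0 e0 e1 e00 e10; have [b b0 bP] := cE ord_max e1 e0 e11 e01.
have key t : t != 0 -> t * c = t ^+ m * b.
  move=> t0; have v0 : e0 + t *: e1 != 0.
    by apply/eqP => /rowP /(_ ord0); rewrite !mxE !eqxx mulr0 addr0 => /eqP; rewrite oner_eq0.
  have v00 : (e0 + t *: e1) 0 ord0 = 1.
    by rewrite mxE e00 mxE e10 mulr0 addr0.
  have v01 : (e0 + t *: e1) 0 ord_max = t.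
    by rewrite mxE e01 mxE e11 mulr1 add0r.
  have [a a0 /rowP ea] := hv _ v0.
  have := ea ord0; rewrite mxE cP mxE v00 mulr1 => ->.
  have := ea ord_max; rewrite mxE [RHS]mxE v01 => E.
  rewrite mulrC -E (_ : e0 + t *: e1 = t *: (e1 + t^-1 *: e0)); last first.
    by rewrite scalerDr scalerA mulfV // scale1r addrC.
  by rewrite (homog_scale _ _ (hS _)) bP.
have cb : c = b by have := key 1 (oner_neq0 _); rewrite mul1r expr1n mul1r.
(* The two charts give [t = t ^+ m] for all nonzero [t]; in characteristic 0 the value [t = 2]
   already forces [m = 1]. *)
have := key 2%:R; rewrite pnatr_eq0 => /(_ isT); rewrite cb => /(mulIf b0).
rewrite -natrX => /eqP; rewrite eqr_nat; case: m {hS key} => [|[|m]] //.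
by rewrite !expnS => /eqP; have := expn_gt0 2 m; case: (2 ^ m)%N => // x _; rewrite !mulnS; lia.
Qed.

(** The composite with the inverse map is the identity and is given by forms of degree [k * k'], so
    both degrees are 1. *)
Lemma linear_of_automorphism N (h : pspace K N.+1 -> pspace K N.+1) :
  automorphism setT h -> exists2 A : 'M[K]_N.+2, A \in unitmx & forall v : 'rV[K]_N.+2, v != 0 -> h (pof v) = pof (v *m A).
Proof.
move=> [mh [h' [mh' h'h _]]].
have [k [P [hP Pv]]] := global_forms mh; have [k' [Q [hQ Qv]]] := global_forms mh'.
pose S i := Q i \mPo [tuple P j | j < N.+2].
have SE i v : veval (S i) v = veval (Q i) (\row_j veval (P j) v).
  rewrite /veval /S comp_mpoly_meval; apply: meval_eq => j.
  by rewrite tnth_mktuple mxE.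
have hS i : S i \is (k * k').-homog.
  apply: homog_char => t v t0; rewrite !SE.
  have -> : \row_j veval (P j) (t *: v) = t ^+ k *: \row_j veval (P j) v.
    by apply/rowP => j; rewrite !mxE (homog_scale _ _ (hP j)).
  by rewrite (homog_scale _ _ (hQ i)) exprM.
have Sv v : v != 0 -> exists2 c, c != 0 & \row_i veval (S i) v = c *: v.
  move=> v0; have [Pv0 eP] := Pv _ v0; have [Qv0 eQ] := Qv _ Pv0.
  have -> : \row_i veval (S i) v = \row_i veval (Q i) (\row_j veval (P j) v).
    by apply/rowP => i; rewrite !mxE SE.
  apply: pof_inj => //; rewrite -eQ -eP; exact: h'h.
have := identity_forms_degree hS Sv => /eqP; rewrite muln_eq1 => /andP[/eqP k1 _].
rewrite k1 in hP.
pose A := \matrix_(i, j) veval (P j) (delta_mx 0 i).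
have AE v : \row_j veval (P j) v = v *m A.
  apply/rowP => j; rewrite mxE {1}(homog1_linform (hP j)) veval_linform !mxE.
  by apply: eq_bigr => i _; rewrite !mxE.
exists A; last by move=> v v0; rewrite -AE; have [] := Pv _ v0.
rewrite -row_free_unit -kermx_eq0; apply/eqP/row_matrixP => i; rewrite row0; apply/eqP.
apply: contraT => nz; have [] := Pv _ nz.
by rewrite AE -row_mul mulmx_ker row0 eqxx.
Qed.

End LinearForms.

(** * Smooth forms and linear sections *)

Section CommonZero.
Variable K : numClosedFieldType.

(** The prescribed coefficient may be zero. Unlike the leading coefficient, this notion is
    compatible with sums, products and substitution without any case distinction. *)
Definition top_coef (R : nzRingType) k (q : {poly R}) c := (size q <= k.+1)%N /\ q`_k = c.

Lemma top_coefM (R : comNzRingType) k l (q r : {poly R}) c d :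
  top_coef k q c -> top_coef l r d -> top_coef (k + l) (q * r) (c * d).
Proof.
move=> [sq <-] [sr <-]; split.
  apply: leq_trans (size_polyMleq _ _) _; rewrite -subn1 leq_subLR add1n.
  by apply: leq_trans (leq_add sq sr) _; rewrite addSn addnS.
have kl : (k < (k + l).+1)%N by rewrite ltnS leq_addr.
rewrite coefM (bigD1 (Ordinal kl)) //= addKn big1 ?addr0 // => i.
rewrite -val_eqE /= => ik; have [ki|ki] := ltnP k i.
  by rewrite (nth_default 0 (leq_trans sq ki)) mul0r.
rewrite [r`_ _]nth_default ?mulr0 //; apply: leq_trans sr _.
have : (i < k)%N by rewrite ltn_neqAle ik.
by have := ltn_ord i; lia.
Qed.

Lemma top_coef_mmap (R : comNzRingType) n (phi : {rmorphism K -> R}) e (x : 'I_n -> {poly R})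
    (p : 'I_n -> K) ka (f : {mpoly K[n]}) : f \is ka.-homog ->
  (forall i, top_coef e (x i) (phi (p i))) ->
  top_coef (ka * e) (mmap (polyC \o phi) x f) (phi f.@[p]).
Proof.
move=> /dhomogP h xE; rewrite /mmap mevalE rmorph_sum /= big_seq [X in top_coef _ _ X]big_seq.
elim/big_ind2: _ => [|q1 c1 q2 c2 [s1 <-] [s2 <-]|m /h /= mE].
- by split; rewrite ?size_poly0 ?coef0.
- split; last by rewrite coefD.
  by apply: leq_trans (size_polyD _ _) _; rewrite geq_max s1.
rewrite -mE -[(mdeg m * e)%N]add0n rmorphM; apply: top_coefM.
  by split; rewrite ?coefC ?size_polyC_leq1.
rewrite /mmap1 rmorph_prod /= mdegE big_distrl /=.
elim/big_ind3: _ => [|k1 q1 c1 k2 q2 c2|i _]; first by split; rewrite ?size_poly1 ?coef1.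
  exact: top_coefM.
rewrite rmorphXn; elim: (m i) => [|k ih]; first by split; rewrite ?size_poly1 ?coef1.
by rewrite !exprS mulSn; apply: top_coefM ih.
Qed.

Lemma top_coef_homog (R : comNzRingType) n (phi : {rmorphism K -> R}) (c : 'I_n -> R)
    (p : 'I_n -> K) ka (f : {mpoly K[n]}) : f \is ka.-homog ->
  top_coef ka (mmap (polyC \o phi) (fun i => (c i)%:P + phi (p i) *: 'X) f) (phi f.@[p]).
Proof.
move=> h; rewrite -[ka in top_coef ka]muln1; apply: top_coef_mmap => // i; split.
  apply: leq_trans (size_polyD _ _) _; rewrite geq_max.
  rewrite (leq_trans (size_polyC_leq1 _)) //=.
  by apply: leq_trans (size_scale_leq _ _) _; rewrite size_polyX.
by rewrite coefD coefC /= add0r coefZ coefX mulr1.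
Qed.

(** If the outer variable occurs in [r], it can be solved for over a nonzero value [a] at which one
    of its coefficients survives. Otherwise [r] depends on the inner variable alone and vanishes at
    [a = 0], whatever [b] is. *)
Lemma bivariate_zero (r : {poly {poly K}}) : r.[0].[0] = 0 ->
  exists a b, (a != 0) || (b != 0) /\ r.[b%:P].[a] = 0.
Proof.
move=> r0; have [[j jr]|nr] := pselect (exists j, r`_j.+1 != 0).
  have rX : r`_j.+1 * 'X != 0 by rewrite mulf_neq0 // polyX_eq0.
  have [a] := poly_nonroot rX; rewrite hornerM hornerX mulf_eq0 negb_or => /andP[ra a0].
  have [b /rootP rb] : exists b, root (map_poly (horner_eval a) r) b.
    apply/closed_rootP; rewrite gtn_eqF // ltnNge; apply/negP => s.
    have := nth_default 0 (leq_trans s (ltn0Sn j)); rewrite coef_map /= => /eqP.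
    by rewrite (negbTE ra).
  exists a, b; split; first by rewrite a0.
  rewrite -[RHS]rb -[b in RHS](_ : horner_eval a b%:P = b) ?horner_map //.
  by rewrite /horner_eval hornerC.
exists 0, 1; split; first by rewrite oner_neq0 orbT.
have er : r = (r`_0)%:P.
  apply/polyP => -[|j]; rewrite coefC //=; apply/eqP; apply: contrapT => /negP nz.
  by apply: nr; exists j.
by rewrite er hornerC; move: r0; rewrite {1}er hornerC.
Qed.

(** Restrict to the span of two coordinate vectors and a point [p] off both hypersurfaces, and
    eliminate the coordinate [z] along [p]. The resultant in [x] and [y] vanishes at the origin,
    because both forms do, hence also at some other [(x, y)]; a common root [z] over it gives the
    zero. *)
Lemma common_zero_aux N ka kb (f g : {mpoly K[N.+3]}) :
  f \is ka.-homog -> g \is kb.-homog -> (0 < ka)%N -> (0 < kb)%N -> f != 0 -> g != 0 ->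
  exists2 v : 'rV[K]_N.+3, v != 0 & veval f v = 0 /\ veval g v = 0.
Proof.
move=> hf hg a0 b0 f0 g0.
have [p] := veval_neq0 (mulf_neq0 f0 g0); rewrite vevalM mulf_eq0 negb_or => /andP[fp gp].
have p0 : p != 0 by apply: contraNneq fp => ->; rewrite (homog_eval0 hf).
have /rV0Pn [i pi] := p0.
pose j := lift i ord0; pose k := lift i ord_max.
have jk : j != k by rewrite (inj_eq lift_inj).
have ij : i != j := neq_lift _ _; have ik : i != k := neq_lift _ _.
pose w (x y z : K) : 'rV_N.+3 := x *: delta_mx 0 j + y *: delta_mx 0 k + z *: p.
have w0 x y z : (x != 0) || (y != 0) -> w x y z != 0.
  apply: contraTneq => /rowP we; have := we i; rewrite !mxE !eqxx (negbTE ij) (negbTE ik).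
  rewrite !mulr0 !add0r => /eqP; rewrite mulf_eq0 (negbTE pi) orbF => /eqP z0.
  have := we j; have := we k; rewrite z0 !mxE !eqxx (negbTE jk) eq_sym (negbTE jk) /=.
  by rewrite !mulr1 !mulr0 !mul0r !addr0 add0r => -> ->; rewrite eqxx.
pose phi : {rmorphism K -> {poly {poly K}}} := polyC \o polyC.
pose c l : {poly {poly K}} := ((delta_mx 0 j : 'rV[K]_N.+3) 0 l *: 'X)%:P +
   ((delta_mx 0 k : 'rV[K]_N.+3) 0 l)%:P *: 'X.
(* [T q] is [q] on this span, as a polynomial in [z] over polynomials in [y] over polynomials in
   [x]. Its leading coefficient is the constant [veval q p], so specialising [x] and [y] preserves
   its degree and commutes with the resultant. *)
pose T : {rmorphism {mpoly K[N.+3]} -> {poly {poly {poly K}}}} :=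
  mmap (polyC \o phi) (fun l => (c l)%:P + phi (p 0 l) *: 'X).
pose ev x y : {rmorphism {poly {poly K}} -> K} := horner_eval x \o horner_eval y%:P.
have evphi x y s : ev x y (phi s) = s by rewrite /= /horner_eval !hornerC.
have lead q e : q \is e.-homog -> veval q p != 0 ->
    lead_coef (T q) = phi (veval q p) /\ size (T q) = e.+1.
  move=> hq qp; have [s t] : top_coef e (T q) (phi (veval q p)) := top_coef_homog phi c (p 0) hq.
  have sz : size (T q) = e.+1.
    apply/eqP; rewrite eqn_leq s ltnNge; apply/negP => /(nth_default 0).
    by rewrite t => /eqP; rewrite !polyC_eq0 (negbTE qp).
  by rewrite lead_coefE sz /= t.
have evT x y z q : (map_poly (ev x y) (T q)).[z] = veval q (w x y z).
  apply: (@mpoly_morph_ext _ _ _ (horner_eval z \o map_poly (ev x y) \o T) (meval (w x y z 0))) => [s|l].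
    by rewrite /= mmapC /= map_polyC /horner_eval /= /horner_eval !hornerC mevalC.
  rewrite /= mmapX mmap1U mevalXU rmorphD /= map_polyC map_polyZ map_polyX.
  rewrite /horner_eval !hornerE /= /c /horner_eval !hornerE !mxE.
  ring.
have [lf sf] := lead _ _ hf fp; have [lg sg] := lead _ _ hg gp.
pose r := resultant (T f) (T g).
have evr x y : ev x y r = resultant (map_poly (ev x y) (T f)) (map_poly (ev x y) (T g)).
  by apply: map_resultant; rewrite ?lf ?lg evphi.
have szm x y q e : q \is e.-homog -> veval q p != 0 -> size (map_poly (ev x y) (T q)) = e.+1.
  by move=> hq qp; have [lq sq] := lead _ _ hq qp; rewrite size_map_poly_id0 ?lq ?evphi.
have rootP' x y : (exists z, veval f (w x y z) = 0 /\ veval g (w x y z) = 0) <-> ev x y r = 0.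
  rewrite evr; split=> [[z [fz gz]]|/eqP].
    apply/eqP; rewrite resultant_eq0.
    have : 'X - z%:P %| gcdp (map_poly (ev x y) (T f)) (map_poly (ev x y) (T g)).
      by rewrite dvdp_gcd !dvdp_XsubCl /root !evT fz gz eqxx.
    move/dvdp_leq; rewrite size_XsubC; apply.
    by rewrite gcdp_eq0 negb_and -size_poly_eq0 (szm x y f ka).
  rewrite resultant_eq0 => s.
  have /closed_rootP [z] : size (gcdp (map_poly (ev x y) (T f)) (map_poly (ev x y) (T g))) != 1 by rewrite gtn_eqF.
  by rewrite root_gcd /root !evT => /andP[/eqP fz /eqP gz]; exists z.
have r00 : r.[0].[0] = 0.
  have /rootP' : exists z, veval f (w 0 0 z) = 0 /\ veval g (w 0 0 z) = 0.
    by exists 0; rewrite /w !scale0r !addr0 (homog_eval0 hf) ?(homog_eval0 hg).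
  by rewrite /= /horner_eval.
have [x [y [xy rxy]]] := bivariate_zero r00.
have /rootP' [z [fz gz]] : ev x y r = 0 by [].
by exists (w x y z); [apply: w0|].
Qed.

Lemma common_zero N ka kb (f g : {mpoly K[N.+3]}) :
  f \is ka.-homog -> g \is kb.-homog -> (0 < ka)%N -> (0 < kb)%N ->
  exists2 v : 'rV[K]_N.+3, v != 0 & veval f v = 0 /\ veval g v = 0.
Proof.
move=> hf hg a0 b0; have [ef|f0] := eqVneq f 0; have [eg|g0] := eqVneq g 0.
- by exists (const_mx 1); rewrite ?ones_neq0 // ef eg veval0.
- have [v v0 [gv _]] := common_zero_aux hg hg b0 b0 g0 g0.
  by exists v; rewrite // ef veval0.
- have [v v0 [fv _]] := common_zero_aux hf hf a0 a0 f0 f0.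
  by exists v; rewrite // eg veval0.
- exact: common_zero_aux hf hg a0 b0 f0 g0.
Qed.

Definition smooth_form N (F : {mpoly K[N.+1]}) :=
  forall v : 'rV[K]_N.+1, v != 0 -> veval F v = 0 -> exists i, veval F^`M(i) v != 0.

Lemma homog_unit_deg0 n d (f : {mpoly K[n]}) : f \is d.-homog -> f \is a GRing.unit -> d = 0%N.
Proof.
move=> h u; have [c c0 e] := mpoly_unit_const u.
by apply: (dhomog_uniq (unit_neq0 u) h); rewrite e; apply: homogC.
Qed.

Lemma prime_homog_gt0 n d (f : {mpoly K[n]}) : f \is d.-homog -> prime_elt f -> (0 < d)%N.
Proof.
move=> h [f0 fu _]; rewrite lt0n; apply: contraNneq fu => d0; rewrite d0 in h.
by rewrite (homog0_const h) mpolyC_unit //; apply: contraNneq f0 => e; rewrite (homog0_const h) e.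
Qed.

Lemma prime_mul_unit (R : idomainType) (p u : R) : prime_elt p -> u \is a GRing.unit -> prime_elt (p * u).
Proof.
move=> [p0 pu pP] uu; have dv x : dvdr p x -> dvdr (p * u) x.
  by move=> [y ->]; exists (y / u); rewrite mulrA [y / u * p]mulrAC divrK.
split; first by rewrite mulf_neq0 // unit_neq0.
  by rewrite unitrM negb_and pu.
move=> b c h; have : dvdr p (b * c) by apply: dvdr_trans h; exists u; rewrite mulrC.
by case/pP => /dv; [left|right].
Qed.

Lemma smooth_form_prime N d (F : {mpoly K[N.+3]}) :
  F \is d.-homog -> F != 0 -> (0 < d)%N -> smooth_form F -> prime_elt F.
Proof.
move=> hF F0 d0 smF; have := factorial_mpoly F0.
case E : F / => [u uu|q a qp fa].
  by have := homog_unit_deg0 hF; rewrite E => /(_ uu) e; rewrite e in d0.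
have qa0 : q * a != 0 by rewrite -E.
have [e [ed hq]] : exists e, (e <= d)%N /\ q \is e.-homog.
  by apply: (@factor_homog _ _ d q a); rewrite -E.
have [e' [_ ha]] : exists e, (e <= d)%N /\ a \is e.-homog.
  by apply: (@factor_homog _ _ d a q); rewrite mulrC -E.
have [e'0|e'0] := posnP e'.
  rewrite e'0 in ha; apply: prime_mul_unit => //; rewrite (homog0_const ha) mpolyC_unit //.
  by apply: contraNneq (factored_neq0 fa) => z; rewrite (homog0_const ha) z.
have [v v0 [qv av]] := common_zero hq ha (prime_homog_gt0 hq qp) e'0.
have [|i] := smF _ v0; first by rewrite E vevalM qv mul0r.
by rewrite E mderivM vevalD !vevalM qv av mulr0 mul0r addr0 eqxx.
Qed.

End CommonZero.

Section LinearSections.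
Variable K : numClosedFieldType.

Lemma dvdr_homog_deg N d e (F P : {mpoly K[N.+1]}) :
  F \is d.-homog -> P \is e.-homog -> P != 0 -> dvdr F P -> (d <= e)%N.
Proof.
move=> hF hP P0 [c ec]; have Fc0 : F * c != 0 by rewrite mulrC -ec.
have [e' [le h]] : exists e', (e' <= e)%N /\ F \is e'.-homog.
  by apply: (@factor_homog _ _ e F c); rewrite ?(mulrC F) -ec.
have F0 : F != 0 by apply: contraNneq P0 => z; rewrite ec z mulr0.
by rewrite (dhomog_uniq F0 hF h).
Qed.

Lemma irr_of_prime N (Z : set (pspace K N)) : Z !=set0 ->
  (forall P Q, P * Q \in vanishing Z -> P \in vanishing Z \/ Q \in vanishing Z) ->
  irreducible_set Z.
Proof.
move=> Z0 pZ; split=> // Z1 Z2 c1 c2 cov; apply: contrapT => H.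
have ex Zi : closed_set Zi -> ~ (Z `<=` Zi) -> exists d P,
    [/\ P \is d.-homog, forall q, Zi q -> heval P q = 0 & P \notin vanishing Z].
  move=> ci ni; have [p [Zp np]] : exists p, Z p /\ ~ Zi p.
    apply: contrapT => H'; apply: ni => p Zp; apply: contrapT => np; apply: H'; by exists p.
  have [d [P [hP v z]]] := closed_sep ci np; exists d, P; split=> //.
  by apply/negP => /(vanishing_homog _ hP) /(_ _ Zp) /eqP; rewrite (negbTE z).
have [d1 [P1 [h1 v1 z1]]] := ex _ c1 (fun x => H (or_introl x)).
have [d2 [P2 [h2 v2 z2]]] := ex _ c2 (fun x => H (or_intror x)).
have : P1 * P2 \in vanishing Z.
  apply/(vanishing_homog _ (dhomogM h1 h2)) => p /cov.
  by rewrite /heval vevalM -!/(heval _ _) => -[/v1|/v2] ->; rewrite ?mul0r ?mulr0.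
by case/pZ; [apply/negP|apply/negP].
Qed.

Section FixedSection.
Variables (m N : nat) (B : 'M[K]_(m.+1, N.+1)).
Hypothesis Bfree : row_free B.
Implicit Types (f : {mpoly K[m.+1]}).

(** The linear subspace is parametrised by [x |-> x *m B], so that its section is governed by a
    polynomial [f] in the parameters alone. *)
Definition hypersection f : set (pspace K N) :=
  [set p | exists x, pcoord p = x *m B /\ veval f x = 0].

Lemma row_free_neq0 (x : 'rV[K]_m.+1) : x != 0 -> x *m B != 0.
Proof. by apply: contraNneq => e; apply/eqP/(row_free_inj Bfree); rewrite e mul0mx. Qed.

Lemma pof_hypersection d f x : f \is d.-homog -> x != 0 ->
  hypersection f (pof (x *m B)) <-> veval f x = 0.
Proof.
move=> hf x0; have [a a0 e] := pcoord_pof (row_free_neq0 x0); split=> [[y [ey fy]]|fx].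
  have /(row_free_inj Bfree) e' : (a *: x) *m B = y *m B by rewrite -scalemxAl -e.
  by apply/eqP; rewrite -(homog_eq0Z _ hf a0) e' fy.
by exists (a *: x); rewrite e -scalemxAl; split=> //; apply/eqP; rewrite (homog_eq0Z _ hf a0) fx.
Qed.

Lemma hypersection_pof f p : hypersection f p ->
  exists x, [/\ x != 0, p = pof (x *m B) & veval f x = 0].
Proof.
move=> [x [e fx]]; exists x; split=> //; last by rewrite -e pof_pcoord.
by apply: contraNneq (pcoord_neq0 p) => x0; rewrite e x0 mul0mx.
Qed.

Lemma hypersection_closed d f : f \is d.-homog -> closed_set (hypersection f).
Proof.
move=> hf.
have c2 : closed_set [set p | heval (lsub (pinvmx B) f) p = 0].
  exists [set lsub (pinvmx B) f] => [P ->|p]; first by exists d; apply: lsub_homog.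
  by split=> [h P ->|h]; [|apply: h].
suff -> : hypersection f = linset B `&` [set p | heval (lsub (pinvmx B) f) p = 0].
  exact: closed_setI (linset_closed _) c2.
apply/seteqP; split=> p /=.
  move=> [x [e fx]]; split; first by rewrite /linset /= e submxMl.
  by rewrite /heval veval_lsub e -mulmxA mulmxVp // mulmx1.
move=> [/(mulmxKpV) e]; rewrite /heval veval_lsub => fx.
by exists (pcoord p *m pinvmx B); rewrite e.
Qed.

(** The Nullstellensatz gives an affine zero, which could be the origin; requiring in addition that
    a coordinate ['X_i] be nonzero prevents this. The zero [w] supplies an index [i] for which [f]
    does not divide ['X_i]. *)
Lemma hypersection_vanishing d f P : f \is d.-homog -> prime_elt f ->
  (exists2 w : 'rV[K]_m.+1, w != 0 & veval f w = 0) ->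
  (P \in vanishing (hypersection f) <-> dvdr f (lsub B P)).
Proof.
move=> hf fp [w w0 fw]; split=> [/vanishingP h|[c ec]]; last first.
  apply/vanishingP => v v0 /hypersection_pof [x [x0 e fx]].
  have [a a0 ->] := pof_inj v0 (row_free_neq0 x0) e.
  by rewrite scalemxAl -veval_lsub ec vevalM (eqP (_ : veval f _ == 0)) ?mulr0 // (homog_eq0Z _ hf) // fx.
apply: contrapT => nP; have /rV0Pn [i wi] := w0.
have nX : ~ dvdr f 'X_i.
  move=> [c /(congr1 (fun Q => veval Q w))]; rewrite vevalX vevalM fw mulr0 => /eqP.
  by rewrite (negbTE wi).
have nPX : ~ dvdr f (lsub B P * 'X_i) by have [_ _ h'] := fp; case/h'.
have [x [fx]] := nullstellensatz_row fp nPX; rewrite vevalM mulf_eq0 negb_or => /andP[Px xi].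
have x0 : x != 0 by apply: contraNneq xi => ->; rewrite vevalX mxE.
move: Px; rewrite veval_lsub h ?eqxx ?row_free_neq0 //.
by apply/(pof_hypersection hf x0).
Qed.

Lemma hypersection_irr d f : f \is d.-homog -> prime_elt f ->
  (exists2 w : 'rV[K]_m.+1, w != 0 & veval f w = 0) -> irr_closed (hypersection f).
Proof.
move=> hf fp hw; split; first exact: hypersection_closed hf.
apply: irr_of_prime; first by have [w w0 fw] := hw; exists (pof (w *m B)); apply/(pof_hypersection hf w0).
move=> P Q; have vE R := hypersection_vanishing R hf fp hw.
by move/vE; rewrite rmorphM; have [_ _ h] := fp; case/h => /vE; [left|right].
Qed.

End FixedSection.

Definition hyp_form N d (X : set (pspace K N)) (F : {mpoly K[N.+1]}) :=
  [/\ F \is d.-homog, smooth_form F, prime_elt F,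
      forall v : 'rV[K]_N.+1, v != 0 -> (X (pof v) <-> veval F v = 0) &
      forall P, P \in vanishing X <-> dvdr F P].

Lemma homog_has_zero n d (f : {mpoly K[n.+3]}) : f \is d.-homog -> (0 < d)%N ->
  exists2 w : 'rV[K]_n.+3, w != 0 & veval f w = 0.
Proof. by move=> hf d0; have [w w0 []] := common_zero hf hf d0 d0; exists w. Qed.

Lemma smooth_hypersurface_form n d (X : set (pspace K n.+2)) : (0 < d)%N ->
  smooth_hypersurface d X -> exists F, hyp_form d X F.
Proof.
move=> d0 [F [hF F0 eX sm]]; exists F.
have XE v : v != 0 -> (X (pof v) <-> veval F v = 0).
  move=> v0; rewrite eX /=; have e := heval_pof hF v0.
  by split=> /eqP; [rewrite e|rewrite -e] => /eqP.
have smF : smooth_form F.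
  move=> v v0 Fv; case: (sm _ ((XE _ v0).2 Fv)) => i nz; exists i; move: nz.
  by rewrite -(heval_pof (mderiv_homog i hF)).
have Fp := smooth_form_prime hF F0 d0 smF.
split=> // P; have f1 : row_free (1%:M : 'M[K]_n.+3) by rewrite row_free_unit unitmx1.
rewrite -[P in dvdr _ P]lsub1 -(hypersection_vanishing f1 P hF Fp (homog_has_zero hF d0)).
suff -> : X = hypersection 1%:M F by [].
apply/seteqP; split; apply: pof_ind => v v0.
  by move/(XE _ v0) => Fv; rewrite -[v]mulmx1; apply/(pof_hypersection f1 hF).
by rewrite -{1}[v]mulmx1 => /(pof_hypersection f1 hF v0) /(XE _ v0).
Qed.

Definition dirderiv N (u : 'rV[K]_N.+1) (F : {mpoly K[N.+1]}) := \sum_i u 0 i *: F^`M(i).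

Lemma veval_dirderiv N (u : 'rV[K]_N.+1) F v :
  veval (dirderiv u F) v = \sum_i u 0 i * veval F^`M(i) v.
Proof. by rewrite veval_sum; apply: eq_bigr => i _; rewrite vevalZ. Qed.

Lemma dirderiv_homog N d (u : 'rV[K]_N.+1) F : F \is d.-homog -> dirderiv u F \is d.-1.-homog.
Proof. by move=> h; apply: rpred_sum => i _; apply: rpredZ; apply: mderiv_homog. Qed.

Lemma dirderivD N (u w : 'rV[K]_N.+1) F v :
  veval (dirderiv (u + w) F) v = veval (dirderiv u F) v + veval (dirderiv w F) v.
Proof.
by rewrite !veval_dirderiv -big_split; apply: eq_bigr => i _; rewrite mxE mulrDl.
Qed.

Lemma dirderivZ N c (u : 'rV[K]_N.+1) F v :
  veval (dirderiv (c *: u) F) v = c * veval (dirderiv u F) v.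
Proof.
by rewrite !veval_dirderiv mulr_sumr; apply: eq_bigr => i _; rewrite mxE mulrA.
Qed.

Lemma dirderiv_zero N (u : 'rV[K]_N.+1) F y c (q : {poly K}) :
  (forall t, veval F (y + t *: u) = q.[t]) -> q^`().[0] = c -> veval (dirderiv u F) y = c.
Proof.
move=> h <-; have [r [rE dr]] := deriv_line F y u.
rewrite (_ : q = r); last by apply: poly_ext_nz => t _; rewrite rE h.
by rewrite dr veval_dirderiv; apply: eq_bigr => i _; rewrite mulrC.
Qed.

Lemma smooth_dirderiv N (F : {mpoly K[N.+1]}) v : smooth_form F -> v != 0 -> veval F v = 0 ->
  exists u, veval (dirderiv u F) v != 0.
Proof.
move=> sm v0 Fv; have [i nz] := sm _ v0 Fv; exists (delta_mx 0 i).
rewrite veval_dirderiv (bigD1 i) //= big1 ?addr0 => [|j ji].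
  by rewrite mxE !eqxx mul1r.
by rewrite mxE (negbTE ji) andbF mul0r.
Qed.

Lemma dirderiv_lin_zero m N (B : 'M[K]_(m.+1, N.+1)) (F : {mpoly K[N.+1]}) x u :
  lsub B F = 0 -> (u <= B)%MS -> veval (dirderiv u F) (x *m B) = 0.
Proof.
move=> B0 /submxP [z ->]; apply: (@dirderiv_zero _ _ _ _ _ 0); last by rewrite deriv0 horner0.
by move=> t; rewrite scalemxAl -mulmxDl -veval_lsub B0 veval0 horner0.
Qed.

(* If F vanishes on the subspace spanned by the rows of B, its derivatives in
   the directions e and e' have a common zero there, which is a singular point. *)
Lemma restriction_neq0 m N d (B : 'M[K]_(m.+3, N.+1)) (F : {mpoly K[N.+1]}) (e e' : 'rV[K]_N.+1) :
  F \is d.-homog -> (1 < d)%N -> smooth_form F -> row_free B ->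
  (1%:M <= B + e + e')%MS -> lsub B F != 0.
Proof.
move=> hF d1 smF Bf full; apply/eqP => B0.
have d10 : (0 < d.-1)%N by case: d d1 {hF} => [|[]].
have [x x0 [ex ex']] := common_zero (lsub_homog B (dirderiv_homog e hF))
  (lsub_homog B (dirderiv_homog e' hF)) d10 d10.
have xB0 : x *m B != 0 by apply: row_free_neq0.
have [|u] := smooth_dirderiv smF xB0; first by rewrite -veval_lsub B0 veval0.
have : (u <= B + e + e')%MS by apply: submx_trans full; apply: submx1.
case/sub_addsmxP => -[u1 u2] /= ->.
have /sub_addsmxP [[u3 u4] /= ->] : (u1 *m (B + e)%MS <= B + e)%MS by apply: submxMl.
rewrite !dirderivD dirderiv_lin_zero ?submxMl // [u4]mx11_scalar [u2]mx11_scalar.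
rewrite !mul_scalar_mx !dirderivZ; rewrite !veval_lsub in ex ex'.
by rewrite ex ex' !mulr0 !addr0 eqxx.
Qed.

End LinearSections.

(** * Coordinates adapted to a hyperplane and a point *)

Section Expansion.
Variables (K : numClosedFieldType) (m N : nat).
Variables (H : 'M[K]_(m.+1, N.+1)) (p : 'rV[K]_N.+1).

(** The rows of [H] followed by [p]: the parameter along [p] becomes the last variable, the one that
    [muni] singles out. *)
Definition stack : 'M[K]_(m.+2, N.+1) :=
  \matrix_(i, j) if insub (val i) is Some i' then H i' j else p 0 j.

Lemma mul_stack (y : 'rV[K]_m.+1) t : \row_i extend_last (y 0) t i *m stack = y *m H + t *: p.
Proof.
apply/rowP => j; rewrite !mxE [LHS]big_ord_recr /=.
congr (_ + _); last by rewrite !mxE /extend_last /= insubF ?ltnn.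
apply: eq_bigr => i _; rewrite !mxE /extend_last /= insubT //= => lt.
by congr (y 0 _ * H _ j); apply: val_inj.
Qed.

Lemma veval_stack P y t :
  veval P (y *m H + t *: p) = (map_poly (meval (y 0)) (muni (lsub stack P))).[t].
Proof.
rewrite -meval_extend -mul_stack -veval_lsub.
by rewrite /veval; apply: meval_eq => i; rewrite mxE.
Qed.

(** Scaling [y] and [t] together by [s] multiplies the value by [s ^+ d]. Comparing the coefficients
    of [t ^+ i] makes the coefficient of index [i] a form of degree [d - i]; those with [i > d],
    where the subtraction truncates, have to be shown to vanish. *)
Lemma expansion d (P : {mpoly K[N.+1]}) : P \is d.-homog ->
  exists q : {poly {mpoly K[m.+1]}},
    [/\ forall y t, veval P (y *m H + t *: p) = (map_poly (meval (y 0)) q).[t],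
        (size q <= d.+1)%N & forall i, q`_i \is (d - i).-homog].
Proof.
move=> hP; pose q := muni (lsub stack P).
have qE y t : veval P (y *m H + t *: p) = (map_poly (meval (y 0)) q).[t] := veval_stack P y t.
have coefE s y i : s != 0 -> veval q`_i (s *: y) * s ^+ i = s ^+ d * veval q`_i y.
  move=> s0; pose r := \poly_(i < size q) (veval q`_i (s *: y) * s ^+ i).
  have er : r = s ^+ d *: map_poly (meval (y 0)) q.
    apply: poly_ext_nz => t _; rewrite hornerZ -qE -(homog_scale _ _ hP) scalerDr scalemxAl scalerA.
    rewrite qE horner_poly (@horner_coef_wide _ (size q)) ?size_poly //.
    by apply: eq_bigr => j _; rewrite coef_map exprMn mulrA.
  have := congr1 (fun r : {poly K} => r`_i) er; rewrite coefZ coef_map coef_poly.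
  case: ltnP => [//|si] <-; rewrite nth_default // veval0 mul0r //.
have q0 i : (d < i)%N -> q`_i = 0.
  move=> di; apply: veval_ext => y; rewrite veval0.
  (* For [i > d], the coefficient at [s *: y] times [s ^+ (i - d)] is constant in [s], hence equal
     to its value 0 at [s = 0]. *)
  pose r := linepoly q`_i y * 'X^(i - d).
  have er : r = (veval q`_i y)%:P.
    apply: poly_ext_nz => t t0; rewrite hornerM linepolyE hornerXn hornerC.
    apply: (mulfI (expf_neq0 d t0)); rewrite -coefE // mulrCA -exprD subnKC //.
    exact: ltnW.
  have := congr1 (fun r => r.[0]) er; rewrite hornerM hornerXn hornerC => <-.
  by rewrite expr0n subn_eq0 leqNgt di mulr0.
exists q; split=> //; first by apply/leq_sizeP => i; apply: q0.
move=> i; have [id|/q0 ->] := leqP i d; last exact: rpred0.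
apply: homog_char => t v t0; apply: (mulIf (expf_neq0 i t0)).
by rewrite coefE // mulrAC -exprD subnK.
Qed.

End Expansion.

Section KernelBasis.
Variables (K : fieldType) (N : nat) (l : 'cV[K]_N.+2) (k : 'I_N.+2).
Hypothesis lk : l k 0 != 0.

(** Parameters on the hyperplane [l = 0], obtained by solving for the coordinate [k]; the factor
    [l k 0] avoids a division. *)
Definition kerbasis : 'M[K]_(N.+1, N.+2) :=
  \matrix_i (l k 0 *: delta_mx 0 (lift k i) - l (lift k i) 0 *: delta_mx 0 k).

Lemma kerbasisE (x : 'rV[K]_N.+1) i : (x *m kerbasis) 0 (lift k i) = l k 0 * x 0 i.
Proof.
rewrite mxE (bigD1 i) //= big1 ?addr0 => [|j ji].
  by rewrite !mxE !eqxx eq_sym (negbTE (neq_lift _ _)) mulr0 subr0 mulr1 mulrC.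
rewrite !mxE !eqxx (inj_eq lift_inj) eq_sym (negbTE ji) eq_sym (negbTE (neq_lift _ _)).
by rewrite !mulr0 subr0 mulr0.
Qed.

Lemma kerbasis_free : row_free kerbasis.
Proof.
rewrite -kermx_eq0; apply/eqP/row_matrixP => i; rewrite row0; apply/rowP => j.
have := kerbasisE (row i (kermx kerbasis)) j.
rewrite -row_mul mulmx_ker row0 !mxE => /esym/eqP; rewrite mulf_eq0 (negbTE lk) /=.
by move/eqP.
Qed.

Lemma kerbasis_mul : kerbasis *m l = 0.
Proof.
apply/row_matrixP => i; rewrite row_mul rowK row0 mulmxBl -!scalemxAl -!rowE.
by apply/rowP => j; rewrite !mxE ord1 mulrC subrr.
Qed.

Lemma col_rank1 : \rank l = 1%N.
Proof.
rewrite -mxrank_tr rank_rV; case: eqP => // /rowP /(_ k); rewrite !mxE => /eqP.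
by rewrite (negbTE lk).
Qed.

Lemma sub_kerbasis (v : 'rV[K]_N.+2) : (v <= kerbasis)%MS = (v *m l == 0).
Proof.
apply/idP/eqP => [/submxP [x ->]|vl]; first by rewrite -mulmxA kerbasis_mul mulmx0.
have : (kermx l <= kerbasis)%MS.
  have sub : (kerbasis <= kermx l)%MS by apply/sub_kermxP; apply: kerbasis_mul.
  by rewrite -(geq_leqif (mxrank_leqif_sup sub)) mxrank_ker col_rank1 (eqP kerbasis_free) subn1.
by apply: submx_trans; apply/sub_kermxP.
Qed.

Lemma kerbasis_full (p : 'rV[K]_N.+2) : (p *m l) 0 0 != 0 -> (1%:M <= kerbasis + p)%MS.
Proof.
move=> s0; apply/row_subP => i; set v := row i _.
rewrite -[v](subrK (((v *m l) 0 0 / (p *m l) 0 0) *: p)).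
apply: addmx_sub_adds; last exact: scalemx_sub.
rewrite sub_kerbasis mulmxBl -scalemxAl.
move: (p *m l) s0 (v *m l) => b s0 w; apply/eqP/rowP => j.
by rewrite !mxE ord1 divfK // subrr.
Qed.

End KernelBasis.

Section RankOne.
Variables (K : fieldType) (n : nat) (lam : K) (l : 'cV[K]_n.+1) (p : 'rV[K]_n.+1).
Let A := lam%:M + l *m p.
Let s := (p *m l) 0 0.

Lemma rank_one_mul (v : 'rV[K]_n.+1) : v *m A = lam *: v + (v *m l) 0 0 *: p.
Proof.
by rewrite mulmxDr mul_mx_scalar mulmxA [v *m l]mx11_scalar mul_scalar_mx -mx11_scalar.
Qed.

(** The square of [l *m p] is [s] times itself, so the powers of [A] stay in the span of it and the
    identity. The formula for [c * s] loses [c] when [s = 0], and this case gets its own value. *)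
Lemma rank_one_power m : exists c, A ^+ m = (lam ^+ m)%:M + c *: (l *m p) /\
  c * s = (lam + s) ^+ m - lam ^+ m /\ (s = 0 -> c = lam ^+ m.-1 *+ m).
Proof.
elim: m => [|m [c [IH [cs c0]]]].
  by exists 0; rewrite !expr0 scale0r addr0 mul0r subrr mulr0n.
exists (lam ^+ m + c * (lam + s)); split; last split.
- rewrite exprSr IH /A -[RHS]/(_ : 'M_n.+1) -mulmxE mulmxDl !mulmxDr.
  rewrite mul_scalar_mx scale_scalar_mx mul_scalar_mx.
  rewrite -!scalemxAl mul_mx_scalar -mulmxA [p *m (l *m p)]mulmxA [p *m l]mx11_scalar -/s.
  rewrite mul_scalar_mx -scalemxAr !scalerA -exprSr -!addrA; congr (_ + _).
  by rewrite -!scalerDl mulrDr.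
- by rewrite !exprSr mulrDl mulrAC cs; ring.
- move=> s0; rewrite (c0 s0) s0 addr0; case: m {IH cs c0} => [|m] /=; first by rewrite mulr0n mul0r addr0.
  by rewrite mulrnAl -exprSr -mulrS.
Qed.

End RankOne.

(** * Homologies preserving a smooth hypersurface *)

(** A row vector [v] goes to [lam *: v] plus the multiple of [p] by the value of [l] at [v].
    Elations, with [p] on the axis, are included; the finite order excludes them later. *)
Definition homology (K : fieldType) N (A : 'M[K]_N) lam (l : 'cV[K]_N) (p : 'rV[K]_N) :=
  [/\ A = lam%:M + l *m p, l != 0 & p != 0].

Section LinearAction.
Variables (K : numClosedFieldType) (n d : nat) (X : set (pspace K n.+3)).
Variable F : {mpoly K[n.+4]}.
Hypothesis XF : hyp_form d X F.
Hypothesis d4 : (4 <= d)%N.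
Variables (g : pspace K n.+3 -> pspace K n.+3) (A : 'M[K]_n.+4).
Hypothesis Aunit : A \in unitmx.
Hypothesis gE : forall v : 'rV[K]_n.+4, v != 0 -> X (pof v) -> g (pof v) = pof (v *m A).
Hypothesis gX : forall v : 'rV[K]_n.+4, v != 0 -> X (pof v) -> X (pof (v *m A)).

Lemma low_degree_eq0 e P : P \is e.-homog -> (e < d)%N ->
  (forall v : 'rV[K]_n.+4, v != 0 -> X (pof v) -> veval P v = 0) -> P = 0.
Proof.
move=> hP ed h; have [hF _ _ _ XV] := XF.
apply/eqP; apply: contraLR ed => P0; rewrite -leqNgt.
by apply: (dvdr_homog_deg hF hP P0); apply/XV/vanishingP.
Qed.

Lemma iter_action m v : v != 0 -> X (pof v) ->
  [/\ v *m A ^+ m != 0, X (pof (v *m A ^+ m)) & iter m g (pof v) = pof (v *m A ^+ m)].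
Proof.
move=> v0 Xv; elim: m => [|m [nz Xm IH]]; first by rewrite expr0 mulmx1.
rewrite exprSr -mulmxE mulmxA; split.
- by apply: row_free_neq0 nz; rewrite row_free_unit.
- exact: gX.
- by rewrite /= IH gE.
Qed.

Lemma invariant_form : exists2 c, c != 0 & forall v, veval F (v *m A) = c * veval F v.
Proof.
have [hF _ Fp XE XV] := XF; have F0 : F != 0 by case: Fp.
have : dvdr F (lsub A F).
  apply/XV/vanishingP => v v0 Xv; rewrite veval_lsub; apply/XE; last exact: gX.
  by apply: row_free_neq0 v0; rewrite row_free_unit.
case=> c ec.
have AF0 : lsub A F != 0.
  have [v nz] := veval_neq0 F0; apply: contraNneq nz => /(congr1 (fun P => veval P (v *m invmx A))).
  by rewrite veval_lsub mulmxKV // veval0 => ->.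
have cF0 : c * F != 0 by rewrite -ec.
have [e [_ hc]] : exists e, (e <= d)%N /\ c \is e.-homog.
  by apply: (@factor_homog _ _ d c F cF0); rewrite -ec; apply: lsub_homog.
have e0 : e = 0%N.
  have := dhomog_uniq cF0 (dhomogM hc hF); rewrite -ec => /(_ _ (lsub_homog A hF)).
  by rewrite -{2}[d]add0n => /eqP; rewrite eqn_add2r => /eqP.
rewrite e0 in hc; have cE := homog0_const hc; exists c@_0.
  by apply: contraNneq cF0 => z; rewrite cE z mpolyC0 mul0r.
by move=> v; rewrite -veval_lsub ec vevalM {1}cE vevalC.
Qed.

Section Homology.
Variables (lam : K) (l : 'cV[K]_n.+4) (p : 'rV[K]_n.+4).
Hypothesis hom : homology A lam l p.
Let s := (p *m l) 0 0.

Lemma homology_lam_neq0 : lam != 0.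
Proof.
have [eA l0 p0] := hom; have /cV0Pn [k lk] := l0.
have B0 := row_free_neq0 (kerbasis_free lk) (ones_neq0 K n.+2).
have Af : row_free A by rewrite row_free_unit.
have Av0 := row_free_neq0 Af B0; apply: contraNneq Av0 => z.
by rewrite eA rank_one_mul z scale0r -mulmxA kerbasis_mul mulmx0 mxE scale0r addr0.
Qed.

(** On X every [v] is proportional to its image under [A ^+ m], which differs from [a *: v] by [c]
    times the value of [l] at [v] times [p]. For nonzero [c], all products of [l] with a minor of
    [v] and [p] then vanish on X. They have degree 2, so they are zero, although some minor is
    not. *)
Lemma rank_one_trivial c a m : A ^+ m = a%:M + c *: (l *m p) ->
  (forall y, X y -> iter m g y = y) -> c = 0.
Proof.
move=> eA id; have [_ l0 p0] := hom; apply/eqP; apply: contraT => c0.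
have /rV0Pn [i pi] := p0.
pose j := lift i ord0; have ij : i != j := neq_lift _ _.
pose P := linform l * (p 0 i *: 'X_j - p 0 j *: 'X_i).
have : P = 0.
  apply: (@low_degree_eq0 2 P).
  - apply: (@dhomogM _ _ _ 1 _ 1 _ (linform_homog _)).
    by apply: rpredB; apply: rpredZ; apply: homogX.
  - by apply: leq_trans d4.
  - move=> v v0 Xv; have [nz _ e] := iter_action m v0 Xv.
    have := id _ Xv; rewrite e => /(pof_inj nz v0) [b b0].
    rewrite eA mulmxDr mul_mx_scalar -scalemxAr mulmxA [v *m l]mx11_scalar mul_scalar_mx => E.
    rewrite vevalM veval_linform vevalB !vevalZ !vevalX.
    have E' k : c * (v *m l) 0 0 * p 0 k = (b - a) * v 0 k.
      by move/rowP: E => /(_ k); rewrite !mxE mulrBl => <-; ring.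
    apply: (mulfI c0); rewrite mulr0 mulrA mulrBr.
    rewrite (mulrA _ (p 0 i)) (mulrA _ (p 0 j)) !E'; ring.
move/eqP; rewrite mulf_eq0 => /orP[/eqP|/eqP] e.
  have /cV0Pn [k lk] := l0.
  have := congr1 (fun P => veval P (delta_mx 0 k)) e.
  by rewrite veval_linform -rowE mxE veval0 => /eqP; rewrite (negbTE lk).
have := congr1 (fun P => veval P (delta_mx 0 j)) e.
rewrite vevalB !vevalZ !vevalX veval0 !mxE !eqxx (negbTE ij) mulr1 mulr0 subr0.
by move/eqP; rewrite (negbTE pi).
Qed.

Hypothesis gord : automorphism_order X g d.-1.

(** For [s = 0] the coefficient [c] of the power [d - 1] is a nonzero multiple of a power of [lam]:
    an elation has infinite order in characteristic 0. *)
Lemma homology_axis : s != 0.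
Proof.
have [dgt0 id _] := gord; have [eA _ _] := hom.
have [c [eAm [_ c0]]] := rank_one_power lam l p d.-1; rewrite -eA in eAm.
have := rank_one_trivial eAm id; apply: contra_eqN => /eqP /c0 ->.
by rewrite mulrn_eq0 negb_or -lt0n dgt0 expf_neq0 // homology_lam_neq0.
Qed.

(** The order of [g] is that of the ratio of the two eigenvalues of [A]: [lam] on the axis and
    [lam + s] at the center. *)
Lemma homology_primitive : d.-1.-primitive_root ((lam + s) / lam).
Proof.
have [dgt0 id nid] := gord; have [eA _ _] := hom.
have lam0 := homology_lam_neq0.
have cE m : (forall y, X y -> iter m g y = y) <-> ((lam + s) / lam) ^+ m = 1.
  have [c [eAm [cs _]]] := rank_one_power lam l p m; rewrite -eA in eAm.
  have lm : lam ^+ m != 0 by rewrite expf_neq0.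
  split=> [/(rank_one_trivial eAm) c0|].
    move: cs; rewrite c0 mul0r => /esym/eqP; rewrite subr_eq0 => /eqP e.
    by rewrite expr_div_n e mulfV.
  rewrite expr_div_n => /(canRL (divfK lm)); rewrite mul1r => e.
  move: cs; rewrite /s e subrr => /eqP; rewrite mulf_eq0 (negbTE homology_axis) orbF => /eqP c0.
  apply: pof_ind => v v0 Xv; have [_ _ ->] := iter_action m v0 Xv.
  by rewrite eAm c0 scale0r addr0 mul_mx_scalar pofZ.
apply/andP; split=> //; apply/forallP => i; rewrite unity_rootE.
have [->|ni] := eqVneq i.+1 d.-1; first by have /cE -> := id; rewrite eqxx.
rewrite eqbF_neg; apply/eqP => /cE; apply: nid.
by rewrite /= ltn_neqAle ni ltn_ord.
Qed.

End Homology.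
End LinearAction.

Section Structure.
Variables (K : numClosedFieldType) (n d : nat) (X : set (pspace K n.+3)).
Variable F : {mpoly K[n.+4]}.
Hypothesis XF : hyp_form d X F.
Hypothesis d4 : (4 <= d)%N.
Variables (lam c : K) (l : 'cV[K]_n.+4) (p : 'rV[K]_n.+4) (k : 'I_n.+4).
Let s := (p *m l) 0 0.
Hypothesis lam0 : lam != 0.
Hypothesis s0 : s != 0.
Hypothesis lk : l k 0 != 0.
Hypothesis prim : d.-1.-primitive_root ((lam + s) / lam).
Hypothesis FA : forall v, veval F (v *m (lam%:M + l *m p)) = c * veval F v.
Let H := kerbasis l k.

Definition axis_section := lsub H F.

Lemma axis_section_neq0 : axis_section != 0.
Proof.
(* The axis is a hyperplane, so the single transversal direction [p] plays both roles. *)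
have [hF smF _ _ _] := XF; apply: (restriction_neq0 (e := p) (e' := p) hF _ smF (kerbasis_free lk)).
  by apply: leq_trans d4.
exact: submx_trans (kerbasis_full lk s0) (addsmxSl _ _).
Qed.

(* Writing F(yH + tp) as a polynomial in t, the invariance of F under the
   homology only leaves the exponents of t divisible by d - 1. *)
Lemma homology_normal_form : exists L : {mpoly K[n.+3]},
  [/\ L \is 1.-homog, L != 0 &
      forall y t, veval F (y *m H + t *: p) = t ^+ d.-1 * veval L y + veval axis_section y].
Proof.
have [hF smF _ _ _] := XF.
have [q [qE sq hq]] := expansion H p hF.
have q0 : q`_0 = axis_section.
  apply: veval_ext => y; rewrite veval_lsub -[_ *m _]addr0 -[X in _ + X](scale0r p) qE.
  by rewrite horner_coef0 coef_map.
pose zeta := (lam + s) / lam.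
have act y t : (y *m H + t *: p) *m (lam%:M + l *m p) = lam *: (y *m H + (zeta * t) *: p).
  rewrite rank_one_mul mulmxDl -mulmxA kerbasis_mul mulmx0 add0r -scalemxAl mxE -/s.
  rewrite !scalerDr -addrA !scalerA -scalerDl; congr (_ + _ *: _).
  by rewrite /zeta; field.
have coefE i y : lam ^+ d * zeta ^+ i * veval q`_i y = c * veval q`_i y.
  have er : lam ^+ d *: (map_poly (meval (y 0)) q \Po (zeta *: 'X)) = c *: map_poly (meval (y 0)) q.
    apply: poly_ext_nz => t _; rewrite !hornerZ horner_comp hornerZ hornerX -!qE.
    by rewrite -FA act (homog_scale _ _ hF).
  have := congr1 (fun r : {poly K} => r`_i) er; rewrite !coefZ coef_map => <-.
  rewrite -mulrA; congr (_ * _); rewrite comp_polyE coef_sum.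
  have [iq|iq] := ltnP i (size (map_poly (meval (y 0)) q)); last first.
    rewrite big1 => [|j _].
      by move: iq => /(nth_default 0); rewrite coef_map /= /veval => ->; rewrite mulr0.
    rewrite exprZn !coefZ coefXn gtn_eqF ?mulr0 //; exact: leq_trans (ltn_ord j) iq.
  rewrite (bigD1 (Ordinal iq)) //= big1 ?addr0 => [|j]; rewrite exprZn !coefZ coefXn.
    by rewrite eqxx mulr1 coef_map mulrC.
  by rewrite -val_eqE eq_sym => /negbTE /= ->; rewrite !mulr0.
(* On the axis [A] is the scalar [lam], and F does not vanish identically there: this fixes the
   multiplier. *)
have ec : c = lam ^+ d.
  have [y nz] := veval_neq0 axis_section_neq0; apply: (mulIf nz).
  by rewrite -q0 -coefE expr0 mulr1.
have supp i : q`_i != 0 -> (d.-1 %| i)%N.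
  move=> /veval_neq0 [y nz]; rewrite (prim_order_dvd prim).
  apply/eqP; have := coefE i y; rewrite ec -mulrA => /(mulfI (expf_neq0 d lam0)).
  by rewrite -[RHS]mul1r => /(mulIf nz).
have qi i : i != 0%N -> i != d.-1 -> q`_i = 0.
  move=> i0 id; apply/eqP; apply: contraT => nz; have := supp _ nz.
  have [di|di] := leqP (size q) i; first by rewrite nth_default ?eqxx in nz.
  have : (i <= d)%N by rewrite -ltnS (leq_trans di).
  move=> le /dvdnP [[|[|a]] e]; [by rewrite e in i0|by rewrite e mul1n eqxx in id|].
  by move: le d4; rewrite e !mulSn; lia.
have d1 : (0 < d.-1)%N by case: d d4 => [|[]].
have expand y t : veval F (y *m H + t *: p) = t ^+ d.-1 * veval q`_d.-1 y + veval axis_section y.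
  rewrite qE (@horner_coef_wide _ d.+1); last by apply: leq_trans (size_poly _ _) sq.
  rewrite big_ord_recl coef_map expr0 mulr1 q0 addrC; congr (_ + _).
  have dd : (d.-1.-1 < d)%N by move: d4; lia.
  rewrite (bigD1 (Ordinal dd)) //= big1 ?addr0 => [|i].
    by rewrite coef_map mulrC /bump /= add1n prednK.
  rewrite -val_eqE /= => ni; rewrite coef_map /= qi ?meval0 ?mul0r //.
  by apply: contra ni; rewrite /bump /= add1n => /eqP <-.
exists q`_d.-1; split=> //.
  have := hq d.-1; rewrite (_ : (d - d.-1)%N = 1%N) //; by move: d4; lia.
(* Were [L] zero, the value of F would not depend on [t], and X would be a cone, singular at its
   vertex [p]. *)
apply/eqP => L0; have p0 : p != 0.
  by apply: contraNneq s0 => z; rewrite /s z mul0mx mxE.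
have axis_hom : axis_section \is d.-homog by apply: lsub_homog.
have Fp : veval F p = 0.
  have := expand 0 1; rewrite mul0mx scale1r add0r L0 veval0 mulr0 add0r => ->.
  by apply: (homog_eval0 axis_hom); move: d4; lia.
have [u] := smooth_dirderiv smF p0 Fp; apply/negP; rewrite negbK; apply/eqP.
have : (u <= kerbasis l k + p)%MS by apply: submx_trans (kerbasis_full lk s0); apply: submx1.
case/sub_addsmxP => -[z w] /= ->; rewrite [w]mx11_scalar mul_scalar_mx; move: (w 0 0) => {}w.
apply: (@dirderiv_zero _ _ _ _ _ _ (veval axis_section z *: 'X^d)).
  move=> t; have -> : p + t *: (z *m kerbasis l k + w *: p) = (t *: z) *m H + (1 + t * w) *: p.
    by rewrite scalerDr scalerDl scale1r scalemxAl scalerA addrCA.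
  by rewrite expand L0 veval0 mulr0 add0r (homog_scale _ _ axis_hom) hornerZ hornerXn mulrC.
rewrite derivZ derivXn hornerZ hornerMn hornerXn expr0n gtn_eqF //.
by rewrite mul0rn mulr0.
Qed.

Lemma homology_center : veval F p = 0.
Proof.
have [L [hL _ expand]] := homology_normal_form; have [hF _ _ _ _] := XF.
have := expand 0 1; rewrite mul0mx scale1r add0r => ->.
rewrite (homog_eval0 hL) // mulr0 add0r (homog_eval0 (lsub_homog _ hF)) //.
by move: d4; lia.
Qed.

(** Near a point of the axis the term with [t ^+ d.-1] contributes nothing to first order, since
    [d - 1] is at least 2. A singular point of the section is therefore singular on X. *)
Lemma axis_section_smooth : smooth_form axis_section.
Proof.
have [hF smF _ _ _] := XF; have [L [hL _ expand]] := homology_normal_form.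
move=> y y0 Gy; apply: contrapT => Hsing.
have yH0 : y *m H != 0 by apply: (row_free_neq0 (kerbasis_free lk)).
have [|u] := smooth_dirderiv smF yH0; first by rewrite -veval_lsub.
apply/negP; rewrite negbK; apply/eqP.
have : (u <= kerbasis l k + p)%MS by apply: submx_trans (kerbasis_full lk s0); apply: submx1.
case/sub_addsmxP => -[z w] /= ->; rewrite [w]mx11_scalar mul_scalar_mx; move: (w 0 0) => {}w.
have [r [rE dr]] := deriv_line axis_section y z.
have [r' [rE' _]] := deriv_line L y z.
apply: (@dirderiv_zero _ _ _ _ _ _ (w ^+ d.-1 *: 'X^(d.-1) * r' + r)).
  move=> t; have -> : y *m H + t *: (z *m kerbasis l k + w *: p) = (y + t *: z) *m H + (t * w) *: p.
    by rewrite scalerDr scalerA mulmxDl scalemxAl addrA.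
  by rewrite expand -rE -rE' hornerD hornerM hornerZ hornerXn exprMn [X in X * _]mulrC.
rewrite derivD hornerD dr big1 ?addr0 => [|i _]; last first.
  have [->|nz] := eqVneq (veval axis_section^`M(i) y) 0; first by rewrite mul0r.
  by case: Hsing; exists i.
rewrite derivM hornerD !hornerM derivZ derivXn !hornerZ hornerMn !hornerXn !expr0n.
have -> : (d.-1.-1 == 0)%N = false by move: d4; lia.
have -> : (d.-1 == 0)%N = false by move: d4; lia.
by rewrite mul0rn !mulr0 !mul0r addr0.
Qed.

Lemma axis_section_prime : prime_elt axis_section.
Proof.
have [hF _ _ _ _] := XF; apply: (smooth_form_prime (lsub_homog H hF) axis_section_neq0 _ axis_section_smooth).
by move: d4; lia.
Qed.

End Structure.

(** * Function fields and Galois points *)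

Lemma div_crossP (F : fieldType) (a b c e : F) : b != 0 -> e != 0 ->
  (a / b = c / e <-> a * e = c * b).
Proof. by move=> b0 e0; split=> /eqP; [rewrite eqr_div|rewrite -eqr_div] => // /eqP. Qed.

Section SubfieldVal.
Variables (F : fieldType) (S : divringClosed F).
Local Notation T := (subfield_type S).
Implicit Types f : T.

Lemma subfield_valB f f' : subfield_val (f - f') = subfield_val f - subfield_val f'.
Proof. exact: (rmorphB (val : T -> F)). Qed.
Lemma subfield_valD f f' : subfield_val (f + f') = subfield_val f + subfield_val f'.
Proof. exact: (rmorphD (val : T -> F)). Qed.
Lemma subfield_valM f f' : subfield_val (f * f') = subfield_val f * subfield_val f'.
Proof. exact: (rmorphM (val : T -> F)). Qed.
Lemma subfield_val1 : subfield_val (1 : T) = 1.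
Proof. exact: (rmorph1 (val : T -> F)). Qed.
Lemma subfield_val0 : subfield_val (0 : T) = 0.
Proof. exact: (rmorph0 (val : T -> F)). Qed.
Lemma subfield_valV f : subfield_val f^-1 = (subfield_val f)^-1.
Proof. exact: (fmorphV (val : T -> F)). Qed.

End SubfieldVal.

Section FunctionField.
Variables (K : numClosedFieldType) (N : nat) (Y : projvar K N).
Implicit Types (P Q : {mpoly K[N.+1]}) (f : funfield Y).

Lemma coord_class_zmod : zmod_morphism (@coord_class K N Y).
Proof. exact: coord_classB. Qed.
HB.instance Definition _ := GRing.isZmodMorphism.Build _ _ (@coord_class K N Y) coord_class_zmod.

Lemma coord_class_monoid : monoid_morphism (@coord_class K N Y).
Proof. by split; [exact: coord_class1|exact: coord_classM]. Qed.
HB.instance Definition _ := GRing.isMonoidMorphism.Build _ _ (@coord_class K N Y) coord_class_monoid.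

Lemma coord_classD P Q : coord_class Y (P + Q) = coord_class Y P + coord_class Y Q.
Proof. exact: (rmorphD (@coord_class K N Y)). Qed.
Lemma coord_classN P : coord_class Y (- P) = - coord_class Y P.
Proof. exact: (rmorphN (@coord_class K N Y)). Qed.

Lemma funfield_val_inj f f' : subfield_val f = subfield_val f' -> f = f'.
Proof. exact: val_inj. Qed.

Lemma exists_ratfun f : exists P Q, ratfun_eq f P Q.
Proof. by have /asboolP := valP f. Qed.

Lemma make_ratfun k P Q : P \is k.-homog -> Q \is k.-homog -> Q \notin vanishing Y ->
  exists f : funfield Y, ratfun_eq f P Q.
Proof.
move=> hP hQ nQ; have h : coord_class Y P / coord_class Y Q \in @degree0 K N Y.
  by apply/asboolP; exists P, Q, k.
by exists (Subfield h), k.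
Qed.

Lemma notin_vanishing1 : 1 \notin vanishing Y.
Proof. by rewrite -coord_class_eq0 coord_class1 oner_eq0. Qed.

Lemma notin_vanishingM P Q : P \notin vanishing Y -> Q \notin vanishing Y -> P * Q \notin vanishing Y.
Proof. by move=> hP hQ; rewrite -coord_class_eq0 coord_classM mulf_neq0 ?coord_class_eq0. Qed.

Lemma ratfun_eqD f f' P Q P' Q' : ratfun_eq f P Q -> ratfun_eq f' P' Q' ->
  ratfun_eq (f + f') (P * Q' + P' * Q) (Q * Q').
Proof.
move=> [k [hP hQ nQ e]] [k' [hP' hQ' nQ' e']]; exists (k + k')%N; split.
- by apply: rpredD; [exact: dhomogM|rewrite addnC; exact: dhomogM].
- exact: dhomogM.
- exact: notin_vanishingM.
- by rewrite subfield_valD e e' addf_div ?coord_class_eq0 // coord_classD !coord_classM.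
Qed.

Lemma ratfun_eqN f P Q : ratfun_eq f P Q -> ratfun_eq (- f) (- P) Q.
Proof.
move=> [k [hP hQ nQ e]]; exists k; split=> //; first by rewrite rpredN.
by rewrite -sub0r subfield_valB subfield_val0 sub0r e coord_classN mulNr.
Qed.

Lemma ratfun_eqM f f' P Q P' Q' : ratfun_eq f P Q -> ratfun_eq f' P' Q' ->
  ratfun_eq (f * f') (P * P') (Q * Q').
Proof.
move=> [k [hP hQ nQ e]] [k' [hP' hQ' nQ' e']]; exists (k + k')%N; split.
- exact: dhomogM.
- exact: dhomogM.
- exact: notin_vanishingM.
- by rewrite subfield_valM e e' !coord_classM mulf_div.
Qed.

Lemma ratfun_eqV f P Q : ratfun_eq f P Q -> f != 0 -> ratfun_eq f^-1 Q P.
Proof.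
move=> [k [hP hQ nQ e]] f0; exists k; split=> //; last by rewrite subfield_valV e invf_div.
rewrite -coord_class_eq0; apply: contraNneq f0 => z.
by apply/eqP; apply: funfield_val_inj; rewrite e z mul0r subfield_val0.
Qed.

Lemma ratfun_eq1 : ratfun_eq (1 : funfield Y) 1 1.
Proof.
exists 0%N; split; rewrite ?dhomog1 ?notin_vanishing1 //.
by rewrite subfield_val1 coord_class1 divr1.
Qed.

Lemma ratfun_eq_cross f P Q P' Q' : ratfun_eq f P Q -> ratfun_eq f P' Q' ->
  P * Q' - P' * Q \in vanishing Y.
Proof.
move=> [k [_ _ nQ e]] [k' [_ _ nQ' e']]; rewrite -coord_class_eq0 coord_classB !coord_classM.
rewrite subr_eq0; apply/eqP/div_crossP; rewrite ?coord_class_eq0 //.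
by rewrite -e -e'.
Qed.

Lemma ratfun_eq_inj f f' P Q P' Q' : ratfun_eq f P Q -> ratfun_eq f' P' Q' ->
  P * Q' - P' * Q \in vanishing Y -> f = f'.
Proof.
move=> [k [_ _ nQ e]] [k' [_ _ nQ' e']].
rewrite -coord_class_eq0 coord_classB !coord_classM subr_eq0 => /eqP h.
apply: funfield_val_inj; rewrite e e'.
by apply/div_crossP; rewrite ?coord_class_eq0.
Qed.

Lemma ratfun_pair f : exists PQ : {mpoly K[N.+1]} * {mpoly K[N.+1]}, ratfun_eq f PQ.1 PQ.2.
Proof. by have [P [Q e]] := exists_ratfun f; exists (P, Q). Qed.

Definition ratfun_rep f := projT1 (cid (ratfun_pair f)).

Lemma ratfun_repP f : ratfun_eq f (ratfun_rep f).1 (ratfun_rep f).2.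
Proof. exact: projT2 (cid (ratfun_pair f)). Qed.

Section Map.
Variables (S : fieldType) (psi : {rmorphism {mpoly K[N.+1]} -> S}).
Hypothesis psi0 : forall k P, P \is k.-homog -> (psi P == 0) = (P \in vanishing Y).

(** The kernel of [psi] is prescribed on forms only. Restriction to an affine chart is such a map,
    although it also kills inhomogeneous polynomials that do not vanish on [Y]. *)
Definition ffmap f : S := psi (ratfun_rep f).1 / psi (ratfun_rep f).2.

Lemma ffmapE f P Q : ratfun_eq f P Q -> ffmap f = psi P / psi Q.
Proof.
rewrite /ffmap => fPQ; have := ratfun_repP f; case: (ratfun_rep f) => P' Q' /= fPQ'.
have /= h := ratfun_eq_cross fPQ' fPQ; have [k [hP hQ nQ e]] := fPQ.
have [k' [hP' hQ' nQ' e']] := fPQ'; apply/div_crossP; rewrite ?(psi0 hQ) ?(psi0 hQ') //.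
apply/eqP; rewrite -subr_eq0 -!rmorphM -rmorphB (@psi0 (k' + k)%N) //.
by apply: rpredB; [exact: dhomogM|rewrite addnC; exact: dhomogM].
Qed.

Lemma psi_denom f P Q : ratfun_eq f P Q -> psi Q != 0.
Proof. by move=> [k [_ hQ nQ _]]; rewrite (psi0 hQ). Qed.

Lemma ffmap_zmod : zmod_morphism ffmap.
Proof.
move=> f f'; have [P [Q e]] := exists_ratfun f; have [P' [Q' e']] := exists_ratfun f'.
rewrite (ffmapE (ratfun_eqD e (ratfun_eqN e'))) (ffmapE e) (ffmapE e').
by rewrite -mulNr addf_div ?(psi_denom e) ?(psi_denom e') // rmorphD !rmorphM rmorphN.
Qed.

Lemma ffmap_monoid : monoid_morphism ffmap.
Proof.
split=> [|f f']; first by rewrite (ffmapE ratfun_eq1) rmorph1 divr1.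
have [P [Q e]] := exists_ratfun f; have [P' [Q' e']] := exists_ratfun f'.
by rewrite (ffmapE (ratfun_eqM e e')) (ffmapE e) (ffmapE e') mulf_div !rmorphM.
Qed.

End Map.

Lemma ratfun_value_cross f y c P Q : pvset Y y -> ratfun_value f y c -> ratfun_eq f P Q ->
  heval P y = c * heval Q y.
Proof.
move=> Yy [P' [Q' [e' Q'0 ->]]] e; have h := ratfun_eq_cross e' e.
have [k [hP hQ _ _]] := e; have [k' [hP' hQ' _ _]] := e'.
have hh : P' * Q - P * Q' \is (k' + k).-homog.
  by apply: rpredB; [exact: dhomogM|rewrite addnC; exact: dhomogM].
have := (vanishing_homog _ hh).1 h _ Yy; rewrite /heval vevalB !vevalM => /eqP.
rewrite subr_eq0 => /eqP E; apply: (mulIf Q'0); rewrite -E mulrAC; congr (_ * _).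
by rewrite divfK.
Qed.

End FunctionField.

Lemma minors_collinear (K : fieldType) n (u w : 'rV[K]_n) :
  (forall i j, u 0 i * w 0 j = u 0 j * w 0 i) -> w != 0 -> exists c, u = c *: w.
Proof.
move=> h w0; have /rV0Pn [k wk] := w0.
exists (u 0 k / w 0 k); apply/rowP => j; rewrite mxE mulrAC h.
by rewrite mulfK.
Qed.

Section PencilPreserving.
Variables (K : fieldType) (N : nat) (A : 'M[K]_N.+3) (l : 'cV[K]_N.+3) (p : 'rV[K]_N.+3).
Let s := (p *m l) 0 0.
Let Pi := s%:M - l *m p.
Hypothesis s0 : s != 0.
Hypothesis pencil : forall (v : 'rV[K]_N.+3) i j,
  (v *m A *m Pi) 0 i * (v *m Pi) 0 j = (v *m A *m Pi) 0 j * (v *m Pi) 0 i.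

Lemma projection_mul (v : 'rV[K]_N.+3) : v *m Pi = s *: v - (v *m l) 0 0 *: p.
Proof.
by rewrite mulmxBr mul_mx_scalar mulmxA [v *m l]mx11_scalar mul_scalar_mx -mx11_scalar.
Qed.

(** [Pi] is [s] times the projection from [p]. By the minors, [A] acts on the quotient by the line
    of [p] with every vector an eigenvector, hence as a scalar, and it preserves that line. So [A]
    minus a scalar has its image in the line of [p]. *)
Lemma pencil_rank_one : exists lam (m : 'cV[K]_N.+3), A = lam%:M + m *m p.
Proof.
have l0 : l != 0 by apply: contraNneq s0 => z; rewrite /s z mulmx0 mxE.
have /cV0Pn [k lk] := l0; pose H := kerbasis l k.
have Hfree := kerbasis_free lk.
pose h i := row i H; have hPi i : h i *m Pi = s *: h i.
  by rewrite projection_mul /h -row_mul kerbasis_mul row0 mxE scale0r subr0.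
have h_ind i j a b : i != j -> a *: h i + b *: h j = 0 -> a = 0 /\ b = 0.
  move=> ij; rewrite /h !rowE !scalemxAl -mulmxDl => e.
  have /rowP E : a *: delta_mx 0 i + b *: delta_mx 0 j = 0 :> 'rV[K]_N.+2.
    by apply: (row_free_inj Hfree); rewrite e mul0mx.
  split; [have := E i|have := E j]; rewrite !mxE !eqxx.
    by rewrite (negbTE ij) mulr0 addr0 mulr1.
  by rewrite eq_sym (negbTE ij) mulr0 add0r mulr1.
have other i : exists j : 'I_N.+2, i != j by exists (lift i ord0); apply: neq_lift.
have h0 i : h i != 0.
  have [j ij] := other i; apply: contraTneq (oner_neq0 K) => z; rewrite negbK.
  by have [|-> _] := h_ind i j 1 0 ij; rewrite ?eqxx // z scaler0 scale0r addr0.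
have hp0 i : h i *m Pi != 0 by rewrite hPi scaler_eq0 negb_or s0 h0.
pose M := A *m Pi.
have eig (v : 'rV[K]_N.+3) : v *m Pi != 0 -> exists c, v *m M = c *: (v *m Pi).
  by move=> nz; apply: minors_collinear nz => i j; rewrite /M mulmxA; apply: pencil.
have cE i : exists c, h i *m M = c *: h i.
  by have [c ->] := eig _ (hp0 i); exists (c * s); rewrite hPi scalerA.
have [c0 hc0] := cE ord0.
have hc i : h i *m M = c0 *: h i.
  have [->//|i0] := eqVneq i ord0; have [c hc] := cE i.
  have nz : (h i + h ord0) *m Pi != 0.
    rewrite mulmxDl !hPi -scalerDr scaler_eq0 negb_or s0 /=.
    apply: contraTneq (oner_neq0 K) => z; rewrite negbK.
    by have [|-> _] := h_ind i ord0 1 1 i0; rewrite ?eqxx // !scale1r.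
  have [b] := eig _ nz; rewrite !mulmxDl hc hc0 !hPi -scalerDr scalerA scalerDr.
  move/eqP; rewrite -subr_eq0 opprD addrACA -!scalerBl => /eqP /(h_ind _ _ _ _ i0) [/eqP e /eqP].
  rewrite subr_eq0 => /eqP ->; move: e; rewrite subr_eq0 => /eqP <-.
  by [].
have pPi : p *m Pi = 0 by rewrite projection_mul -/s subrr.
(* Adding [p] to [h i] shows that [p *m M] is a multiple of each [h i], and two of these are
   independent. *)
have pM : p *m M = 0.
  have bE i : exists b, p *m M = b *: h i.
    have nz : (p + h i) *m Pi != 0 by rewrite mulmxDl pPi add0r.
    have [b] := eig _ nz; rewrite !mulmxDl pPi add0r hc hPi scalerA => e.
    by exists (b * s - c0); rewrite scalerBl -e addrK.
  have [j ij] := other ord0; have [b eb] := bE ord0; have [b' eb'] := bE j.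
  have [|b0 _] := h_ind _ _ b (- b') ij; first by rewrite scaleNr -eb -eb' subrr.
  by rewrite eb b0 scale0r.
exists (c0 / s); suff : (A - (c0 / s)%:M <= p)%MS.
  by move=> /submxP [m e]; exists m; rewrite -e addrC subrK.
have key (v : 'rV[K]_N.+3) : v *m M = c0 *: v -> (v *m (A - (c0 / s)%:M) <= p)%MS.
  rewrite /M mulmxA projection_mul mulmxBr mul_mx_scalar => /eqP.
  rewrite subr_eq => /eqP /(congr1 (fun x => s^-1 *: x)); rewrite scalerA mulVf // scale1r => ->.
  by rewrite scalerDr !scalerA [s^-1 * c0]mulrC addrAC subrr add0r scalemx_sub.
have HA : (H *m (A - (c0 / s)%:M) <= p)%MS.
  by apply/row_subP => i; rewrite row_mul; apply: key; apply: hc.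
have pA : (p *m (A - (c0 / s)%:M) <= p)%MS.
  rewrite mulmxBr mul_mx_scalar; apply: addmx_sub; last by rewrite -scaleNr scalemx_sub.
  move: pM; rewrite /M mulmxA projection_mul => /eqP; rewrite subr_eq0 => /eqP e.
  by rewrite -[p *m A]scale1r -(mulVf s0) -scalerA e scalerA scalemx_sub.
apply/row_subP => i; rewrite rowE.
have : ((delta_mx 0 i : 'rV[K]_N.+3) <= kerbasis l k + p)%MS by apply: submx_trans (kerbasis_full lk s0); apply: submx1.
case/sub_addsmxP => -[u w] /= ->; rewrite mulmxDl -!mulmxA.
by apply: addmx_sub; apply: mulmx_sub.
Qed.

End PencilPreserving.

(** * From a Galois point to a homology *)

Section GaloisImpliesHomology.
Variables (K : numClosedFieldType) (n d : nat) (X : projvar K n.+3).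
Variable F : {mpoly K[n.+4]}.
Hypothesis XF : hyp_form d X F.
Hypothesis d4 : (4 <= d)%N.
Variables (g : pspace K n.+3 -> pspace K n.+3) (A : 'M[K]_n.+4).
Hypothesis Aunit : A \in unitmx.
Hypothesis gE : forall v : 'rV[K]_n.+4, v != 0 -> pvset X (pof v) -> g (pof v) = pof (v *m A).
Hypothesis gX : forall v : 'rV[K]_n.+4, v != 0 -> pvset X (pof v) -> pvset X (pof (v *m A)).

Lemma projection_formE (q : pspace K n.+3) l j v :
  veval (projection_form q l j) v = (v *m ((pcoord q *m l) 0 0)%:M - v *m (l *m pcoord q)) 0 j.
Proof.
rewrite vevalB vevalZ vevalX vevalM vevalC -/(linform l) veval_linform.
rewrite mul_mx_scalar [in RHS]mulmxA [v *m l]mx11_scalar mul_scalar_mx !mxE.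
by rewrite mulr1n.
Qed.

Lemma projection_form_homog (q : pspace K n.+3) l j : projection_form q l j \is 1.-homog.
Proof.
apply: rpredB; first by apply: rpredZ; apply: homogX.
by apply: (@dhomogM _ _ _ 1 _ 0 _ (linform_homog l) (homogC _ _)).
Qed.

Lemma pull_projectionX (q : pspace K n.+3) l j :
  pull_projection q l 'X_j = projection_form q l j.
Proof. by rewrite /pull_projection comp_mpolyXU -tnth_nth tnth_mktuple. Qed.

(** A quotient of two coordinates of the projection lies in K_p, so [tau] fixes it and it takes
    equal values at [v] and [v *m A]. Cleared of denominators these equalities are minors, of degree
    2, which extend from X to the whole space. *)
Lemma galois_homology q : belongs_to_galois_point X q g -> automorphism_order X g d.-1 ->
  exists lam l, homology A lam l (pcoord q).
Proof.
move=> [_ [tau ind [[_ tfix] _]]] [dgt0 id nid].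
set p := pcoord q; have p0 : p != 0 := pcoord_neq0 q.
have /rV0Pn [k pk] := p0.
pose l : 'cV[K]_n.+4 := delta_mx k 0.
have sE : (p *m l) 0 0 = p 0 k by rewrite /l -colE mxE.
have s0 : (p *m l) 0 0 != 0 by rewrite sE.
pose Pi := ((p *m l) 0 0)%:M - l *m p.
have piE j v : veval (projection_form q l j) v = (v *m Pi) 0 j by rewrite projection_formE mulmxBr.
have hpi j := projection_form_homog q l j.
have key i j (v : 'rV[K]_n.+4) : v != 0 -> pvset X (pof v) -> veval (projection_form q l j) (v *m A) != 0 ->
    (v *m A *m Pi) 0 i * (v *m Pi) 0 j = (v *m A *m Pi) 0 j * (v *m Pi) 0 i.
  move=> v0 Xv nz; have vA0 : v *m A != 0 by apply: row_free_neq0 v0; rewrite row_free_unit.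
  have nj : projection_form q l j \notin vanishing X.
    by apply: contraNN nz => /vanishingP h; rewrite h //; apply: gX.
  have [f fE] := make_ratfun (hpi i) (hpi j) nj.
  have fk : projection_subfield q f.
    exists l, 1%N, 'X_i, 'X_j; split; rewrite ?homogX //.
    by rewrite !pull_projectionX.
  have val : ratfun_value f (g (pof v)) (heval (projection_form q l i) (g (pof v)) / heval (projection_form q l j) (g (pof v))).
    exists (projection_form q l i), (projection_form q l j); split=> //.
    by rewrite gE // (heval_pof (hpi j)).
  have := ind _ _ _ Xv val; rewrite tfix // => val'.
  have := ratfun_value_cross Xv val' fE; rewrite gE // /heval.
  have [a a0 ->] := pcoord_pof v0; have [b b0 ->] := pcoord_pof vA0.
  rewrite !(homog_scale _ _ (hpi _)) !expr1 -mulf_div divff // mul1r mulrCA => /(mulfI a0).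
  rewrite !piE => ->; rewrite mulrA mulrCA mulfV ?mulr1 // -?piE //.
have pencil (v : 'rV[K]_n.+4) i j : (v *m A *m Pi) 0 i * (v *m Pi) 0 j = (v *m A *m Pi) 0 j * (v *m Pi) 0 i.
  pose P := lsub A (projection_form q l i) * projection_form q l j -
            lsub A (projection_form q l j) * projection_form q l i.
  have PE w : veval P w = (w *m A *m Pi) 0 i * (w *m Pi) 0 j - (w *m A *m Pi) 0 j * (w *m Pi) 0 i.
    by rewrite vevalB !vevalM !veval_lsub !piE.
  have : P = 0.
    apply: (low_degree_eq0 XF (e := 2)).
    - by apply: rpredB; apply: (@dhomogM _ _ _ 1 _ 1); rewrite ?lsub_homog.
    - exact: leq_trans d4.
    - move=> w w0 Xw; rewrite PE; apply/eqP; rewrite subr_eq0; apply/eqP.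
      (* The quotient needs a denominator nonzero at [w *m A]. Either of the two coordinates may
         serve, and if both vanish there the minor is zero. *)
      have [zj|nj] := eqVneq (veval (projection_form q l j) (w *m A)) 0; last exact: key.
      have [zi|ni] := eqVneq (veval (projection_form q l i) (w *m A)) 0; last by rewrite (key j i).
      by move: zi zj; rewrite !piE => -> ->; rewrite !mul0r.
  by move=> /(congr1 (fun P => veval P v)); rewrite PE veval0 => /eqP; rewrite subr_eq0 => /eqP.
have [lam [m eA]] := pencil_rank_one s0 pencil; exists lam, m; split=> //.
apply/eqP => m0; have lamA : A = lam%:M by rewrite eA m0 mul0mx addr0.
have lam0 : lam != 0.
  by apply: contraTneq Aunit => z; rewrite lamA z -scalemx1 scale0r unitmxE det0 unitr0.
apply: (nid 1%N) => [|]; first by move: d4; case: d => [|[|[|[]]]].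
apply: pof_ind => v v0 Xv /=; rewrite gE // lamA mul_mx_scalar pofZ //.
Qed.

End GaloisImpliesHomology.

(** * Kummer extensions *)

Section Kummer.
Variables (L : fieldType) (k : set L) (tau : {rmorphism L -> L}) (m : nat) (zeta y : L).
Hypothesis k1 : k 1.
Hypothesis kB : forall a b, k a -> k b -> k (a - b).
Hypothesis kdiv : forall a b, k a -> k b -> k (a / b).
Hypothesis tau_fix : forall a, k a -> tau a = a.
Hypothesis mL : m%:R != 0 :> L.
Hypothesis kzeta : k zeta.
Hypothesis prim : m.-primitive_root zeta.
Hypothesis y0 : y != 0.
Hypothesis tauy : tau y = zeta * y.
Hypothesis kym : k (y ^+ m).

Definition poly_value x := exists2 p, poly_over k p & x = p.[y].

Hypothesis gen : forall x, exists a b, [/\ poly_value a, poly_value b, b != 0 & x = a / b].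

Let k0 : k 0. Proof. by rewrite -(subrr 1); apply: kB. Qed.
Let kN a : k a -> k (- a). Proof. by rewrite -sub0r; apply: kB. Qed.
Let kD a b : k a -> k b -> k (a + b).
Proof. by move=> ka kb; rewrite -[b]opprK; apply: kB => //; apply: kN. Qed.
Let kV a : k a -> k a^-1. Proof. by rewrite -div1r; apply: kdiv. Qed.
Let kM a b : k a -> k b -> k (a * b).
Proof. by move=> ka kb; rewrite -[b]invrK; apply: kdiv => //; apply: kV. Qed.
Let kX a i : k a -> k (a ^+ i).
Proof. by move=> ka; elim: i => [|i ih]; rewrite ?expr0 // exprS; apply: kM. Qed.
Let ksum (I : Type) (r : seq I) (P : pred I) (F : I -> L) :
  (forall i, P i -> k (F i)) -> k (\sum_(i <- r | P i) F i).
Proof. by move=> h; elim/big_ind: _. Qed.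

Lemma poly_overM p q : poly_over k p -> poly_over k q -> poly_over k (p * q).
Proof. by move=> kp kq i; rewrite coefM; apply: ksum => j _; apply: kM. Qed.

Lemma poly_overC c : k c -> poly_over k c%:P.
Proof. by move=> kc i; rewrite coefC; case: eqP. Qed.

Lemma poly_value_affine a b c : k a -> k b -> k c -> poly_value (a * b + c * y).
Proof.
move=> ka kb kc; exists ((a * b)%:P + c *: 'X); last by rewrite !hornerE.
move=> i; rewrite coefD coefC coefZ coefX; apply: kD; first by case: eqP => // _; apply: kM.
by apply: kM => //; case: eqP.
Qed.

Lemma poly_value_mmap (A : comNzRingType) (phi : {rmorphism A -> L}) N (x : 'I_N -> L) P :
  (forall c, k (phi c)) -> (forall i, poly_value (x i)) -> poly_value (mmap phi x P).
Proof.
move=> kphi vx; elim/mpoly_ring_ind: P => [c|i|P Q [p kp ep] [q kq eq]|P Q [p kp ep] [q kq eq]].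
- by exists (phi c)%:P; rewrite ?hornerC ?mmapC //; apply: poly_overC.
- by rewrite mmapX mmap1U.
- exists (p + q); last by rewrite mmapD ep eq hornerD.
  by move=> i; rewrite coefD; apply: kD.
- by exists (p * q); [apply: poly_overM|rewrite (rmorphM (mmap phi x)) hornerM -ep -eq].
Qed.

Lemma poly_over_scale p c : poly_over k p -> k c -> poly_over k (p \Po (c *: 'X)).
Proof.
move=> kp kc i; rewrite comp_polyE coef_sum; apply: ksum => j _.
by rewrite coefZ exprZn coefZ coefXn; apply: kM => //; apply: kM; [apply: kX|case: eqP].
Qed.

Lemma horner_scale (p : {poly L}) c x : (p \Po (c *: 'X)).[x] = p.[c * x].
Proof. by rewrite horner_comp hornerZ hornerX. Qed.

Lemma tau_horner p x : poly_over k p -> tau p.[x] = p.[tau x].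
Proof.
move=> kp; rewrite -horner_map; congr (_.[_]); apply/polyP => i.
by rewrite coef_map; apply: tau_fix; apply: kp.
Qed.

Lemma iter_tau_horner j p : poly_over k p -> iter j tau p.[y] = p.[zeta ^+ j * y].
Proof.
move=> kp; elim: j => [|j ih]; first by rewrite expr0 mul1r.
by rewrite /= ih tau_horner // rmorphM rmorphXn tau_fix // tauy exprSr mulrA.
Qed.

(* Averaging over the powers of [tau] kills the coefficients of y^i for i
   not divisible by m. *)
Lemma fixed_value p : poly_over k p -> tau p.[y] = p.[y] -> k p.[y].
Proof.
move=> kp fp; have itf j : iter j tau p.[y] = p.[y] by elim: j => //= j ->.
have e : m%:R * p.[y] = \sum_(i < size p) p`_i * y ^+ i * \sum_(j < m) (zeta ^+ i) ^+ j.
  rewrite mulr_natl -[m in LHS]card_ord -sumr_const.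
  under eq_bigr => j _ do rewrite -(itf j) iter_tau_horner // horner_coef.
  rewrite exchange_big; apply: eq_bigr => i _; rewrite mulr_sumr; apply: eq_bigr => j _.
  by rewrite exprMn -!exprM [(j * i)%N]mulnC; ring.
rewrite -[p.[y]]mul1r -(mulVf mL) -mulrA; apply: kM.
  by apply: kV; elim: (m) => // i ih; rewrite -addn1 natrD; apply: kD.
rewrite e; apply: ksum => i _.
have [/dvdnP [a ->]|ni] := boolP (m %| i)%N.
  rewrite [(a * m)%N]mulnC exprM; apply: kM; first by apply: kM => //; apply: kX.
  by apply: ksum => j _; do 2 apply: kX.
rewrite (_ : \sum_(j < m) _ = 0) ?mulr0 //.
apply/eqP; have := subrX1 (zeta ^+ i) m; rewrite -exprM mulnC exprM (prim_expr_order prim).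
rewrite expr1n subrr => /esym/eqP; rewrite mulf_eq0 subr_eq0.
by rewrite -(prim_order_dvd prim) (negbTE ni).
Qed.

(** Denominators are removed by a norm: [q.[y]] times its other conjugates is fixed by [tau], hence
    lies in [k], while the cofactor [r] is again a polynomial over [k]. *)
Lemma generated_poly x : exists2 p, poly_over k p & x = p.[y].
Proof.
have [_ [_ [[p kp ->] [q kq ->] q0 ->]]] := gen x.
pose r := \prod_(1 <= j < m) (q \Po (zeta ^+ j *: 'X)).
have m0 : (0 < m)%N := prim_order_gt0 prim.
have kr : poly_over k r.
  rewrite /r; elim/big_ind: _ => [||j _]; [exact: poly_overC|exact: poly_overM|].
  by apply: poly_over_scale => //; apply: kX.
have rqE : (r * q).[y] = \prod_(0 <= j < m) q.[zeta ^+ j * y].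
  rewrite hornerM mulrC [in RHS]big_ltn // expr0 mul1r; congr (_ * _).
  by rewrite horner_prod; apply: eq_bigr => j _; rewrite horner_scale.
have kc : k (r * q).[y].
  apply: fixed_value; first exact: poly_overM.
  (* [tau] shifts the factors cyclically, because [zeta ^+ m = 1]. *)
  rewrite rqE rmorph_prod /=.
  under eq_bigr => j _ do rewrite tau_horner // rmorphM rmorphXn tau_fix // tauy mulrA -exprSr.
  rewrite -[in RHS](prednK m0) -[in LHS](prednK m0) big_nat_recr //= big_nat_recl //= prednK //.
  by rewrite prim_expr_order // expr0 mulrC.
have c0 : (r * q).[y] != 0.
  rewrite rqE prodf_seq_neq0; apply/allP => j _; rewrite /= -iter_tau_horner //.
  by elim: j => //= j; rewrite fmorph_eq0.
exists (((r * q).[y])^-1%:P * p * r).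
  by apply: poly_overM => //; apply: poly_overM => //; apply/poly_overC/kV.
have r0 : r.[y] != 0 by apply: contraNneq c0; rewrite hornerM => ->; rewrite mul0r.
by rewrite !hornerM hornerC; field; rewrite q0 r0.
Qed.

Lemma tau_fixed x : tau x = x -> k x.
Proof. by have [p kp ->] := generated_poly x; apply: fixed_value. Qed.

Lemma iter_tau_order x : iter m tau x = x.
Proof.
by have [p kp ->] := generated_poly x; rewrite iter_tau_horner // prim_expr_order // mul1r.
Qed.

(** The orbit of [x] may have fewer than [m] elements; dropping repetitions makes [conj_poly]
    separable and minimal. *)
Definition conjugates x := undup [seq iter j tau x | j <- iota 0 m].
Definition conj_poly x := \prod_(a <- conjugates x) ('X - a%:P).

Lemma conjugates_self x : x \in conjugates x.
Proof.
rewrite mem_undup; apply/mapP; exists 0%N => //.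
by rewrite mem_iota (prim_order_gt0 prim).
Qed.

Lemma conj_poly_over x : poly_over k (conj_poly x).
Proof.
suff e : map_poly tau (conj_poly x) = conj_poly x.
  by move=> i; apply: tau_fixed; rewrite -coef_map e.
rewrite /conj_poly rmorph_prod /=.
under eq_bigr => a _ do rewrite rmorphB /= map_polyX map_polyC /=.
rewrite -(big_map tau predT (fun a => 'X - a%:P)); apply: perm_big.
have u : uniq [seq tau a | a <- conjugates x] by rewrite map_inj_uniq ?undup_uniq //; apply: fmorph_inj.
have sub : {subset [seq tau a | a <- conjugates x] <= conjugates x}.
  move=> _ /mapP [a + ->]; rewrite !mem_undup => /mapP [j jm ->]; apply/mapP.
  have [jm'|jm'] := eqVneq j.+1 m.
    exists 0%N; first by rewrite mem_iota (prim_order_gt0 prim).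
    by rewrite -iterS jm' iter_tau_order.
  exists j.+1 => //; move: jm; rewrite !mem_iota /= !add0n => jm.
  by rewrite ltn_neqAle jm'.
have [] := uniq_min_size u sub; first by rewrite size_map.
by move=> _ e; apply: uniq_perm => //; apply: undup_uniq.
Qed.

Lemma conj_poly_dvd x r : poly_over k r -> root r x -> conj_poly x %| r.
Proof.
move=> kr rx; apply: uniq_roots_dvdp; last by rewrite uniq_rootsE undup_uniq.
apply/allP => a; rewrite mem_undup => /mapP [j _ ->]; elim: j => //= j /eqP ih.
by rewrite /root -tau_horner // ih rmorph0.
Qed.

Lemma conj_poly_min x q : min_poly_over k x q -> q = conj_poly x.
Proof.
move=> [qm kq qx qmin]; have dv := conj_poly_dvd kq qx.
have Pm : conj_poly x \is monic by apply: monic_prod_XsubC.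
have s := qmin _ (conj_poly_over x) (monic_neq0 Pm) _.
apply/esym/eqP; rewrite -eqp_monic // -dvdp_size_eqp // eqn_leq.
rewrite (dvdp_leq (monic_neq0 qm) dv) s // root_prod_XsubC; exact: conjugates_self.
Qed.

Lemma conj_poly_is_min x : min_poly_over k x (conj_poly x).
Proof.
split; [exact: monic_prod_XsubC|exact: conj_poly_over| |].
  by rewrite root_prod_XsubC conjugates_self.
by move=> r kr r0 rx; apply: dvdp_leq => //; apply: conj_poly_dvd.
Qed.

Lemma kummer_galois : galois_ext k.
Proof.
split=> [x|x q /conj_poly_min ->|x q /conj_poly_min ->].
- by exists (conj_poly x); apply: conj_poly_is_min.
- by exists (conjugates x).
- by rewrite separable_prod_XsubC undup_uniq.
Qed.

(** An element [s] of the group is determined by [s y]. As [y ^+ m] is in [k], the ratio [s y / y]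
    is an [m]-th root of unity, hence a power of [zeta]. *)
Lemma kummer_generates : generates_galois_group k tau.
Proof.
have m0 : (0 < m)%N := prim_order_gt0 prim.
split; [split=> //|].
  exists (iter m.-1 tau) => x; first by rewrite -iterSr prednK // iter_tau_order.
  by rewrite -iterS prednK // iter_tau_order.
move=> s [_ sfix]; have : (s y / y) ^+ m = 1.
  by rewrite expr_div_n -rmorphXn sfix // mulfV // expf_neq0.
move=> /(prim_rootP prim) [i e]; exists i; left=> x.
have [p kp ->] := generated_poly x; rewrite iter_tau_horner // -e divfK //.
rewrite -horner_map; congr (_.[_]); apply/polyP => j.
by rewrite coef_map; apply: sfix; apply: kp.
Qed.

End Kummer.

Section FunfieldMorphisms.
Variables (K : numClosedFieldType) (N : nat) (Y : projvar K N).
Implicit Types (P Q : {mpoly K[N.+1]}) (f : funfield Y).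

Lemma notin_vanishingC c : c != 0 -> c%:MP \notin vanishing Y.
Proof.
move=> c0; apply/negP => /vanishingP h; have [_ [[q Yq] _]] := projvarP Y.
have := h (pcoord q) (pcoord_neq0 q); rewrite pof_pcoord vevalC => /(_ Yq) /eqP.
by rewrite (negbTE c0).
Qed.

Lemma ratfun_eqZ f P Q c : c != 0 -> ratfun_eq f P Q -> ratfun_eq f (c *: P) (c *: Q).
Proof.
move=> c0 [k [hP hQ nQ e]]; have nC := notin_vanishingC c0.
exists k; split; [exact: rpredZ|exact: rpredZ| |].
  by rewrite -mul_mpolyC; apply: notin_vanishingM.
rewrite -!mul_mpolyC !coord_classM e; apply/div_crossP; rewrite ?coord_class_eq0 //.
  by rewrite mulf_neq0 ?coord_class_eq0.
by rewrite mulrCA mulrA.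
Qed.

Lemma constfun_degree0 c : coord_class Y c%:MP \in @degree0 K N Y.
Proof.
apply/asboolP; exists c%:MP, 1, 0%N; split; rewrite ?homogC ?dhomog1 ?notin_vanishing1 //.
by rewrite coord_class1 divr1.
Qed.

Definition constfun c : funfield Y := Subfield (constfun_degree0 c).

Lemma constfunP c : ratfun_const (constfun c) c.
Proof.
exists 0%N; split; rewrite ?homogC ?dhomog1 ?notin_vanishing1 //.
by rewrite coord_class1 divr1.
Qed.

Lemma constfun_zmod : zmod_morphism constfun.
Proof.
move=> a b; apply: funfield_val_inj; rewrite subfield_valB /=.
by rewrite mpolyCB coord_classB.
Qed.
HB.instance Definition _ := GRing.isZmodMorphism.Build _ _ constfun constfun_zmod.

Lemma constfun_monoid : monoid_morphism constfun.
Proof.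
split=> [|a b]; apply: funfield_val_inj; first by rewrite subfield_val1 /= mpolyC1 coord_class1.
by rewrite subfield_valM /= mpolyCM coord_classM.
Qed.
HB.instance Definition _ := GRing.isMonoidMorphism.Build _ _ constfun constfun_monoid.

Section LinearPullback.
Variable A : 'M[K]_N.+1.
Hypothesis hA : forall P, (lsub A P \in vanishing Y) = (P \in vanishing Y).

Let psi : {rmorphism {mpoly K[N.+1]} -> {fraction coordring Y}} := @coord_class K N Y \o lsub A.

Let psi0 k P : P \is k.-homog -> (psi P == 0) = (P \in vanishing Y).
Proof. by move=> _; rewrite /psi /= coord_class_eq0 hA. Qed.

Let pull_form f P Q : ratfun_eq f P Q -> form_quotient (ffmap psi f) (lsub A P) (lsub A Q).
Proof.
move=> fPQ; have [k [hP hQ nQ e]] := fPQ; exists k; split; rewrite ?lsub_homog ?hA //.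
by rewrite (ffmapE psi0 fPQ).
Qed.

Lemma linear_pullback_degree0 f : ffmap psi f \in @degree0 K N Y.
Proof.
have [P [Q fPQ]] := exists_ratfun f; apply/asboolP.
by exists (lsub A P), (lsub A Q); apply: pull_form.
Qed.

Definition linear_pullback f : funfield Y := Subfield (linear_pullback_degree0 f).

Lemma linear_pullbackE f P Q : ratfun_eq f P Q -> ratfun_eq (linear_pullback f) (lsub A P) (lsub A Q).
Proof. exact: pull_form. Qed.

Lemma linear_pullback_zmod : zmod_morphism linear_pullback.
Proof.
move=> f f'; apply: funfield_val_inj; rewrite subfield_valB /=.
exact: (ffmap_zmod psi0).
Qed.
HB.instance Definition _ := GRing.isZmodMorphism.Build _ _ linear_pullback linear_pullback_zmod.

Lemma linear_pullback_monoid : monoid_morphism linear_pullback.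
Proof.
have [m1 mM] := ffmap_monoid psi0.
split=> [|f f']; apply: funfield_val_inj; first by rewrite subfield_val1.
by rewrite subfield_valM; apply: mM.
Qed.
HB.instance Definition _ := GRing.isMonoidMorphism.Build _ _ linear_pullback linear_pullback_monoid.

End LinearPullback.

Section Generators.
Variables (M : {mpoly K[N.+1]}) (x : 'I_N.+1 -> funfield Y).
Hypothesis hM : M \is 1.-homog.
Hypothesis nM : M \notin vanishing Y.
Hypothesis xE : forall j, ratfun_eq (x j) 'X_j M.

(** Evaluation at the functions ['X_j / M]. It exhibits them as generators of the function field
    over the constants. *)
Definition dehomog : {rmorphism {mpoly K[N.+1]} -> funfield Y} := mmap constfun x.

Lemma dehomogE e P : P \is e.-homog -> ratfun_eq (dehomog P) P (M ^+ e).
Proof.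
have cM0 : coord_class Y M != 0 by rewrite coord_class_eq0.
have hMe i : M ^+ i \is i.-homog.
  by elim: i => [|i ih]; rewrite ?expr0 ?dhomog1 // exprS; apply: (@dhomogM _ _ _ 1).
have nMe i : M ^+ i \notin vanishing Y.
  by elim: i => [|i ih]; rewrite ?expr0 ?notin_vanishing1 // exprS notin_vanishingM.
have mono (m : 'X_{1..N.+1}) : ratfun_eq (\prod_i x i ^+ m i) 'X_[m] (M ^+ mdeg m).
  rewrite mpolyXE_id mdegE; elim/big_ind3: _ => [|i1 g1 i2 g2 i3 g3 h1 h2|i _].
  - by rewrite expr0; apply: ratfun_eq1.
  - by rewrite exprD; apply: ratfun_eqM.
  - elim: (m i) => [|j ih]; first by rewrite !expr0; apply: ratfun_eq1.
    by rewrite !exprS; apply: ratfun_eqM.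
move=> hP; exists e; split=> //.
have vsum (I : eqType) (r : seq I) (f : I -> funfield Y) :
    subfield_val (\sum_(i <- r) f i) = \sum_(i <- r) subfield_val (f i).
  elim: r => [|i r ih]; first by rewrite !big_nil subfield_val0.
  by rewrite !big_cons subfield_valD ih.
have csum (I : Type) (r : seq I) (f : I -> {mpoly K[N.+1]}) :
    coord_class Y (\sum_(i <- r) f i) = \sum_(i <- r) coord_class Y (f i).
  exact: (rmorph_sum (@coord_class K N Y)).
rewrite [P in RHS]mpolyE /dehomog /= /mmap vsum csum mulr_suml.
apply: eq_big_seq => m mP; have <- : mdeg m = e := dhomogP _ _ _ hP _ mP.
have [k [_ _ _ E]] := mono m.
have -> : coord_class Y (P@_m *: 'X_[m]) = coord_class Y (P@_m)%:MP * coord_class Y 'X_[m].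
  by rewrite -coord_classM mul_mpolyC.
by rewrite subfield_valM [X in _ * X]E mulrA.
Qed.

End Generators.

End FunfieldMorphisms.

(** * From a homology to a Galois point *)

Section HomologyImpliesGalois.
Variables (K : numClosedFieldType) (n d : nat) (X : projvar K n.+3).
Variable F : {mpoly K[n.+4]}.
Hypothesis XF : hyp_form d X F.
Hypothesis d4 : (4 <= d)%N.
Variables (g : pspace K n.+3 -> pspace K n.+3) (A : 'M[K]_n.+4).
Hypothesis Aunit : A \in unitmx.
Hypothesis gE : forall v : 'rV[K]_n.+4, v != 0 -> pvset X (pof v) -> g (pof v) = pof (v *m A).
Hypothesis gX : forall v : 'rV[K]_n.+4, v != 0 -> pvset X (pof v) -> pvset X (pof (v *m A)).

Lemma vanishing_invariant P : (lsub A P \in vanishing X) = (P \in vanishing X).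
Proof.
have [_ _ _ _ XV] := XF; have [c c0 FA] := invariant_form XF Aunit gX.
have eF : lsub A F = c *: F by apply: veval_ext => v; rewrite veval_lsub FA vevalZ.
have eF' : lsub (invmx A) F = c^-1 *: F.
  apply: veval_ext => v; rewrite veval_lsub vevalZ -[v in RHS](mulmxKV Aunit) FA mulrA mulVf //.
  by rewrite mul1r.
apply/idP/idP => /XV [u e]; apply/XV.
  exists (c^-1 *: lsub (invmx A) u); rewrite -[P]lsub1 -(mulVmx Aunit) -lsub_comp e rmorphM eF'.
  by rewrite -scalerAl scalerAr.
by exists (c *: lsub A u); rewrite e rmorphM eF -scalerAl scalerAr.
Qed.

Variables (lam : K) (l : 'cV[K]_n.+4) (p : 'rV[K]_n.+4).
Hypothesis hom : homology A lam l p.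
Hypothesis gord : automorphism_order X g d.-1.

Let s := (p *m l) 0 0.
Let s0 : s != 0 := homology_axis XF d4 Aunit gE gX hom gord.
Let lam0 : lam != 0 := homology_lam_neq0 Aunit hom.
Let zeta := (lam + s) / lam.
Let prim : d.-1.-primitive_root zeta := homology_primitive XF d4 Aunit gE gX hom gord.
Let Pi := s%:M - l *m p.
Let p0 : p != 0. Proof. by case: hom. Qed.

Let PiE (v : 'rV[K]_n.+4) : v *m Pi = s *: v - (v *m l) 0 0 *: p.
Proof. exact: projection_mul. Qed.

Let APi : A *m Pi = lam *: Pi.
Proof.
have [-> _ _] := hom; rewrite mulmxDl mul_scalar_mx -mulmxA [p *m Pi]PiE subrr mulmx0.
by rewrite addr0.
Qed.

Lemma center_on_hypersurface : pvset X (pof p).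
Proof.
have [_ _ _ XE _] := XF; apply/(XE _ p0).
have [eA l0 _] := hom; have /cV0Pn [k lk] := l0.
have [c _ FA] := invariant_form XF Aunit gX; rewrite eA in FA.
exact: (homology_center XF d4 lam0 s0 lk prim FA).
Qed.

(** The normal form freed from the parametrisation: [t] is the value of [l] divided by [s], and [y]
    depends linearly on [v *m Pi]. The other terms thus become pullbacks by [Pi], whose quotients
    make up K_p. *)
Lemma normal_form_proj : exists Lt Gt : {mpoly K[n.+4]},
  [/\ Lt \is 1.-homog, Gt \is d.-homog, lsub Pi Lt != 0 &
      F = s ^- d.-1 *: (linform l ^+ d.-1 * lsub Pi Lt) + lsub Pi Gt].
Proof.
have [eA l0 _] := hom; have /cV0Pn [k lk] := l0.
have [c _ FA] := invariant_form XF Aunit gX; rewrite eA in FA.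
have [L [hL L0 expand]] := homology_normal_form XF d4 lam0 s0 lk prim FA.
have [hF _ _ _ _] := XF.
(* [Pi] sends the point with parameters [y], [t] to [s] times the point [y] of the axis, whose
   coordinate [lift k i] is [l k 0] times that of [y]; hence the denominator. *)
pose C : 'M[K]_(n.+4, n.+3) := \matrix_(a, i) ((a == lift k i)%:R / (s * l k 0)).
have CE (y : 'rV[K]_n.+3) t : (y *m kerbasis l k + t *: p) *m Pi *m C = y.
  have -> : (y *m kerbasis l k + t *: p) *m Pi = s *: (y *m kerbasis l k).
    rewrite PiE mulmxDl -mulmxA kerbasis_mul mulmx0 add0r -scalemxAl mxE -/s scalerDr.
    by rewrite scalerA mulrC addrK.
  apply/rowP => i; rewrite -scalemxAl mxE mxE (bigD1 (lift k i)) //= big1 => [|a ai].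
    rewrite kerbasisE mxE eqxx addr0 div1r; field.
    by rewrite lk s0.
  by rewrite [X in _ * X]mxE (negbTE ai) mul0r mulr0.
have decomp v : exists y t, v = y *m kerbasis l k + t *: p.
  have : (v <= kerbasis l k + p)%MS by apply: submx_trans (kerbasis_full lk s0); apply: submx1.
  case/sub_addsmxP => -[y w] /= ->; exists y, (w 0 0); congr (_ + _).
  by rewrite {1}[w]mx11_scalar mul_scalar_mx.
have tE (y : 'rV[K]_n.+3) t : ((y *m kerbasis l k + t *: p) *m l) 0 0 = t * s.
  by rewrite mulmxDl -mulmxA kerbasis_mul mulmx0 add0r -scalemxAl mxE.
exists (lsub C L), (lsub C (axis_section F l k)); split.
- exact: lsub_homog.
- by apply: lsub_homog; apply: lsub_homog.
- have [y nz] := veval_neq0 L0; apply: contraNneq nz => /(congr1 (fun P => veval P (y *m kerbasis l k + 0 *: p))).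
  by rewrite !veval_lsub CE veval0 => ->.
- apply: veval_ext => v; have [y [t ->]] := decomp v.
  rewrite expand vevalD vevalZ vevalM vevalXn veval_linform tE !veval_lsub !CE.
  congr (_ + _); rewrite exprMn mulrA mulrCA mulVf ?mulr1 //.
  by rewrite expf_neq0.
Qed.

Let k := projection_subfield (X := X) (pof p).

(** Independence of the hyperplane: projecting first by [Pi] does not affect a second projection
    from the same center, as [Pi *m Pi' = s *: Pi'], and powers of scalars cancel in quotients of
    forms of equal degree. *)
Lemma projection_subfieldP f : k f <-> exists e P Q,
  [/\ P \is e.-homog, Q \is e.-homog & ratfun_eq f (lsub Pi P) (lsub Pi Q)].
Proof.
have [a a0 ea] := pcoord_pof p0.
have pE l' P e : P \is e.-homog ->
    pull_projection (pof p) l' P = a ^+ e *: lsub (((p *m l') 0 0)%:M - l' *m p) P.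
  move=> hP; apply: veval_ext => v; rewrite vevalZ veval_lsub -(homog_scale _ _ hP).
  rewrite /veval /pull_projection comp_mpoly_meval; apply: meval_eq => j.
  rewrite tnth_mktuple -/(veval _ _) projection_formE ea !mulmxBr.
  have -> : (a *: p *m l') 0 0 = a * (p *m l') 0 0 by rewrite -scalemxAl mxE.
  rewrite -!scalemxAr scalerBr.
  by rewrite !mul_mx_scalar scalerA.
split=> [[l' [e [P [Q [s'0 hP hQ fE]]]]]|[e [P [Q [hP hQ fE]]]]].
  rewrite (pE _ _ _ hP) (pE _ _ _ hQ) in fE.
  pose Pi' := ((p *m l') 0 0)%:M - l' *m p.
  have PP : Pi *m Pi' = s *: Pi'.
    rewrite /Pi mulmxBl mul_scalar_mx -mulmxA [p *m Pi']projection_mul subrr mulmx0.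
    by rewrite subr0.
  exists e, (lsub Pi' P), (lsub Pi' Q); split; rewrite ?lsub_homog //.
  rewrite !lsub_comp PP.
  have sE R : R \is e.-homog -> lsub (s *: Pi') R = (s ^+ e / a ^+ e) *: (a ^+ e *: lsub Pi' R).
    move=> hR; apply: veval_ext => v; rewrite !vevalZ !veval_lsub -scalemxAr (homog_scale _ _ hR).
    by rewrite mulrA divfK // expf_neq0.
  rewrite (sE _ hP) (sE _ hQ); apply: ratfun_eqZ => //.
  by rewrite mulf_neq0 ?invr_eq0 ?expf_neq0.
exists l, e, P, Q; split=> //; first by rewrite ea -scalemxAl mxE mulf_neq0.
by rewrite !(pE _ _ e) //; apply: ratfun_eqZ => //; rewrite expf_neq0.
Qed.

Let tau : {rmorphism funfield X -> funfield X} := linear_pullback vanishing_invariant.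

Lemma pullback_induced : induced_by g tau.
Proof.
move=> f; apply: pof_ind => v v0 c Xv [P [Q [fPQ Q0 ->]]].
have := linear_pullbackE vanishing_invariant fPQ => tf.
have [e [hP hQ _ _]] := fPQ.
rewrite gE // in Q0 *; have vA0 : v *m A != 0 by apply: row_free_neq0 v0; rewrite row_free_unit.
have [a a0 ea] := pcoord_pof v0; have [b b0 eb] := pcoord_pof vA0.
move: Q0; rewrite /heval eb (homog_scale _ _ hQ) mulf_eq0 negb_or => /andP[_ Q0].
exists (lsub A P), (lsub A Q); split=> //; rewrite /heval ea !veval_lsub -!scalemxAl.
  by rewrite (homog_eq0Z _ hQ a0).
rewrite !(homog_scale _ _ hP) !(homog_scale _ _ hQ).
by field; rewrite Q0 !expf_neq0.
Qed.

(** The Kummer generator is [eta = l / M]. The matrix [A] multiplies [l] by [lam + s] and the pulled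
    back form [M] by [lam], so [tau] multiplies [eta] by the primitive root [zeta]. *)
Lemma homology_galois : inner_galois_point X (pof p) /\ belongs_to_galois_point X (pof p) g.
Proof.
have [hF _ Fp XE XV] := XF.
have [Lt [Gt [hLt hGt Lt0 FE]]] := normal_form_proj.
pose M := lsub Pi Lt; have hM : M \is 1.-homog by apply: lsub_homog.
have low P : P \is 1.-homog -> P != 0 -> P \notin vanishing X.
  move=> hP P0; apply/negP => /XV /(dvdr_homog_deg hF hP P0).
  by rewrite leqNgt (leq_trans _ d4).
have nM : M \notin vanishing X := low _ hM Lt0.
have [eA l0 _] := hom; have /cV0Pn [j0 lj0] := l0.
have nl : linform l \notin vanishing X.
  apply: low; first exact: linform_homog.
  apply: contraNneq lj0 => /(congr1 (fun P => veval P (delta_mx 0 j0))).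
  by rewrite veval_linform -rowE mxE veval0 => ->.
have [eta etaE] := make_ratfun (linform_homog l) hM nM.
have hMe i : M ^+ i \is i.-homog.
  by elim: i => [|i ih]; rewrite ?expr0 ?dhomog1 // exprS; apply: (@dhomogM _ _ _ 1).
have pow (f : funfield X) P Q i : ratfun_eq f P Q -> ratfun_eq (f ^+ i) (P ^+ i) (Q ^+ i).
  by move=> h; elim: i => [|i ih]; rewrite ?expr0; [exact: ratfun_eq1|rewrite !exprS; apply: ratfun_eqM].
have k1 : k 1.
  by apply/projection_subfieldP; exists 0%N, 1, 1; rewrite !rmorph1; split; rewrite ?dhomog1 //; apply: ratfun_eq1.
have kB a b : k a -> k b -> k (a - b).
  move=> /projection_subfieldP [e [P [Q [hP hQ aE]]]] /projection_subfieldP [e' [P' [Q' [hP' hQ' bE]]]].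
  apply/projection_subfieldP; exists (e + e')%N, (P * Q' - P' * Q), (Q * Q'); split.
  - by apply: rpredB; [exact: dhomogM|rewrite addnC; exact: dhomogM].
  - exact: dhomogM.
  - rewrite rmorphB !rmorphM; have := ratfun_eqD aE (ratfun_eqN bE).
    by rewrite mulNr.
have k0 : k 0 by rewrite -(subrr 1); apply: kB.
have kdiv a b : k a -> k b -> k (a / b).
  have [->|b0] := eqVneq b 0; first by move=> _ _; rewrite invr0 mulr0.
  move=> /projection_subfieldP [e [P [Q [hP hQ aE]]]] /projection_subfieldP [e' [P' [Q' [hP' hQ' bE]]]].
  apply/projection_subfieldP; exists (e + e')%N, (P * Q'), (Q * P'); split; try exact: dhomogM.
  by rewrite !rmorphM; apply: ratfun_eqM aE (ratfun_eqV bE b0).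
have kC c : k (constfun X c).
  apply/projection_subfieldP; exists 0%N, c%:MP, 1; split; rewrite ?homogC ?dhomog1 //.
  have -> : lsub Pi c%:MP = c%:MP by apply: veval_ext => v; rewrite veval_lsub !vevalC.
  by rewrite rmorph1; apply: constfunP.
have tau_fix a : k a -> tau a = a.
  move=> /projection_subfieldP [e [P [Q [hP hQ aE]]]].
  have tE := linear_pullbackE vanishing_invariant aE.
  have sE R : R \is e.-homog -> lsub A (lsub Pi R) = lam ^+ e *: lsub Pi R.
    move=> hR; rewrite lsub_comp APi; apply: veval_ext => v.
    by rewrite vevalZ !veval_lsub -scalemxAr (homog_scale _ _ hR).
  rewrite (sE _ hP) (sE _ hQ) in tE; have aE' := ratfun_eqZ (expf_neq0 e lam0) aE.
  by apply: (ratfun_eq_inj tE aE'); rewrite subrr rpred0.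
have mL : d.-1%:R != 0 :> funfield X.
  rewrite -(rmorph_nat (constfun X)) fmorph_eq0 pnatr_eq0.
  by move: d4; case: d => [|[]].
have primL : d.-1.-primitive_root (constfun X zeta) by rewrite fmorph_primitive_root.
have eta0 : eta != 0.
  apply/eqP => z; case/negP: nl; have zE : ratfun_eq (0 : funfield X) 0 1.
    have := constfunP X 0; rewrite /ratfun_const mpolyC0 (rmorph0 (constfun X)) => h; exact: h.
  rewrite z in etaE; have := ratfun_eq_cross etaE zE.
  by rewrite mul0r subr0 mulr1.
have taueta : tau eta = constfun X zeta * eta.
  have tE := linear_pullbackE vanishing_invariant etaE.
  have zE := ratfun_eqM (constfunP X zeta) etaE; apply: (ratfun_eq_inj tE zE).
  suff -> : lsub A (linform l) * (1 * M) - zeta%:MP * linform l * lsub A M = 0 by rewrite rpred0.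
  apply: veval_ext => v; rewrite vevalB !vevalM veval0 veval1 vevalC veval_lsub !veval_linform.
  rewrite /M lsub_comp APi !veval_lsub -scalemxAr (homog_scale _ _ hLt) eA rank_one_mul mulmxDl -!scalemxAl.
  by rewrite [X in X * _ - _]mxE [X in (X + _) * _]mxE [X in (_ + X) * _]mxE -/s /zeta; field.
have kym : k (eta ^+ d.-1).
  (* On X the normal form equates [l ^+ d.-1 * M] with the pullback of [- s ^+ d.-1 *: Gt]; division
     by [M ^+ d] gives the power of [eta] as a quotient of pullbacks. *)
  apply/projection_subfieldP; exists d, (- s ^+ d.-1 *: Gt), (Lt ^+ d); split.
  - exact: rpredZ.
  - by rewrite -[d in d.-homog]mul1n; apply: dhomogMn.
  have ep := pow _ _ _ d.-1 etaE; have [e [h1 h2 h3 h4]] := ep.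
  have nMd : M ^+ d \notin vanishing X.
    elim: (d) => [|i ih]; rewrite ?expr0 ?notin_vanishing1 // exprS.
    exact: notin_vanishingM.
  have hN : lsub Pi (- s ^+ d.-1 *: Gt) \is d.-homog by apply: lsub_homog; apply: rpredZ.
  have [f fE] := make_ratfun hN (hMe d) nMd.
  have <- : f = eta ^+ d.-1.
    apply: (ratfun_eq_inj fE ep).
    have -> : lsub Pi (- s ^+ d.-1 *: Gt) * M ^+ d.-1 - linform l ^+ d.-1 * M ^+ d =
              (- (M ^+ d.-1 * (s ^+ d.-1)%:MP)) * F.
      have eM : M ^+ d = M * M ^+ d.-1 by rewrite -exprS prednK //; apply: leq_trans d4.
      rewrite eM FE -/M; move: (M ^+ d.-1) (linform l ^+ d.-1) => x q; apply: veval_ext => v.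
      rewrite !(vevalB, vevalM, vevalD, vevalZ, veval_lsub, vevalN, vevalC).
      by field; rewrite expf_neq0.
    by apply/XV; exists (- (M ^+ d.-1 * (s ^+ d.-1)%:MP)).
  by rewrite rmorphXn.
have hpi j : lsub Pi 'X_j \is 1.-homog by apply: lsub_homog; apply: homogX.
have [u uE] := choice (fun j => make_ratfun (hpi j) hM nM).
(* Since [s *: v] is [v *m Pi] plus a multiple of [p] by the value of [l], each function ['X_j / M]
   is affine in [eta] with coefficients in K_p. *)
pose x j := constfun X s^-1 * u j + constfun X (p 0 j / s) * eta.
have xE j : ratfun_eq (x j) 'X_j M.
  have [f fE] := make_ratfun (homogX K j) hM nM.
  have := ratfun_eqD (ratfun_eqM (constfunP X s^-1) (uE j)) (ratfun_eqM (constfunP X (p 0 j / s)) etaE).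
  rewrite -/(x j) => xjE; suff <- : f = x j by [].
  apply: (ratfun_eq_inj fE xjE); rewrite (_ : _ - _ = 0) ?rpred0 //.
  apply: veval_ext => v; rewrite !(vevalB, vevalM, vevalD, veval1, veval0, vevalC, vevalX, veval_linform).
  have -> : veval (lsub Pi 'X_j) v = s * v 0 j - (v *m l) 0 0 * p 0 j.
    by rewrite veval_lsub vevalX PiE !mxE.
  move: (veval M v) ((v *m l) 0 0) (v 0 j) (p 0 j) s s0 => a b c e t t0.
  by field.
pose E := dehomog x.
have EP R : poly_value k eta (E R).
  apply: (poly_value_mmap k1 kB kdiv R kC) => j.
  have kuj : k (u j) by apply/projection_subfieldP; exists 1%N, 'X_j, Lt; rewrite homogX.
  exact: (poly_value_affine eta k1 kB kdiv (kC s^-1) kuj (kC (p 0 j / s))).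
have gen f : exists a b, [/\ poly_value k eta a, poly_value k eta b, b != 0 & f = a / b].
  have [P [Q fPQ]] := exists_ratfun f; have [e [hP hQ nQ _]] := fPQ.
  have EQ := dehomogE hM nM xE hQ; have EP' := dehomogE hM nM xE hP.
  have EQ0 : E Q != 0.
    apply/eqP => z; case/negP: nQ; have zE : ratfun_eq (0 : funfield X) 0 1.
      have := constfunP X 0; rewrite /ratfun_const mpolyC0 (rmorph0 (constfun X)) => h; exact: h.
    rewrite -/E z in EQ; have := ratfun_eq_cross EQ zE.
    by rewrite mul0r subr0 mulr1.
  exists (E P), (E Q); split=> //; apply: (ratfun_eq_inj fPQ (ratfun_eqM EP' (ratfun_eqV EQ EQ0))).
  by rewrite (_ : _ - _ = 0) ?rpred0 //; ring.
have gp : galois_ext k := kummer_galois k1 kB kdiv tau_fix mL (kC zeta) primL taueta kym gen.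
split; first by split=> //; apply: center_on_hypersurface.
split=> //; exists tau; first exact: pullback_induced.
exact: (kummer_generates k1 kB kdiv tau_fix mL (kC zeta) primL eta0 taueta kym gen).
Qed.

End HomologyImpliesGalois.

(** * Dimension of the fixed locus *)

Section EliminationAlong.
Variables (K : numClosedFieldType) (m : nat).
Variables (H : 'M[K]_(m.+1, m.+2)) (p : 'rV[K]_m.+2).
Hypothesis full : (1%:M <= H + p)%MS.

Lemma stack_unit : stack H p \in unitmx.
Proof.
rewrite -row_full_unit -sub1mx; apply: submx_trans full _; rewrite addsmx_sub.
apply/andP; split.
  apply/row_subP => i.
  have -> : row i H = row (widen_ord (leqnSn _) i) (stack H p).
    apply/rowP => j; rewrite !mxE /= insubT //= => lt.
    by congr (H _ j); apply: val_inj.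
  exact: row_sub.
have {1}-> : p = row ord_max (stack H p).
  by apply/rowP => j; rewrite !mxE /= insubF ?ltnn.
exact: row_sub.
Qed.

Lemma stack_coords : exists (C : 'M[K]_(m.+2, m.+1)) (T : 'cV[K]_m.+2),
  (forall v, v = (v *m C) *m H + (v *m T) 0 0 *: p) /\ forall y t, (y *m H + t *: p) *m C = y.
Proof.
pose S := invmx (stack H p); pose C := \matrix_(a, i) S a (widen_ord (leqnSn m.+1) i).
have Su := stack_unit.
have decomp (v : 'rV[K]_m.+2) : v *m S = \row_i extend_last ((v *m C) 0) ((v *m col ord_max S) 0 0) i.
  apply/rowP => i; rewrite [RHS]mxE; have [->|[j ->]] := ord_maxVwiden i.
    by rewrite /extend_last insubF ?ltnn // !mxE; apply: eq_bigr => a _; rewrite !mxE.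
  rewrite /extend_last insubT /= => [|lt]; first exact: ltn_ord.
  by rewrite !mxE; apply: eq_bigr => a _; rewrite !mxE; congr (_ * S _ _); apply: val_inj.
exists C, (col ord_max S); split=> [v|y t].
  by rewrite -mul_stack -decomp mulmxKV.
have := decomp (y *m H + t *: p); rewrite -{1}mul_stack mulmxK // => /rowP e.
apply/rowP => i; have := e (widen_ord (leqnSn m.+1) i); rewrite [LHS]mxE [X in _ = X]mxE.
rewrite /extend_last !insubT /= => [|lt]; first exact: ltn_ord.
by have -> : Sub (val i) lt = i by apply: val_inj.
Qed.

Lemma lsub_unit_prime (B : 'M[K]_m.+2) f : B \in unitmx -> prime_elt f -> prime_elt (lsub B f).
Proof.
move=> Bu; apply: (@iso_prime _ _ (lsub B) (lsub (invmx B))) => P.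
  by rewrite lsub_comp mulVmx // lsub1.
by rewrite lsub_comp mulmxV // lsub1.
Qed.

Lemma lsub_unit_dvdr (B : 'M[K]_m.+2) f P : B \in unitmx -> dvdr (lsub B f) (lsub B P) -> dvdr f P.
Proof.
move=> Bu [c e]; exists (lsub (invmx B) c).
rewrite -[P]lsub1 -(mulVmx Bu) -lsub_comp e rmorphM; congr (_ * _).
by rewrite lsub_comp mulVmx // lsub1.
Qed.

Variables (d : nat) (f : {mpoly K[m.+2]}).
Hypotheses (hf : f \is d.-homog) (d0 : (0 < d)%N) (fp : veval f p != 0).

(** The coefficient of [t ^+ d] is the nonzero constant [veval f p], so no choice of [y] lowers the
    degree along [p]. *)
Lemma muni_size (y : 'rV[K]_m.+1) : (1 < size (map_poly (meval (y 0%R)) (muni (lsub (stack H p) f))))%N.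
Proof.
have [q [qE sq hq]] := expansion H p hf.
have -> : map_poly (meval (y 0)) (muni (lsub (stack H p) f)) = map_poly (meval (y 0)) q.
  by apply: poly_ext_nz => t _; rewrite -qE -veval_stack.
have qd w : veval q`_d w = veval f p.
  have := hq d; rewrite subnn => /homog0_const ->; rewrite vevalC.
  have e : map_poly (meval ((0 : 'rV[K]_m.+1) 0)) q = veval f p *: 'X^d.
    apply: poly_ext_nz => t _; rewrite -qE mul0mx add0r (homog_scale _ _ hf).
    by rewrite hornerZ hornerXn mulrC.
  have := congr1 (fun r : {poly K} => r`_d) e; rewrite coef_map coefZ coefXn eqxx mulr1 => <-.
  by have := hq d; rewrite subnn => /homog0_const {2}->; rewrite /= mevalC.
rewrite ltnNge; apply/negP => s; have := nth_default 0 (leq_trans s d0).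
by rewrite coef_map /=; have := qd y; rewrite /veval => -> /eqP; rewrite (negbTE fp).
Qed.

Lemma root_along (y : 'rV[K]_m.+1) : exists t, veval f (y *m H + t *: p) = 0.
Proof.
have /closed_rootP [t /rootP rt] : size (map_poly (meval (y 0)) (muni (lsub (stack H p) f))) != 1%N.
  by rewrite gtn_eqF // muni_size.
by exists t; rewrite veval_stack.
Qed.

Lemma elimination_along P : prime_elt f -> ~ dvdr f P ->
  exists r : {mpoly K[m.+1]}, r != 0 /\ forall y t,
    veval f (y *m H + t *: p) = 0 -> veval P (y *m H + t *: p) = 0 -> veval r y = 0.
Proof.
move=> fpr nfP; pose q := muni (lsub (stack H p) f).
have qpr : prime_elt q := muni_prime (lsub_unit_prime stack_unit fpr).
have nq : ~ dvdr q (muni (lsub (stack H p) P)).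
  by move/muni_dvdr/(lsub_unit_dvdr stack_unit).
have sq : (1 < size q)%N by apply: leq_trans (muni_size 0) (size_poly _ _).
have [u [w [r [r0 e]]]] := prime_elimination qpr sq nq.
exists r; split=> // y t fz Pz; rewrite !veval_stack in fz Pz.
exact: (eliminant_root e fz Pz).
Qed.

End EliminationAlong.

Section PrimeIdeals.
Variables (K : numClosedFieldType) (N : nat) (Y : projvar K N).

Lemma vanishingM P Q : P * Q \in vanishing Y -> P \in vanishing Y \/ Q \in vanishing Y.
Proof. by move=> /vanishing_prime /orP. Qed.

Lemma prime_in_vanishing m (C : 'M[K]_(N.+1, m.+1)) r : r != 0 -> lsub C r \in vanishing Y ->
  exists q, [/\ prime_elt q, dvdr q r & lsub C q \in vanishing Y].
Proof.
move=> r0; have := factorial_mpoly r0; elim=> [u /mpoly_unit_const [c c0 ->]|q a qp _ ih].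
  have -> : lsub C c%:MP = c%:MP by apply: veval_ext => v; rewrite veval_lsub !vevalC.
  by rewrite (negbTE (notin_vanishingC Y c0)).
rewrite rmorphM => /vanishingM [h|/ih [q' [q'p dv h]]].
  by exists q; split=> //; apply: dvdr_mulr (dvdr_refl _).
by exists q'; split=> //; apply: dvdr_mull.
Qed.

(* A prime binary form cannot vanish on both coordinate axes. *)
Lemma no_binary_relation (C : 'M[K]_(N.+1, 2)) r w w' :
  r != 0 -> lsub C r \in vanishing Y ->
  w != 0 -> w' != 0 -> pvset Y (pof w) -> pvset Y (pof w') ->
  (w *m C) 0 0 != 0 -> (w *m C) 0 1 = 0 -> (w' *m C) 0 0 = 0 -> (w' *m C) 0 1 != 0 -> False.
Proof.
move=> r0 /(prime_in_vanishing r0) [q [qp _ /vanishingP h]] w0 w'0 Yw Yw' a0 a1 b0 b1.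
pose X1 : {mpoly K[2]} := 'X_ord_max; have X1p : prime_elt X1 := prime_last_variable _ _.
have ord1E : ord_max = 1 :> 'I_2 by apply: val_inj.
have [dv|nd] := pselect (dvdr X1 q).
  have [c /(congr1 (fun P => veval P (w' *m C)))] := prime_dvd_prime X1p qp dv.
  rewrite vevalM vevalX -[veval q _]veval_lsub (h _ w'0 Yw') mulr0 ord1E => /eqP.
  by rewrite (negbTE b1).
have nd' : ~ dvdr X1 (q * 'X_0).
  have [_ _ P1] := X1p; case/P1 => // -[c /(congr1 (fun P => veval P (delta_mx 0 0)))].
  rewrite vevalM !vevalX !mxE /= mulr0 => /eqP; by rewrite oner_eq0.
(* [y] is a nonzero point of the first axis where [q] does not vanish; but it is a multiple of the
   image of [w], a zero of [q]. *)
have [y [y1]] := nullstellensatz_row X1p nd'.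
rewrite vevalX ord1E in y1; rewrite vevalM vevalX mulf_eq0 negb_or => /andP[qy y0].
have nz : y 0 0 / (w *m C) 0 0 != 0 by rewrite mulf_neq0 ?invr_eq0.
have e : y = ((y 0 0 / (w *m C) 0 0) *: w) *m C.
  rewrite -scalemxAl; apply/rowP => i; rewrite [RHS]mxE.
  have [->|->] : i = 0 \/ i = 1 by case: i => [[|[|]]] // lt; [left|right]; apply: val_inj.
    by rewrite divfK.
  by rewrite a1 mulr0.
have v0 : (y 0 0 / (w *m C) 0 0) *: w != 0 by rewrite scaler_eq0 negb_or nz.
by move: qy; rewrite e -veval_lsub h ?eqxx // pofZ.
Qed.

End PrimeIdeals.

Section LinearForms.
Variables (K : numClosedFieldType) (N : nat).

Lemma veval_mderiv_linform (l : 'cV[K]_N.+1) i v : veval (linform l)^`M(i) v = l i 0.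
Proof.
have h0 w : veval (linform l)^`M(i) w = veval (linform l)^`M(i) 0.
  by have /homog0_const -> := mderiv_homog i (linform_homog l); rewrite !vevalC.
rewrite h0; have [q [qE dq]] := deriv_line (linform l) 0 (delta_mx 0 i).
have eq : q = l i 0 *: 'X.
  apply: poly_ext_nz => t _; rewrite qE add0r veval_linform -scalemxAl -rowE !mxE.
  by rewrite hornerZ hornerX mulrC.
move: dq; rewrite eq derivZ derivX hornerZ hornerC mulr1 (bigD1 i) //= big1 => [|j ji].
  by rewrite mxE !eqxx mulr1 addr0.
by rewrite mxE (negbTE ji) andbF mulr0.
Qed.

End LinearForms.

Lemma linform_prime (K : numClosedFieldType) N (l : 'cV[K]_N.+3) : l != 0 -> prime_elt (linform l).
Proof.
move=> /cV0Pn [k lk].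
apply: (smooth_form_prime (linform_homog l)) => //.
  apply: contraNneq lk => e; have := veval_mderiv_linform l k 0.
  by rewrite e mderiv0 veval0 => <-.
by move=> v _ _; exists k; rewrite veval_mderiv_linform.
Qed.

Section HyperplaneSection.
Variables (K : numClosedFieldType) (n d : nat) (X : projvar K n.+3).
Variable F : {mpoly K[n.+4]}.
Hypothesis XF : hyp_form d X F.
Variables (l : 'cV[K]_n.+4) (k : 'I_n.+4).
Hypothesis lk : l k 0 != 0.
Let H := kerbasis l k.
Let G := axis_section F l k.
Hypothesis Gprime : prime_elt G.
Let W := hypersection H G.

Let hF : F \is d.-homog. Proof. by case: XF. Qed.
Let hG : G \is d.-homog. Proof. exact: lsub_homog. Qed.
Let d0 : (0 < d)%N. Proof. exact: (prime_homog_gt0 hG Gprime). Qed.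
Let Hfree : row_free H. Proof. exact: kerbasis_free. Qed.

Lemma section_irr_closed : irr_closed W.
Proof. exact: (hypersection_irr Hfree hG Gprime (homog_has_zero hG d0)). Qed.

Lemma pof_section (v : 'rV[K]_n.+4) : v != 0 ->
  W (pof v) <-> (v *m l) 0 0 = 0 /\ veval F v = 0.
Proof.
move=> v0; split=> [/hypersection_pof [x [x0 e Gx]]|[vl Fv]].
  have [a a0 ev] := pof_inj v0 (row_free_neq0 Hfree x0) e.
  rewrite ev -scalemxAl -mulmxA kerbasis_mul mulmx0 scaler0 mxE; split=> //.
  by apply/eqP; rewrite (homog_eq0Z _ hF) // -veval_lsub; apply/eqP.
have : (v <= H)%MS by rewrite sub_kerbasis //; apply/eqP/rowP => i; rewrite ord1 vl mxE.
case/submxP => x ex; have x0 : x != 0 by apply: contraNneq v0 => z; rewrite ex z mul0mx.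
by rewrite ex; apply/(pof_hypersection Hfree hG x0); rewrite veval_lsub -ex.
Qed.

Lemma section_sub : W `<=` pvset X.
Proof.
have [_ _ _ XE _] := XF; apply: pof_ind => v v0 /(pof_section v0) [_ Fv].
exact/(XE _ v0).
Qed.

(* Eliminating a variable between F and P gives a relation r vanishing on Y,
   which may be taken prime and then does not involve l; its zeros on the
   hyperplane lift to the section. *)
Lemma section_not_sub (Y : projvar K n.+3) P : pvset Y `<=` pvset X ->
  P \in vanishing Y -> ~ dvdr F P -> linform l \notin vanishing Y ->
  exists v : 'rV[K]_n.+4, [/\ v != 0, W (pof v) & ~ pvset Y (pof v)].
Proof.
have [_ _ Fp XE XV] := XF.
move=> YX /vanishingP YP nFP nl; have [G0 _ _] := Gprime; have [z Gz] := veval_neq0 G0.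
(* Eliminating along a direction inside the hyperplane keeps [l] a linear form [m1] in the remaining
   coordinates. *)
pose p := z *m H; have Fp0 : veval F p != 0 by rewrite -veval_lsub.
have pl : (p *m l) 0 0 = 0 by rewrite /p -mulmxA kerbasis_mul mulmx0 mxE.
have p0 : p != 0 by apply: contraNneq Fp0 => ->; rewrite (homog_eval0 hF).
have /rV0Pn [k1 pk] := p0.
pose l1 : 'cV[K]_n.+4 := delta_mx k1 0.
have l1k : l1 k1 0 != 0 by rewrite mxE !eqxx oner_neq0.
have pl1 : (p *m l1) 0 0 != 0 by rewrite /l1 -colE mxE.
pose H1 := kerbasis l1 k1; have full : (1%:M <= H1 + p)%MS := kerbasis_full l1k pl1.
have [r [r0 rE]] := elimination_along full hF d0 Fp0 Fp nFP.
have [C [T [CT CK]]] := stack_coords full.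
have rY : lsub C r \in vanishing Y.
  apply/vanishingP => v v0 Yv; rewrite veval_lsub; apply: (rE _ ((v *m T) 0 0)); rewrite -CT.
    by apply/(XE _ v0); apply: YX.
  exact: YP.
have [q [qp _ qY]] := prime_in_vanishing r0 rY.
pose m1 := H1 *m l.
have vl (v : 'rV[K]_n.+4) : (v *m l) 0 0 = (v *m C *m m1) 0 0.
  rewrite {1}(CT v) mulmxDl -mulmxA -/m1 -scalemxAl mxE [X in _ + X]mxE pl mulr0 addr0.
  by rewrite mulmxA.
have lE : lsub C (linform m1) = linform l.
  by apply: veval_ext => v; rewrite veval_lsub !veval_linform vl.
have m10 : m1 != 0.
  apply: contraNneq lk => e; have := vl (delta_mx 0 k).
  by rewrite e mulmx0 -rowE !mxE => ->.
have m1p := linform_prime m10.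
(* Otherwise the primes [linform m1] and [q] would divide each other, and [l] would vanish on [Y]
   together with [q]. *)
have nq : ~ dvdr (linform m1) q.
  move=> /(prime_dvd_prime m1p qp) [c e]; case/negP: nl; rewrite -lE e rmorphM.
  by apply/vanishingP => v v0 Yv; move/vanishingP: qY => h; rewrite vevalM h ?mulr0.
have /cV0Pn [k2 m1k] := m10.
have y0 := row_free_neq0 (kerbasis_free m1k) (ones_neq0 K n.+1).
set y1 : 'rV_n.+3 := _ *m _ in y0.
have y1m : (y1 *m m1) 0 0 = 0 by rewrite /y1 -mulmxA kerbasis_mul mulmx0 mxE.
have /rV0Pn [i yi] := y0.
have nqX : ~ dvdr (linform m1) (q * 'X_i).
  have [_ _ m1P] := m1p; case/m1P => // -[c /(congr1 (fun P => veval P y1))].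
  rewrite vevalM vevalX veval_linform y1m mulr0 => /eqP.
  by rewrite (negbTE yi).
have [y [m1y]] := nullstellensatz_row m1p nqX.
rewrite vevalM vevalX mulf_eq0 negb_or => /andP[qy yi0].
have [t Ft] := root_along H1 hF d0 Fp0 y.
have vC : (y *m H1 + t *: p) *m C = y by apply: CK.
have v0 : y *m H1 + t *: p != 0.
  by apply: contraNneq yi0 => e; rewrite -vC e mul0mx mxE.
exists (y *m H1 + t *: p); split=> //.
  by apply/(pof_section v0); rewrite vl vC -veval_linform.
by move=> Yv; move/vanishingP: qY => /(_ _ v0 Yv) /eqP; rewrite veval_lsub vC (negbTE qy).
Qed.

(** A form that vanishes on [V 1] but not on [V 2] is no multiple of F, and [l] does not vanish on
    [V 1], which would otherwise lie in [W]. Then some point of [W] is outside [V 1], against the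
    chain. *)
Lemma section_codim : ~ chain_above (pvset X) W 2.
Proof.
move=> [V [V0 irr strict]].
have [irr1 sub1] := irr 1%N isT; have [irr2 sub2] := irr 2%N isT.
have [s01 n01] := strict 0%N isT; have [s12 n12] := strict 1%N isT.
pose Y := ProjVar irr1.
have [q [Vq nq]] : exists q, V 2%N q /\ ~ V 1%N q.
  apply: contrapT => h; apply: n12 => q Vq; apply: contrapT => nq; apply: h; by exists q.
have [e [P [hP Pv Pq]]] := closed_sep irr1.1 nq.
have PY : P \in vanishing Y by apply/(vanishing_homog _ hP).
have [_ _ _ XE XV] := XF.
have nFP : ~ dvdr F P.
  by move/XV/(vanishing_homog _ hP) => /(_ _ (sub2 _ Vq)) /eqP; rewrite (negbTE Pq).
have nl : linform l \notin vanishing Y.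
  apply/negP => /vanishingP h; apply: n01; rewrite V0; apply: pof_ind => v v0 Yv.
  apply/(pof_section v0); split; first by rewrite -veval_linform; apply: h.
  by apply/(XE _ v0); apply: sub1.
have [v [v0 Wv nYv]] := @section_not_sub Y P sub1 PY nFP nl; apply: nYv.
by apply: s01; rewrite V0.
Qed.

End HyperplaneSection.

Section HomologyCodim.
Variables (K : numClosedFieldType) (n d : nat) (X : projvar K n.+3).
Variable F : {mpoly K[n.+4]}.
Hypothesis XF : hyp_form d X F.
Hypothesis d4 : (4 <= d)%N.
Variables (g : pspace K n.+3 -> pspace K n.+3) (A : 'M[K]_n.+4).
Hypothesis Aunit : A \in unitmx.
Hypothesis gE : forall v : 'rV[K]_n.+4, v != 0 -> pvset X (pof v) -> g (pof v) = pof (v *m A).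
Hypothesis gX : forall v : 'rV[K]_n.+4, v != 0 -> pvset X (pof v) -> pvset X (pof (v *m A)).
Hypothesis gord : automorphism_order X g d.-1.

Lemma not_all_fixed : ~ (pvset X `<=` fixed_set X g).
Proof.
have [_ _ nid] := gord => h; apply: (nid 1%N).
  by move: d4; case: (d) => [|[|[|[]]]].
by move=> y Xy /=; have [] := h _ Xy.
Qed.

Lemma fixed_chain_above Z0 : irr_closed Z0 -> Z0 `<=` fixed_set X g -> chain_above X Z0 1.
Proof.
move=> irrZ sub; exists (fun i => if i is 0%N then Z0 else pvset X); split=> //.
- by case=> [|[|]] // _; split=> //; [move=> y /sub []|exact: projvarP].
- case=> [|] // _; split; first by move=> y /sub [].
  by move=> h; apply: not_all_fixed => y Xy; apply: sub; apply: h.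
Qed.

Variables (lam : K) (l : 'cV[K]_n.+4) (p : 'rV[K]_n.+4) (k : 'I_n.+4).
Hypothesis hom : homology A lam l p.
Hypothesis lk : l k 0 != 0.

Lemma homology_section_prime : prime_elt (axis_section F l k) /\ smooth_form (axis_section F l k).
Proof.
have [c _ FA] := invariant_form XF Aunit gX.
have [eA _ _] := hom; rewrite eA in FA.
have s0 := homology_axis XF d4 Aunit gE gX hom gord.
have lam0 := homology_lam_neq0 Aunit hom.
have prim := homology_primitive XF d4 Aunit gE gX hom gord.
split; [exact: (axis_section_prime XF d4 lam0 s0 lk prim FA)|].
exact: (axis_section_smooth XF d4 lam0 s0 lk prim FA).
Qed.

Lemma section_fixed : hypersection (kerbasis l k) (axis_section F l k) `<=` fixed_set X g.
Proof.
apply: pof_ind => v v0 Wv; have Xv := section_sub XF lk Wv; split=> //.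
have [eA _ _] := hom; have [vl _] := (pof_section XF lk v0).1 Wv.
by rewrite gE // eA rank_one_mul vl scale0r addr0 pofZ // (homology_lam_neq0 Aunit hom).
Qed.

Lemma homology_codim : codim_is (fixed_set X g) X 1.
Proof.
have [Gp _] := homology_section_prime; split.
- by move=> y [].
- exact: fixed_chain_above.
- exists (hypersection (kerbasis l k) (axis_section F l k)); split.
  + exact: (section_irr_closed XF lk Gp).
  + exact: section_fixed.
  + exact: (section_codim XF lk Gp).
Qed.

End HomologyCodim.

Lemma row_free2 (K : fieldType) n (a b : 'rV[K]_n) :
  a != 0 -> (forall c, b != c *: a) -> row_free (col_mx a b).
Proof.
move=> a0 ind; apply: inj_row_free => v; rewrite -[v]hsubmxK mul_row_col.
set x := lsubmx v; set y := rsubmx v; rewrite [x]mx11_scalar [y]mx11_scalar !mul_scalar_mx => e.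
have y0 : y 0 0 = 0.
  apply: contraTeq (ind (- (y 0 0)^-1 * x 0 0)) => ny; rewrite negbK; apply/eqP.
  have := congr1 (fun w => (y 0 0)^-1 *: w) e; rewrite scaler0 scalerDr !scalerA mulVf // scale1r.
  by move/eqP; rewrite addrC addr_eq0 => /eqP ->; rewrite mulNr scaleNr.
move: e; rewrite y0 scale0r addr0 => /eqP; rewrite scaler_eq0 (negbTE a0) orbF => /eqP x0.
have z0 : (0 : K)%:M = 0 :> 'M_1 by exact: raddf0.
by rewrite x0 z0; exact: row_mx0.
Qed.

Lemma mul_pair_mx (K : fieldType) n (a b : 'rV[K]_n) (x : 'rV[K]_2) :
  x *m (col_mx a b : 'M_(1 + 1, n)) = x 0 0 *: a + x 0 1 *: b.
Proof.
apply/rowP => j; rewrite !mxE big_ord_recl big_ord1 !mxE.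
case: splitP => [i _|//]; case: splitP => [[[]] //|i' _].
by rewrite !ord1; congr (_ + x 0 _ * _); apply: val_inj.
Qed.

Lemma exists_annihilator (K : fieldType) k n (B : 'M[K]_(k, n)) :
  (\rank B < n)%N -> exists2 l : 'cV[K]_n, l != 0 & B *m l = 0.
Proof.
move=> rk; have /matrix0Pn [i [j nz]] : cokermx B != 0.
  by rewrite -mxrank_eq0 mxrank_coker subn_eq0 -ltnNge.
exists (col j (cokermx B)); first by apply: contraNneq nz => /colP /(_ i); rewrite !mxE => ->.
by rewrite colE mulmxA mulmx_coker mul0mx.
Qed.

Section PlaneCurve.
Variables (K : numClosedFieldType) (N d : nat) (H : 'M[K]_(3, N.+1)) (G : {mpoly K[3]}).
Hypotheses (Hfree : row_free H) (hG : G \is d.-homog) (Gp : prime_elt G).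
Let W := hypersection H G.
Let d0 : (0 < d)%N. Proof. exact: (prime_homog_gt0 hG Gp). Qed.

Lemma plane_curve_irr : irr_closed W.
Proof. exact: (hypersection_irr Hfree hG Gp (homog_has_zero hG d0)). Qed.

Lemma plane_curve_two_points : exists a b : 'rV[K]_3,
  [/\ a != 0, b != 0, veval G a = 0, veval G b = 0 & pof (a *m H) != pof (b *m H)].
Proof.
have [a a0 Ga] := homog_has_zero hG d0.
have /rV0Pn [i ai] := a0.
have [b b0 [Gb]] := common_zero hG (linform_homog (delta_mx i 0)) d0 isT.
rewrite veval_linform -colE mxE => bi.
exists a, b; split=> //; apply/eqP => e.
have [c c0] := pof_inj (row_free_neq0 Hfree a0) (row_free_neq0 Hfree b0) e.
rewrite scalemxAl => /(row_free_inj Hfree) /rowP /(_ i) /eqP.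
by rewrite mxE bi mulr0 (negbTE ai).
Qed.

(** The center [z] of the elimination avoids both the curve and the line through the two points.
    That line receives the projection, with the two points as coordinate points, and no nonzero
    relation on an irreducible set allows both. *)
Lemma plane_curve_no_proper (Y : projvar K N) w w' q :
  pvset Y `<=` W -> pvset Y w -> pvset Y w' -> w != w' -> W q -> ~ pvset Y q -> False.
Proof.
move=> YW Yw Yw' ww' Wq nYq.
have [e [P [hP Pv Pq]]] := closed_sep (projvarP Y).1 nYq.
have nGP : ~ dvdr G (lsub H P).
  move/(hypersection_vanishing Hfree P hG Gp (homog_has_zero hG d0)).2.
  by move/(vanishing_homog _ hP) => /(_ _ Wq) /eqP; rewrite (negbTE Pq).
have [a [a0 ea Ga]] := hypersection_pof (YW _ Yw).
have [b [b0 eb Gb]] := hypersection_pof (YW _ Yw').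
have ind c : b != c *: a.
  apply/negP => /eqP e'; move: ww'; rewrite ea eb e' -scalemxAl pofZ ?eqxx //.
    by apply: contraNneq b0 => c0; rewrite e' c0 scale0r.
  exact: row_free_neq0.
pose H' : 'M[K]_(1 + 1, 3) := col_mx a b.
have H'free : row_free H' := row_free2 a0 ind.
have rk : \rank H' = 2%N by apply/eqP.
have [m mj Hm] : exists2 m : 'cV[K]_3, m != 0 & H' *m m = 0 by apply: exists_annihilator; rewrite rk.
have m0 : linform m != 0 by have [] := linform_prime mj.
have [G0 _ _] := Gp; have [z] := veval_neq0 (mulf_neq0 G0 m0).
rewrite vevalM mulf_eq0 negb_or veval_linform => /andP[Gz zm].
have full : (1%:M <= H' + z)%MS.
  rewrite sub1mx /row_full eqn_leq rank_leq_col /=.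
  suff : (H' < H' + z)%MS by move=> /rank_ltmx; rewrite rk.
  rewrite /ltmx addsmxSl /= addsmx_sub submx_refl /=; apply: contra zm => /submxP [u ->].
  by rewrite -mulmxA Hm mulmx0 mxE.
have [r [r0 rE]] := elimination_along full hG d0 Gz Gp nGP.
have [C [T [CT CK]]] := stack_coords full.
have rY : lsub (pinvmx H *m C) r \in vanishing Y.
  apply/vanishingP => v v0 Yv; rewrite veval_lsub.
  have [x [x0 ex Gx]] := hypersection_pof (YW _ Yv).
  have [c c0 ev] := pof_inj v0 (row_free_neq0 Hfree x0) ex.
  have {}ev : v = (c *: x) *m H by rewrite ev scalemxAl.
  have -> : v *m (pinvmx H *m C) = (c *: x) *m C by rewrite ev -mulmxA (mulmxA H) mulmxVp // mul1mx.
  apply: (rE _ (((c *: x) *m T) 0 0)); rewrite -CT.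
    by apply/eqP; rewrite (homog_eq0Z _ hG c0) Gx.
  rewrite veval_lsub -ev; by move/(vanishing_homog _ hP)/vanishingP: Pv; apply.
have aC : a *m C = delta_mx 0 0.
  rewrite -[RHS](CK _ 0) scale0r addr0; congr (_ *m C).
  by rewrite mul_pair_mx !mxE /= scale1r scale0r addr0.
have bC : b *m C = delta_mx 0 1.
  rewrite -[RHS](CK _ 0) scale0r addr0; congr (_ *m C).
  by rewrite mul_pair_mx !mxE /= scale1r scale0r add0r.
have HC x : (x *m H) *m (pinvmx H *m C) = x *m C by rewrite -mulmxA (mulmxA H) mulmxVp // mul1mx.
rewrite ea in Yw; rewrite eb in Yw'.
apply: (no_binary_relation r0 rY (row_free_neq0 Hfree a0) (row_free_neq0 Hfree b0) Yw Yw');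
  by rewrite HC ?aC ?bC mxE ?eqxx ?oner_neq0.
Qed.

Lemma plane_curve_dim : dim_is W 1.
Proof.
split.
  have [a [b [a0 b0 Ga Gb ab]]] := plane_curve_two_points.
  have Wa : W (pof (a *m H)) by apply/(pof_hypersection Hfree hG a0).
  have Wb : W (pof (b *m H)) by apply/(pof_hypersection Hfree hG b0).
  exists (fun i => if i is 0%N then [set pof (a *m H)] else W); split.
    case=> [|i] _; last by split=> //; apply: plane_curve_irr.
    by split; [apply: point_irr_closed|move=> q ->].
  case=> [|i] // _; split; first by move=> q ->.
  by move=> /(_ _ Wb) e; move: ab; rewrite e eqxx.
move=> [V [irr strict]].
have [irr0 _] := irr 0%N isT; have [irr1 sub1] := irr 1%N isT; have [irr2 sub2] := irr 2%N isT.
have [s01 n01] := strict 0%N isT; have [s12 n12] := strict 1%N isT.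
have [w Vw] := irr0.2.1.
have ex (S T : set (pspace K N)) : ~ T `<=` S -> exists2 q, T q & ~ S q.
  by move=> h; apply: contrapT => nh; apply: h => q Tq; apply: contrapT => nq; apply: nh; exists q.
have [w' Vw' nw'] := ex _ _ n01; have [q Vq nq] := ex _ _ n12.
apply: (@plane_curve_no_proper (ProjVar irr1) w w' q) => //; first exact: s01.
  by apply/eqP => e; apply: nw'; rewrite -e.
exact: sub2.
Qed.

End PlaneCurve.

(** * Smooth plane curves are not rational *)

Lemma factorial_field (F : fieldType) : factorial_domain F.
Proof. by move=> a a0; apply: FactoredUnit; rewrite unitfE. Qed.

Lemma minor_relation (R : comNzRingType) (n0 n1 n2 a0 a1 a2 b0 b1 b2 : R) :
  n0 * a0 + n1 * a1 + n2 * a2 = 0 -> n0 * b0 + n1 * b1 + n2 * b2 = 0 ->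
  n1 * (a1 * b2 - a2 * b1) = n0 * (a2 * b0 - a0 * b2).
Proof.
move=> e e'; apply/eqP; rewrite -subr_eq0; apply/eqP.
transitivity (b2 * (n0 * a0 + n1 * a1 + n2 * a2) - a2 * (n0 * b0 + n1 * b1 + n2 * b2)); first by ring.
by rewrite e e' !mulr0 subrr.
Qed.

Lemma ord3_split (V : nmodType) (i : 'I_3) : exists j k : 'I_3,
  (forall f : 'I_3 -> V, \sum_m f m = f i + f j + f k) /\ forall m, [\/ m = i, m = j | m = k].
Proof.
have E (m : 'I_3) : [\/ m = 0, m = 1 | m = 2].
  by case: m => [[|[|[|]]]] // lt; [apply: Or31|apply: Or32|apply: Or33]; apply: val_inj.
have S (f : 'I_3 -> V) : \sum_m f m = f 0 + f 1 + f 2.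
  rewrite !big_ord_recl big_ord0 addr0 addrA; congr (f _ + f _ + f _); exact: val_inj.
case: (E i) => ->; [exists 1, 2|exists 0, 2|exists 0, 1]; split=> [f|m]; rewrite ?S //.
- by rewrite [f 1 + _]addrC.
- by case: (E m) => ->; [apply: Or32|apply: Or31|apply: Or33].
- by rewrite [f 2 + _]addrC [LHS]addrC addrA [f 2 + _]addrC -addrA addrC.
- by case: (E m) => ->; [apply: Or32|apply: Or33|apply: Or31].
Qed.

Section PolynomialCurves.
Variable K : numClosedFieldType.

Definition no_common_root (I : Type) (b : I -> {poly K}) := forall t, exists i, (b i).[t] != 0.

Lemma dvdr_no_common_root (I : Type) (N : I -> {poly K}) a w : no_common_root N -> a != 0 ->
  (forall i, dvdr a (w * N i)) -> dvdr a w.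
Proof.
move=> nr a0 h; apply: (dvdr_cofactor (factorial_poly (@factorial_field K) a0) h) => p [p0 pu _] _.
have /closed_rootP [t /rootP pt] : size p != 1%N.
  apply: contraNneq pu => /eqP /size_poly1P [c c0 ->].
  by apply: (rmorph_unit (@polyC K)); rewrite unitfE.
by have [i ni] := nr t; exists i => -[c e]; move: ni; rewrite e hornerM pt mulr0 eqxx.
Qed.

Lemma dvdr_size (a w : {poly K}) : w != 0 -> dvdr a w -> (size a <= size w)%N.
Proof.
move=> w0 [c e]; rewrite e in w0 *; have c0 : c != 0 by apply: contraNneq w0 => ->; rewrite mul0r.
rewrite size_mul //; last by apply: contraNneq w0 => ->; rewrite mulr0.
by rewrite -(prednK (_ : 0 < size c)%N) ?size_poly_gt0 // leq_addl.
Qed.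

Lemma extract_common_root (I : Type) (b : I -> {poly K}) i0 : b i0 != 0 ->
  exists h c, [/\ h != 0, forall i, b i = h * c i & no_common_root c].
Proof.
have [n] := ubnP (size (b i0)); elim: n b => // n ih b; rewrite ltnS => sb bi0.
have [nr|] := pselect (no_common_root b).
  by exists 1, b; split=> [|i|//]; rewrite ?oner_neq0 ?mul1r.
move=> /existsNP [t nt]; have bt i : exists q, b i = q * ('X - t%:P).
  apply/factor_theorem/rootP; apply: contrapT => /eqP nz; apply: nt; by exists i.
have [c cE] := choice bt; have ci0 : c i0 != 0 by apply: contraNneq bi0 => z; rewrite cE z mul0r.
have [|//|h [c' [h0 hE nr]]] := ih c.
  apply: leq_trans sb; rewrite cE size_Mmonic ?monicXsubC // size_XsubC addn2 /= .
  by rewrite ltnS.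
exists (h * ('X - t%:P)), c'; split=> // [|i]; first by rewrite mulf_neq0 ?polyXsubC_eq0.
by rewrite cE hE mulrAC.
Qed.

Section Wronskian.
Variables (d : nat) (G : {mpoly K[3]}) (b : 'I_3 -> {poly K}).
Hypotheses (d3 : (3 <= d)%N) (hG : G \is d.-homog) (Gs : smooth_form G).
Hypotheses (bG : along b G = 0) (nr : no_common_root b).

(* Both b and its derivative are orthogonal to the gradient N of G along b, so
   that N is proportional to their cross product, while N has the larger degree. *)
Lemma smooth_curve_constant : forall i, (size (b i) <= 1)%N.
Proof.
pose N i := along b G^`M(i).
have wE v : \row_i v i = 0 -> forall i : 'I_3, v i = 0 :> K.
  by move=> /rowP e i; have := e i; rewrite !mxE.
have evE P (v : 'I_3 -> K) : P.@[v] = veval P (\row_i v i).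
  by apply: meval_eq => i; rewrite mxE.
have Nb' : \sum_i N i * (b i)^`() = 0 by rewrite -deriv_along bG deriv0.
have Nb : \sum_i N i * b i = 0.
  have -> : \sum_i N i * b i = along b (\sum_i G^`M(i) * 'X_i).
    by rewrite rmorph_sum; apply: eq_bigr => i _; rewrite rmorphM /= alongX.
  have -> : \sum_i G^`M(i) * 'X_i = d%:R *: G.
    apply: veval_ext => v; rewrite veval_sum vevalZ -(euler_homog v hG).
    by apply: eq_bigr => i _; rewrite vevalM vevalX mulrC.
  by rewrite -mul_mpolyC rmorphM /= bG mulr0.
have Nnr : no_common_root N.
  move=> t; have v0 : \row_i (b i).[t] != 0.
    by case: (nr t) => i; apply: contraNneq => /wE ->.
  have Gv : veval G (\row_i (b i).[t]) = 0 by rewrite -evE -horner_along bG horner0.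
  by case: (Gs v0 Gv) => i; rewrite -evE -horner_along; exists i.
pose i0 := [arg max_(i > (ord0 : 'I_3)) size (b i)].
have bmax i : (size (b i) <= size (b i0))%N by rewrite /i0; case: arg_maxnP => // j _ h; apply: h.
have b0 : b i0 != 0.
  case: (nr 0) => i; apply: contraNneq => e.
  by have := bmax i; rewrite e size_poly0 leqn0 size_poly_eq0 => /eqP ->; rewrite horner0.
have sE : size (b i0) = (size (b i0)).-1.+1 by rewrite prednK // size_poly_gt0.
set e := (size (b i0)).-1 in sE.
suff e0 : e = 0%N by move=> i; have := bmax i; rewrite sE e0.
(* The point of the curve at parameter infinity. Smoothness there gives a component of [N] of full
   degree [(d - 1) * e]. *)
pose beta i := (b i)`_e.
have top i : top_coef e (b i) (beta i) by split=> //; have := bmax i; rewrite sE.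
have topP k P : P \is k.-homog -> top_coef (k * e) (along b P) (veval P (\row_i beta i)).
  by move=> hP; rewrite -evE; apply: (top_coef_mmap (phi := idfun) hP).
have beta0 : \row_i beta i != 0.
  apply: contraNneq b0 => /wE /(_ i0) z; rewrite -lead_coef_eq0; exact/eqP.
have [i Gi] : exists i, veval G^`M(i) (\row_i beta i) != 0.
  by apply: (Gs beta0); have [_ <-] := topP _ _ hG; rewrite bG coef0.
have sN : ((d.-1 * e) < size (N i))%N.
  rewrite ltnNge; apply: contra Gi => s; have [_ <-] := topP _ _ (mderiv_homog i hG).
  by rewrite nth_default.
have Ni0 : N i != 0 by rewrite -size_poly_gt0; apply: leq_ltn_trans sN.
have [j [k [S3 c3]]] := ord3_split {poly K} i.
pose w x y := b x * (b y)^`() - b y * (b x)^`().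
rewrite S3 in Nb; rewrite S3 in Nb'.
have r1 : N j * w j k = N i * w k i := minor_relation Nb Nb'.
have r2 : N k * w k j = N i * w j i.
  by apply: (@minor_relation _ _ _ (N j)); rewrite addrAC.
have wN x y : w x y = - w y x by rewrite /w; ring.
have dv : dvdr (N i) (w j k).
  apply: (dvdr_no_common_root Nnr Ni0) => m; case: (c3 m) => ->; first by exists (w j k); rewrite mulrC.
    by exists (w k i); rewrite mulrC r1 mulrC.
  by exists (w i j); rewrite mulrC (wN j k) mulrN r2 -mulrN -(wN i j) mulrC.
(* The degree of a nonzero [w j k] is below [2 * e], and [d - 1] is at least 2, so it cannot be a
   multiple of [N i]. *)
have wjk : w j k = 0.
  apply/eqP; apply: contraT => nz.
  have sw : (size (w j k) <= e + e)%N.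
    have sb (x y : 'I_3) : (size (b x * (b y)^`())%R <= e + e)%N.
      apply: leq_trans (size_polyMleq _ _) _; rewrite -subn1 leq_subLR.
      rewrite addnA leq_add // ?add1n -?sE ?bmax //; apply: leq_trans (size_poly _ _) _.
      by rewrite /e -!subn1 leq_sub2r.
    by apply: leq_trans (size_polyD _ _) _; rewrite geq_max size_polyN !sb.
  have := leq_trans sN (leq_trans (dvdr_size nz dv) sw).
  by rewrite addnn -mul2n ltnNge leq_mul // -subn1 ltn_subRL.
have wki : w k i = 0 by move/eqP: r1; rewrite wjk mulr0 eq_sym mulf_eq0 (negbTE Ni0) => /eqP.
have wji : w j i = 0.
  by move/eqP: r2; rewrite wN wjk oppr0 mulr0 eq_sym mulf_eq0 (negbTE Ni0) => /eqP.
have wi0 x y : w x y = 0.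
  have ww z : w z z = 0 by rewrite /w; ring.
  by case: (c3 x) => ->; case: (c3 y) => ->; rewrite ?ww // ?wjk ?wki ?wji // wN ?wjk ?wki ?wji oppr0.
(* With all minors zero, [b i0] divides the product of its derivative with every [b m]. As these
   have no common root, it divides its derivative, which is then zero; in characteristic 0 it is
   constant. *)
have : dvdr (b i0) (b i0)^`().
  apply: (dvdr_no_common_root nr b0) => m; exists (b m)^`().
  by apply/eqP; rewrite [X in X == _]mulrC [X in _ == X]mulrC eq_sym -subr_eq0 -[X in X == _]/(w i0 m) wi0.
have b1 : (size (b i0)^`() < size (b i0))%N by rewrite lt_size_deriv.
have [b'0 _|nz /(dvdr_size nz)] := eqVneq (b i0)^`() 0; last by rewrite leqNgt b1.
case: (posnP e) => // e_gt0; have /eqP := congr1 (fun q : {poly K} => q`_e.-1) b'0.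
by rewrite coef_deriv coef0 prednK // mulrn_eq0 gtn_eqF //= -[_`_ _]/(lead_coef _) lead_coef_eq0 (negbTE b0).
Qed.

End Wronskian.
End PolynomialCurves.

Lemma frac_numden (R : idomainType) (z : {fraction R}) : exists n d : R,
  d != 0 /\ z * FracField.tofrac d = FracField.tofrac n.
Proof.
elim/quotW: z => x; exists (frac x).1, (frac x).2; split; first exact: denom_ratioP.
apply/eqP; rewrite -[_ * _]/(FracField.mul _ _) !piE /FracField.equivf /FracField.mulf.
by rewrite !numden_Ratio ?mulr1 ?mulf_neq0 ?oner_neq0 ?denom_ratioP // mulrC.
Qed.

Lemma common_denominator (R : idomainType) (I : finType) (z : I -> {fraction R}) : exists (d : R) (n : I -> R),
  d != 0 /\ forall i, FracField.tofrac (n i) = z i * FracField.tofrac d.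
Proof.
have [n nE] := choice (fun i => frac_numden (z i)); have [d dE] := choice nE.
exists (\prod_i d i), (fun i => n i * \prod_(j | j != i) d j); split.
  by apply/prodf_neq0 => i _; have [] := dE i.
by move=> i; have [_ e] := dE i; rewrite [in RHS](bigD1 i) //= !tofracM -e mulrA.
Qed.

Lemma mmap_homog_scale (A : nzRingType) (S : comNzRingType) n (phi : {rmorphism A -> S}) (x : 'I_n -> S) c k
    (P : {mpoly A[n]}) : P \is k.-homog -> mmap phi (fun i => c * x i) P = c ^+ k * mmap phi x P.
Proof.
move=> /dhomogP h; rewrite /mmap mulr_sumr; apply: eq_big_seq => m /h /= mk.
rewrite mulrCA; congr (_ * _); rewrite /mmap1.
under eq_bigr do rewrite exprMn.
by rewrite big_split /= -mk mdegE prodrXr.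
Qed.

Section Parametrisation.
Variables (K : numClosedFieldType) (N d : nat) (H : 'M[K]_(3, N.+1)) (G : {mpoly K[3]}) (Y : projvar K N).
Hypotheses (Hfree : row_free H) (d3 : (3 <= d)%N) (hG : G \is d.-homog) (Gp : prime_elt G) (Gs : smooth_form G).
Hypothesis YE : pvset Y = hypersection H G.
Variables (S : fieldType) (kap : {rmorphism {mpoly K[N.+1]} -> S}) (psi : {rmorphism {poly K} -> S}).
Hypotheses (kap0 : forall P, (kap P == 0) = (P \in vanishing Y)) (psi_inj : injective psi).
Hypothesis psiC : forall c, psi c%:P = kap c%:MP.

Lemma psi_along (b : 'I_N.+1 -> {poly K}) u k P : (forall i, psi (b i) = u * kap 'X_i) ->
  P \is k.-homog -> psi (along b P) = u ^+ k * kap P.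
Proof.
move=> bE hP; have e1 : psi (along b P) = mmap (psi \o polyC) (fun i => u * kap 'X_i) P.
  apply: (@mpoly_morph_ext _ _ _ (psi \o along b) (mmap (psi \o polyC) (fun i => u * kap 'X_i))) => [c|i] /=.
    by rewrite alongC mmapC.
  by rewrite alongX mmapX mmap1U.
rewrite e1 (mmap_homog_scale _ _ _ hP); congr (_ * _).
apply: (@mpoly_morph_ext _ _ _ (mmap (psi \o polyC) (fun i => kap 'X_i)) kap) => [c|i] /=.
  by rewrite mmapC /= psiC.
by rewrite mmapX mmap1U.
Qed.

(** Without common roots the [b i] map the affine line to the curve, so they are constant. The
    coordinate functions are then proportional to constants and [Y] is a single point, whereas the
    curve has two. *)
Lemma no_parametrisation (b : 'I_N.+1 -> {poly K}) u :
  u != 0 -> (forall i, psi (b i) = u * kap 'X_i) -> False.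
Proof.
move=> u0 bE; have [p1 [p2 [p10 p20 Gp1 Gp2 p12]]] := plane_curve_two_points Hfree hG Gp.
have Yp1 : pvset Y (pof (p1 *m H)) by rewrite YE; apply/(pof_hypersection Hfree hG p10).
have Yp2 : pvset Y (pof (p2 *m H)) by rewrite YE; apply/(pof_hypersection Hfree hG p20).
have [i0 bi0] : exists i0, b i0 != 0.
  apply: contrapT => nb; have /negP := row_free_neq0 Hfree p10; apply; apply/eqP/rowP => i; rewrite [RHS]mxE.
  have : 'X_i \in vanishing Y.
    rewrite -kap0; suff : u * kap 'X_i == 0 by rewrite mulf_eq0 (negbTE u0).
    by rewrite -bE; have [->|nz] := eqVneq (b i) 0; [rewrite rmorph0|case: nb; exists i].
  by move=> /vanishingP /(_ _ (row_free_neq0 Hfree p10) Yp1); rewrite vevalX.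
have [h [c [h0 bc nr]]] := extract_common_root bi0.
have ph0 : psi h != 0 by rewrite -(rmorph0 psi) (inj_eq psi_inj).
pose u' := u / psi h; have cE i : psi (c i) = u' * kap 'X_i.
  by apply: (mulfI ph0); rewrite -rmorphM -bc bE /u' mulrA [psi h * _]mulrC divfK.
have u'0 : u' != 0 by rewrite mulf_neq0 ?invr_eq0.
pose ct t := \row_i (c i).[t].
have ct0 t : ct t != 0.
  by case: (nr t) => i; apply: contraNneq => /rowP /(_ i); rewrite !mxE => ->.
have Yct t : pvset Y (pof (ct t)).
  apply: contrapT => nY; have [k [P [hP Pv]]] := closed_sep (projvarP Y).1 nY.
  rewrite (heval_pof hP (ct0 t)) => /negP; apply.
  have -> : veval P (ct t) = (along c P).[t].
    by rewrite horner_along; apply: meval_eq => i; rewrite mxE.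
  have -> : along c P = 0.
    apply: psi_inj; rewrite (psi_along cE hP) rmorph0.
    have /eqP -> : kap P == 0 by rewrite kap0; apply/(vanishing_homog _ hP).
    by rewrite mulr0.
  by rewrite horner0.
pose cb (i : 'I_3) := \sum_j pinvmx H j i *: c j.
have cbE t : \row_i (cb i).[t] = ct t *m pinvmx H.
  apply/rowP => i; rewrite !mxE horner_sum; apply: eq_bigr => j _.
  by rewrite hornerZ [ct t _ _]mxE mulrC.
have ctE t : ct t = (\row_i (cb i).[t]) *m H /\ veval G (\row_i (cb i).[t]) = 0.
  have := Yct t; rewrite YE => /hypersection_pof [x [x0 ex Gx]].
  have [a a0 e] := pof_inj (ct0 t) (row_free_neq0 Hfree x0) ex.
  rewrite cbE e -scalemxAl -mulmxA mulmxVp // mulmx1 -scalemxAl; split=> //.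
  by apply/eqP; rewrite (homog_eq0Z _ hG a0) Gx.
have cbG : along cb G = 0.
  apply: poly_ext_nz => t _; rewrite horner_along horner0 -[RHS](ctE t).2.
  by apply: meval_eq => i; rewrite mxE.
have cbnr : no_common_root cb.
  move=> t; apply: contrapT => ncb; have /negP := ct0 t; apply; apply/eqP.
  rewrite (ctE t).1; have -> : \row_i (cb i).[t] = 0; last by rewrite mul0mx.
  apply/rowP => i; rewrite !mxE; apply: contrapT => /eqP nz; apply: ncb; by exists i.
have cbC := smooth_curve_constant d3 hG Gs cbG cbnr.
have ctC t : ct t = ct 0.
  rewrite (ctE t).1 (ctE 0).1; congr (_ *m H); apply/rowP => i; rewrite !mxE.
  by rewrite (size1_polyC (cbC i)) !hornerC.
have cC i : c i = (ct 0 0 i)%:P.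
  by apply: poly_ext_nz => t _; rewrite hornerC -(ctC t) mxE.
suff single v : v != 0 -> pvset Y (pof v) -> pof v = pof (ct 0).
  move/eqP: p12; apply; rewrite (single _ (row_free_neq0 Hfree p10) Yp1).
  by rewrite (single _ (row_free_neq0 Hfree p20) Yp2).
move=> v0 Yv; have [|a e] := @minors_collinear _ _ v (ct 0) _ (ct0 0); last first.
  by rewrite e pofZ //; apply: contraNneq v0 => a0; rewrite e a0 scale0r.
move=> i j; have : 'X_i * (ct 0 0 j)%:MP - 'X_j * (ct 0 0 i)%:MP \in vanishing Y.
  rewrite -kap0 rmorphB !rmorphM /= -!psiC -!cC !cE.
  by rewrite mulrCA -[X in _ - X]mulrCA [kap 'X_j * _]mulrC subrr.
by move=> /vanishingP /(_ _ v0 Yv) /eqP; rewrite vevalB !vevalM !vevalX !vevalC subr_eq0 => /eqP.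
Qed.

End Parametrisation.

Lemma div_neq0 (F : fieldType) (x y : F) : x != 0 -> y != 0 -> x / y != 0.
Proof. by move=> x0 y0; rewrite mulf_neq0 ?invr_eq0. Qed.

Lemma div_swap (F : fieldType) (x y z : F) : x / y * z = z / y * x.
Proof. by rewrite mulrAC [x * z]mulrC mulrAC. Qed.

Lemma plane_curve_not_rational (K : numClosedFieldType) (N d : nat) (H : 'M[K]_(3, N.+1))
    (G : {mpoly K[3]}) (Y : projvar K N) : row_free H -> (3 <= d)%N -> G \is d.-homog ->
  prime_elt G -> smooth_form G -> pvset Y = hypersection H G -> ~ rational_curve Y.
Proof.
move=> Hfree d3 hG Gp Gs YE [phi [[phi' phiK phiK'] phiC]].
pose psi : {rmorphism {poly K} -> {fraction coordring Y}} :=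
  (val : funfield Y -> {fraction coordring Y}) \o phi \o @FracField.tofrac {poly K}.
have psi_inj : injective psi.
  by move=> p q /val_inj /(can_inj phiK) /eqP; rewrite tofrac_eq => /eqP.
have psiC c : psi c%:P = coord_class Y c%:MP.
  by have [k [_ _ _]] := phiC c; rewrite coord_class1 divr1.
have [j0 nX] : exists j0, 'X_j0 \notin vanishing Y.
  apply: contrapT => nb; have [_ [[q Yq] _]] := projvarP Y.
  have /negP := pcoord_neq0 q; apply; apply/eqP/rowP => i; rewrite [RHS]mxE.
  have : 'X_i \in vanishing Y by apply: contrapT => /negP ni; apply: nb; exists i.
  move=> /vanishingP /(_ _ (pcoord_neq0 q)); rewrite pof_pcoord vevalX; exact.
(* The functions ['X_j / 'X_j0] correspond to fractions of polynomials in one variable; a common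
   denominator [D] makes them polynomials proportional to the coordinates. *)
have [f fE] := choice (fun j => make_ratfun (homogX K j) (homogX K j0) nX).
have [D [b [D0 bE]]] := common_denominator (fun j => phi' (f j)).
have X0 : coord_class Y 'X_j0 != 0 by rewrite coord_class_eq0.
have psiD : psi D != 0 by rewrite -(rmorph0 psi) (inj_eq psi_inj).
apply: (@no_parametrisation K N d H G Y Hfree d3 hG Gp Gs YE _ (@coord_class K N Y) psi
  (@coord_class_eq0 K N Y) psi_inj psiC b (psi D / coord_class Y 'X_j0)).
  exact: (div_neq0 psiD X0).
move=> j; have e : phi (FracField.tofrac (b j)) = f j * phi (FracField.tofrac D).
  by rewrite bE rmorphM phiK'.
rewrite -[psi (b j)]/(subfield_val (phi (FracField.tofrac (b j)))) e subfield_valM.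
have [k [_ _ _ ->]] := fE j; exact: (div_swap _ _ _).
Qed.

(** * Linear subspaces of fixed points *)

Section LinearSubspaces.
Variables (K : numClosedFieldType) (n d : nat) (X : projvar K n.+4).
Variable F : {mpoly K[n.+1.+4]}.
Hypothesis XF : hyp_form d X F.
Hypothesis d2 : (2 <= d)%N.

Let hF : F \is d.-homog. Proof. by case: XF. Qed.

(* Otherwise the linear subspace {l = m = 0} would lie in X, which is smooth. *)
Lemma linform_ndvdr_section (l : 'cV[K]_n.+1.+4) k (m : 'cV[K]_n.+4) : l k 0 != 0 -> m != 0 ->
  ~ dvdr (linform m) (lsub (kerbasis l k) F).
Proof.
move=> lk /cV0Pn [k' mk] [c e]; pose H := kerbasis l k; have [_ smF _ _ _] := XF.
have Hfree : row_free H := kerbasis_free lk.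
pose B := kerbasis m k' *m H.
have /eqP : lsub B F = 0.
  rewrite -lsub_comp e rmorphM (_ : lsub _ (linform m) = 0) ?mulr0 //.
  apply: veval_ext => v; rewrite veval_lsub veval_linform -mulmxA kerbasis_mul mulmx0 mxE.
  by rewrite veval0.
apply/negP; apply: (@restriction_neq0 _ _ _ _ _ _ (delta_mx 0 k' *m H) (delta_mx 0 k) hF d2 smF).
  by rewrite /row_free mxrankMfree //; apply: kerbasis_free.
have fullm : (1%:M <= kerbasis m k' + (delta_mx 0 k' : 'rV[K]_n.+4))%MS.
  by apply: (kerbasis_full mk); rewrite -rowE mxE.
have fulll : (1%:M <= H + (delta_mx 0 k : 'rV[K]_n.+1.+4))%MS by apply: (kerbasis_full lk); rewrite -rowE mxE.
apply: submx_trans fulll _; apply: addsmxS (submx_refl _).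
by rewrite -(addsmxMr (kerbasis m k')) -{1}[H]mul1mx; apply: submxMr.
Qed.

Lemma component_of_section m (H : 'M[K]_(m.+1, n.+1.+4)) (f : {mpoly K[m.+1]}) e Z : row_free H ->
  factored f -> f \is e.-homog -> irreducible_set Z -> Z `<=` hypersection H f ->
  exists q, [/\ prime_elt q, exists k, q \is k.-homog, dvdr q f & Z `<=` hypersection H q].
Proof.
move=> Hfree fac; elim: fac e => [u /mpoly_unit_const [c c0 ->] e _ [[y Zy] _] sub|q a qp af ih e ha irrZ sub].
  have [x [x0 _]] := hypersection_pof (sub _ Zy).
  by rewrite vevalC => /eqP; rewrite (negbTE c0).
have q0 : q != 0 by case: qp.
have a0 : a != 0 := factored_neq0 af.
have [kq [_ hq]] := factor_homog (mulf_neq0 q0 a0) ha.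
have [ka [_ hka]] : exists e', (e' <= e)%N /\ a \is e'.-homog.
  by rewrite mulrC in ha; apply: (factor_homog (mulf_neq0 a0 q0) ha).
have [_ irr] := irrZ.
case: (irr _ _ (hypersection_closed Hfree hq) (hypersection_closed Hfree hka)).
- move=> y /sub [x [ex /eqP]]; rewrite vevalM mulf_eq0 => /orP[] /eqP z; [left|right]; by exists x.
- by move=> Zq; exists q; split=> //; [exists kq|apply: dvdr_mulr (dvdr_refl _)].
- by move=> /(ih _ hka irrZ) [q' [q'p hq' dv Zq']]; exists q'; split=> //; apply: dvdr_mull.
Qed.

(** [V] satisfies [l = 0] and a second linear condition [m = 0]. A component of the section by [l]
    comes between [Z] and X: it is not X, on which [l] does not vanish, and if it equalled [Z] its
    prime equation would be [m] up to a unit, so X would contain the subspace [l = m = 0].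
    Smoothness forbids this from dimension 3 on, while a smooth surface may contain lines. *)
Lemma chain_above_linear k (V : 'M[K]_(k, n.+1.+4)) Z : irr_closed Z -> Z `<=` pvset X ->
  Z `<=` linset V -> (\rank V <= n.+3)%N -> chain_above (pvset X) Z 2.
Proof.
move=> irrZ ZX ZV rV; have [_ _ Fp XE XV] := XF.
have [l l0 Vl] : exists2 l : 'cV[K]_n.+1.+4, l != 0 & V *m l = 0.
  by apply: exists_annihilator; apply: leq_ltn_trans rV _.
have /cV0Pn [i lk] := l0; pose H := kerbasis l i; have Hfree : row_free H := kerbasis_free lk.
have [m m0 Vm] : exists2 m : 'cV[K]_n.+4, m != 0 & V *m pinvmx H *m m = 0.
  by apply: exists_annihilator; apply: leq_ltn_trans (mxrankM_maxl _ _) _.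
have mp := linform_prime m0; have ndv := linform_ndvdr_section lk m0.
have VH (v : 'rV[K]_n.+1.+4) : (v <= V)%MS -> (v <= H)%MS.
  by case/submxP => u ->; rewrite sub_kerbasis // -mulmxA Vl mulmx0.
have inV (x : 'rV[K]_n.+4) : (x *m H <= V)%MS -> (x *m m) 0 0 = 0.
  case/submxP => u e; have -> : x = u *m (V *m pinvmx H).
    by rewrite mulmxA -e -mulmxA mulmxVp // mulmx1.
  by rewrite -mulmxA Vm mulmx0 mxE.
have f0 : lsub H F != 0.
  by apply: contra_notN ndv => /eqP ->; apply: dvdr0.
have Zf : Z `<=` hypersection H (lsub H F).
  apply: pof_ind => v v0 Zv; have /submxP [x ex] := VH _ ((pof_linset _ v0).1 (ZV _ Zv)).
  have x0 : x != 0 by apply: contraNneq v0 => z; rewrite ex z mul0mx.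
  rewrite ex; apply/(pof_hypersection Hfree (lsub_homog H hF) x0); rewrite veval_lsub -ex.
  by apply/(XE _ v0); apply: ZX.
have [q [qp [kq hq] qf Zq]] := component_of_section Hfree (factorial_mpoly f0) (lsub_homog H hF) irrZ.2 Zf.
have kq0 := prime_homog_gt0 hq qp.
have WX : hypersection H q `<=` pvset X.
  move=> y /hypersection_pof [x [x0 -> qx]]; apply/XE; first exact: row_free_neq0.
  by rewrite -veval_lsub; case: qf => c ->; rewrite vevalM qx mulr0.
exists (fun j => if j is j'.+1 then if j' is 0%N then hypersection H q else pvset X else Z); split=> //.
  case=> [|[|[|]]] // _; split=> //; last exact: projvarP.
  exact: (hypersection_irr Hfree hq qp (homog_has_zero hq kq0)).
case=> [|[|]] // _; split=> // sub.
  apply: ndv; apply: dvdr_trans qf; apply: prime_dvd_prime => //.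
  apply: contrapT => nqm; have [x [qx mx]] := nullstellensatz_row qp nqm.
  have x0 : x != 0 by apply: contraNneq mx => ->; rewrite veval_linform mul0mx mxE.
  have Wx : hypersection H q (pof (x *m H)) by apply/(pof_hypersection Hfree hq x0).
  move: mx; rewrite veval_linform inV ?eqxx //.
  by apply/(pof_linset _ (row_free_neq0 Hfree x0)); apply/ZV/sub.
suff lX : linform l \in vanishing (pvset X).
  have := dvdr_homog_deg hF (linform_homog l) _ ((XV _).1 lX); rewrite leqNgt d2 => h.
  by apply: (notF (h _)); have [] := linform_prime l0.
apply/vanishingP => v v0 /sub /hypersection_pof [x [x0 e _]].
have [c _ ->] := pof_inj v0 (row_free_neq0 Hfree x0) e.
by rewrite veval_linform -scalemxAl -mulmxA kerbasis_mul mulmx0 scaler0 mxE.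
Qed.

End LinearSubspaces.

Lemma inverse_rmorphism (A B : fieldType) (f : {rmorphism A -> B}) : (forall y, exists x, f x = y) ->
  exists h : {rmorphism B -> A}, cancel f h /\ cancel h f.
Proof.
move=> /choice [h hK]; have fI := fmorph_inj f.
have hz : zmod_morphism h by move=> x y; apply: fI; rewrite rmorphB /= !hK.
have hm : monoid_morphism h by split=> [|x y]; apply: fI; rewrite ?rmorph1 ?rmorphM /= !hK.
pose ha := GRing.isZmodMorphism.Build _ _ h hz.
pose hb := GRing.isMonoidMorphism.Build _ _ h hm.
pose hr : {rmorphism B -> A} := HB.pack h ha hb.
by exists hr; split=> x; [apply: fI; rewrite /= hK|exact: hK].
Qed.

Lemma div_of_mul (F : fieldType) (x y z : F) : y != 0 -> z * y = x -> x / y = z.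
Proof. by move=> y0 <-; rewrite mulfK. Qed.

Lemma poly_le_def (R : nzRingType) (p : {poly R}) k : (size p <= k)%N -> p = \sum_(i < k) p`_i *: 'X^i.
Proof.
move=> sp; rewrite -poly_def; apply/polyP => i; rewrite coef_poly.
by case: ltnP => // ki; rewrite nth_default // (leq_trans sp).
Qed.

(** * Lines are smooth rational curves *)

Section Line.
Variables (K : numClosedFieldType) (N : nat) (Y : projvar K N).
Variable (B : 'M[K]_(2, N.+1)).
Hypothesis Bfree : row_free B.

Lemma row_pinv i : row i B *m pinvmx B = delta_mx 0 i.
Proof. by rewrite rowE -mulmxA mulmxVp // mulmx1. Qed.

(** A form vanishing on [Y] but not on the whole line restricts to a nonzero binary form, which by
    irreducibility of [Y] cannot be a relation at both base points. *)
Lemma line_full : pvset Y `<=` linset B -> pvset Y (pof (row 0 B)) -> pvset Y (pof (row 1 B)) ->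
  pvset Y = linset B.
Proof.
move=> YB Y0 Y1; apply/seteqP; split=> //; apply: pof_ind => v v0 /(pof_linset _ v0) /submxP [x ex].
apply: contrapT => nY; have [e [P [hP Pv Pq]]] := closed_sep (projvarP Y).1 nY.
rewrite (heval_pof hP v0) ex -veval_lsub in Pq.
have r0 : lsub B P != 0 by apply: contraNneq Pq => ->; rewrite veval0.
have rY : lsub (pinvmx B) (lsub B P) \in vanishing Y.
  apply/vanishingP => w w0 Yw; rewrite !veval_lsub.
  have /mulmxKpV -> := (pof_linset _ w0).1 (YB _ Yw).
  by have /vanishingP := (vanishing_homog _ hP).2 Pv; apply.
have nz i : row i B != 0.
  by rewrite rowE; apply: (row_free_neq0 Bfree); apply/eqP => /rowP /(_ i) /eqP; rewrite !mxE !eqxx oner_eq0.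
by apply: (no_binary_relation r0 rY (nz 0) (nz 1) Y0 Y1); rewrite row_pinv !mxE ?eqxx ?oner_neq0.
Qed.

Hypothesis YE : pvset Y = linset B.

Lemma vanishing_line P : P \in vanishing Y <-> forall v : 'rV[K]_N.+1, (v <= B)%MS -> veval P v = 0.
Proof.
split=> [/vanishingP h v vB|h]; last first.
  by apply/vanishingP => v v0; rewrite YE => /(pof_linset _ v0); apply: h.
have [->|v0] := eqVneq v 0; last by apply: h => //; rewrite YE; apply/(pof_linset _ v0).
pose w := row 0 B; have w0 : w != 0.
  by rewrite /w rowE; apply: (row_free_neq0 Bfree); apply/eqP => /rowP /(_ 0) /eqP; rewrite !mxE !eqxx oner_eq0.
have z : linepoly P w = 0.
  apply: linepoly0 => t t0; have tw : t *: w != 0 by rewrite scaler_eq0 negb_or t0.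
  by apply: h => //; rewrite YE; apply/(pof_linset _ tw); apply/scalemx_sub/row_sub.
by have := linepolyE P w 0; rewrite z horner0 scale0r.
Qed.

Lemma line_smooth : smooth_set Y 1.
Proof.
apply: pof_ind => y y0 Yy; exists B => // v; set y1 := pcoord (pof y).
have y1B : (y1 <= B)%MS by move: Yy; rewrite YE.
split=> [ct|vB P /vanishing_line PY].
  rewrite submxE; apply/eqP/rowP => j; rewrite [RHS]mxE.
  have : linform (col j (cokermx B)) \in vanishing Y.
    apply/vanishing_line => w /submxP [u ->].
    by rewrite veval_linform colE -mulmxA (mulmxA B) mulmx_coker mul0mx mulmx0 mxE.
  move/ct => <-; rewrite mxE; apply: eq_bigr => i _.
  by rewrite /heval veval_mderiv_linform [col _ _ _ _]mxE mulrC.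
have [q [qE dq]] := deriv_line P y1 v.
have q0 : q = 0.
  apply: poly_ext_nz => t _; rewrite qE horner0; apply: PY.
  by apply: addmx_sub => //; apply: scalemx_sub.
by rewrite /heval -dq q0 deriv0 horner0.
Qed.

Let psi : {rmorphism {mpoly K[N.+1]} -> {fraction {poly K}}} :=
  @FracField.tofrac {poly K} \o along (fun i => (B 0 i)%:P + B 1 i *: 'X).

Let psi0 k P : P \is k.-homog -> (psi P == 0) = (P \in vanishing Y).
Proof.
move=> hP; rewrite /psi /= tofrac_eq0.
have alE t : (along (fun i => (B 0 i)%:P + B 1 i *: 'X) P).[t] = veval P (row 0 B + t *: row 1 B).
  by rewrite horner_along; apply: meval_eq => i; rewrite !mxE hornerD hornerC hornerZ hornerX mulrC.
apply/eqP/idP => [e|/vanishing_line PY]; last first.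
  apply: poly_ext_nz => t _; rewrite alE horner0; apply: PY.
  by apply: addmx_sub; rewrite ?scalemx_sub ?row_sub.
have {}e : along (fun i => (B 0 i)%:P + B 1 i *: 'X) P = 0 := e.
apply/vanishing_line => v /submxP [x ->].
have xB (x0 x1 : K) : (\row_i (if i == 0 :> 'I_2 then x0 else x1)) *m B = x0 *: row 0 B + x1 *: row 1 B.
  apply/rowP => j; rewrite !mxE big_ord_recl big_ord1 !mxE /=.
  by congr (_ + _ * B _ _); apply: val_inj.
have Pz x0 x1 : x0 != 0 -> veval P (x0 *: row 0 B + x1 *: row 1 B) = 0.
  move=> nz; have -> : x0 *: row 0 B + x1 *: row 1 B = x0 *: (row 0 B + (x1 / x0) *: row 1 B).
    by rewrite scalerDr scalerA mulrCA divff // mulr1.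
  by rewrite (homog_scale _ _ hP) -alE e horner0 mulr0.
have -> : x = \row_i (if i == 0 :> 'I_2 then x 0 0 else x 0 1).
  apply/rowP => i; rewrite mxE; case: i => [[|[|]]] // lt; congr (x 0 _); exact: val_inj.
rewrite xB; have [x0|] := eqVneq (x 0 0) 0; last exact: Pz.
(* The point missed by the chart is reached along a second line: [P] vanishes on it for all nonzero
   parameters, hence also at 0. *)
have [q [qE _]] := deriv_line P (x 0 1 *: row 1 B) (row 0 B).
have q0 : q = 0 by apply: poly_ext_nz => t t0; rewrite qE horner0 addrC Pz.
by have := qE 0; rewrite q0 horner0 x0 addrC => <-.
Qed.

Lemma psi_surjective (z : {fraction {poly K}}) : exists f : funfield Y, ffmap psi f = z.
Proof.
have [n [d [d0 e]]] := frac_numden z.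
pose C j := linform (col j (pinvmx B)).
have alC (j : 'I_2) : along (fun i => (B 0 i)%:P + B 1 i *: 'X) (C j) = if j == 0 then 1 else 'X.
  apply: poly_ext_nz => t _; rewrite horner_along.
  rewrite (@meval_eq _ _ _ ((row 0 B + t *: row 1 B) 0)); last first.
    by move=> i; rewrite !mxE hornerD hornerC hornerZ hornerX mulrC.
  rewrite -[LHS]/(veval (C j) _) veval_linform colE mulmxA mulmxDl -scalemxAl.
  rewrite !row_pinv -colE !mxE; case: j => [[|[|]]] // lt; rewrite /= ?hornerC ?hornerX.
    by rewrite mulr0 addr0.
  by rewrite mulr1 add0r.
pose k := maxn (size n) (size d).
(* Homogenisation to degree [k] in the coordinates [C 0] and [C 1] of the line, which the chart
   sends to [1] and ['X]. *)
pose hg (p : {poly K}) := \sum_(i < k) p`_i *: (C 0 ^+ (k - i) * C 1 ^+ i).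
have hgh p : hg p \is k.-homog.
  apply: rpred_sum => i _; apply: rpredZ.
  have hX m j : C j ^+ m \is m.-homog.
    by apply: homog_char => t v _; rewrite !vevalXn !veval_linform -scalemxAl mxE exprMn.
  by have := dhomogM (hX (k - i)%N 0) (hX i 1); rewrite subnK // ltnW.
have alh (p : {poly K}) : (size p <= k)%N -> along (fun i => (B 0 i)%:P + B 1 i *: 'X) (hg p) = p.
  move=> sp; rewrite rmorph_sum [RHS](poly_le_def sp); apply: eq_bigr => i _.
  by rewrite -mul_mpolyC !rmorphM !rmorphXn alongC !alC expr1n mul1r mul_polyC.
have psih (p : {poly K}) : (size p <= k)%N -> psi (hg p) = FracField.tofrac p.
  by move=> sp; rewrite -[in RHS](alh _ sp).
have nd : hg d \notin vanishing Y.
  by rewrite -(psi0 (hgh d)) psih ?leq_maxr // tofrac_eq0.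
have [f fE] := make_ratfun (hgh n) (hgh d) nd.
exists f; rewrite (ffmapE psi0 fE) !psih ?leq_maxl ?leq_maxr //.
apply: div_of_mul e; by rewrite tofrac_eq0.
Qed.

Lemma line_rational : rational_curve Y.
Proof.
have fz := ffmap_zmod psi0; have fm := ffmap_monoid psi0.
pose ha := GRing.isZmodMorphism.Build _ _ _ fz.
pose hb := GRing.isMonoidMorphism.Build _ _ _ fm.
pose f : {rmorphism funfield Y -> {fraction {poly K}}} := HB.pack (ffmap psi) ha hb.
have [h [fK hK]] := inverse_rmorphism (f := f) psi_surjective.
exists h; split; first by exists f.
move=> c; have := constfunP Y c; congr (ratfun_const _ _).
rewrite -[LHS]fK; congr (h _); rewrite /= (ffmapE psi0 (constfunP Y c)) rmorph1 divr1.
by rewrite /psi /= alongC.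
Qed.

Lemma line_smooth_rational : smooth_rational_curve Y.
Proof. by split; [apply: line_smooth|apply: line_rational]. Qed.

End Line.

Lemma rank1_homology (K : fieldType) N (A : 'M[K]_N) a : \rank (A - a%:M) = 1%N ->
  exists l p, homology A a l p.
Proof.
move=> rk; pose M := A - a%:M.
exists (castmx (erefl _, rk) (col_base M)), (castmx (rk, erefl _) (row_base M)).
have e : castmx (erefl _, rk) (col_base M) *m castmx (rk, erefl _) (row_base M) = M.
  by rewrite -[RHS]mulmx_base -/M; move: (col_base M) (row_base M); rewrite -/M in rk *; case: _ / rk.
have M0 : M != 0 by rewrite -mxrank_eq0 rk.
split; first by rewrite e /M addrC subrK.
  by apply: contraNneq M0 => z; rewrite -e z mul0mx.
by apply: contraNneq M0 => z; rewrite -e z mulmx0.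
Qed.

Section FixedLocus.
Variables (K : numClosedFieldType) (n d : nat) (X : projvar K n.+3).
Hypothesis d4 : (4 <= d)%N.
Variables (g : pspace K n.+3 -> pspace K n.+3) (A : 'M[K]_n.+4).
Hypothesis Aunit : A \in unitmx.
Hypothesis gE : forall v : 'rV[K]_n.+4, v != 0 -> pvset X (pof v) -> g (pof v) = pof (v *m A).
Hypothesis gord : automorphism_order X g d.-1.

Lemma mulA_neq0 (v : 'rV[K]_n.+4) : v != 0 -> v *m A != 0.
Proof. by apply: row_free_neq0; rewrite row_free_unit. Qed.

Lemma fixed_eigenspace Z : irr_closed Z -> Z `<=` fixed_set X g ->
  exists a, Z `<=` linset (eigenspace A a).
Proof.
move=> irrZ sub; have [s es] := closed_field_poly_normal (char_poly A).
have [||a _ Za] := @irreducible_big K n.+3 _ s (fun a => linset (eigenspace A a)) Z irrZ.2.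
- by move=> a _; apply: linset_closed.
- apply: pof_ind => v v0 /sub [Xv]; rewrite gE // => e.
  have [a a0 va] := pof_inj (mulA_neq0 v0) v0 e; exists a; last first.
    by apply/(pof_linset _ v0)/eigenspaceP.
  have : root (char_poly A) a by rewrite -eigenvalue_root_char; apply/eigenvalueP; exists v.
  rewrite es rootZ ?root_prod_XsubC // lead_coef_eq0; apply/negP => /eqP z.
  by have := char_poly_monic A; rewrite z monicE lead_coef0 eq_sym oner_eq0.
by exists a.
Qed.

(** The rank of [A - a%:M] decides: rank 0 would make [g] the identity on X, rank 1 makes [A] a
    homology, and a larger rank makes the eigenspace have codimension at least 2. *)
Lemma fixed_dichotomy Z : irr_closed Z -> Z `<=` fixed_set X g ->
  (exists l a p, homology A a l p) \/
  exists2 V : 'M[K]_n.+4, (\rank V <= n.+2)%N & Z `<=` linset V.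
Proof.
move=> irrZ sub; have [a Za] := fixed_eigenspace irrZ sub; set V := eigenspace A a in Za.
have rkE : \rank V = (n.+4 - \rank (A - a%:M)%R)%N by apply: mxrank_ker.
case: (ltngtP (\rank (A - a%:M)%R) 1) => rk.
- case: (not_all_fixed d4 gord); apply: pof_ind => v v0 Xv; split=> //.
  have /eqP : A - a%:M == 0 by rewrite -mxrank_eq0 -leqn0.
  move/eqP; rewrite subr_eq0 => /eqP Aa; have vA : v *m A = a *: v by rewrite Aa mul_mx_scalar.
  rewrite gE // vA pofZ //; apply: contraNneq (mulA_neq0 v0) => z.
  by rewrite vA z scale0r.
- by right; exists V => //; rewrite rkE leq_subLR; apply: (leq_add rk (leqnn n.+2)).
- by left; have [l [p h]] := rank1_homology rk; exists l, a, p.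
Qed.

End FixedLocus.

(** A chain of length 1 provides two distinct points of [C]. They span [V], and by irreducibility
    [C] is the whole line. *)
Lemma curve_in_line_is_rational (K : numClosedFieldType) N k (C : projvar K N) (V : 'M[K]_(k, N.+1)) :
  dim_is C 1 -> pvset C `<=` linset V -> (\rank V <= 2)%N -> smooth_rational_curve C.
Proof.
move=> [[W [irr strict]] _] CV rk.
have [irr0 sub0] := irr 0%N isT; have [irr1 sub1] := irr 1%N isT.
have [s01 n01] := strict 0%N isT; have [w Ww] := irr0.2.1.
have [w' W'w' nw'] : exists2 q, W 1%N q & ~ W 0%N q.
  by apply: contrapT => h; apply: n01 => q Vq; apply: contrapT => nq; apply: h; exists q.
pose a := pcoord w; pose b := pcoord w'.
have ind c : b != c *: a.
  apply/negP => /eqP e; apply: nw'; rewrite -(pof_pcoord w') -/b e pofZ ?pof_pcoord ?pcoord_neq0 //.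
  by apply: contraNneq (pcoord_neq0 w') => c0; rewrite -/b e c0 scale0r.
pose B : 'M[K]_(1 + 1, N.+1) := col_mx a b.
have Bfree : row_free B := row_free2 (pcoord_neq0 w) ind.
have B0 : row 0 B = a by rewrite rowE mul_pair_mx !mxE /= scale1r scale0r addr0.
have B1 : row 1 B = b by rewrite rowE mul_pair_mx !mxE /= scale1r scale0r add0r.
have BV : (B <= V)%MS.
  by rewrite col_mx_sub; apply/andP; split; apply: CV; [apply: sub0|apply: sub1].
have VB : (V <= B)%MS.
  by have := mxrank_leqif_sup BV => -[_ <-]; rewrite eqn_leq mxrankS //= (eqP Bfree).
have CB : pvset C `<=` linset B by move=> q /CV Vq; apply: submx_trans Vq VB.
apply: (line_smooth_rational Bfree); apply: line_full => //; rewrite ?B0 ?B1 pof_pcoord.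
  exact: sub0.
exact: sub1.
Qed.

Lemma linear_automorphism_matrix (K : numClosedFieldType) N (X : set (pspace K N.+1)) g :
  linear_automorphism X g -> exists A : 'M[K]_N.+2,
    [/\ A \in unitmx,
        forall v : 'rV[K]_N.+2, v != 0 -> X (pof v) -> g (pof v) = pof (v *m A) &
        forall v : 'rV[K]_N.+2, v != 0 -> X (pof v) -> X (pof (v *m A))].
Proof.
move=> [_ [h [hauto hX hg]]]; have [A Au hA] := linear_of_automorphism hauto.
exists A; split=> // v v0 Xv; rewrite -hA // ?hg //.
by rewrite -hX; exists (pof v); rewrite ?hg.
Qed.

(** * Fixed loci and inner Galois points *)

Section LinearAutomorphism.
Variables (K : numClosedFieldType) (n d : nat) (X : projvar K n.+3).
Hypotheses (d4 : (4 <= d)%N) (Xs : smooth_hypersurface d X).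
Variable g : pspace K n.+3 -> pspace K n.+3.
Hypotheses (glin : linear_automorphism X g) (gord : automorphism_order X g d.-1).

Let d0 : (0 < d)%N. Proof. exact: leq_trans d4. Qed.

Lemma galois_of_fixed Z : irr_closed Z -> Z `<=` fixed_set X g ->
  (exists p, inner_galois_point X p /\ belongs_to_galois_point X p g) \/
  exists2 V : 'M[K]_n.+4, (\rank V <= n.+2)%N & Z `<=` linset V.
Proof.
move=> irrZ sub; have [F XF] := smooth_hypersurface_form d0 Xs.
have [A [Au gE gX]] := linear_automorphism_matrix glin.
case: (fixed_dichotomy d4 Au gE gord irrZ sub) => [[l [a [p hom]]]|]; last by right.
left; exists (pof p); exact: (homology_galois XF d4 Au gE gX hom gord).
Qed.

Lemma fixed_codim : (exists p, inner_galois_point X p /\ belongs_to_galois_point X p g) ->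
  codim_is (fixed_set X g) X 1.
Proof.
move=> [p [_ bel]]; have [F XF] := smooth_hypersurface_form d0 Xs.
have [A [Au gE gX]] := linear_automorphism_matrix glin.
have [lam [l hom]] := galois_homology XF d4 Au gE gX bel gord.
have [_ l0 _] := hom; have /cV0Pn [k lk] := l0.
exact: (homology_codim XF d4 Au gE gX gord hom lk).
Qed.

End LinearAutomorphism.

Lemma fixed_plane_curve (K : numClosedFieldType) d (X : projvar K 3) g : (4 <= d)%N ->
  smooth_hypersurface d X -> linear_automorphism X g -> automorphism_order X g d.-1 ->
  (exists p, inner_galois_point X p /\ belongs_to_galois_point X p g) ->
  exists C : projvar K 3, [/\ dim_is C 1, C `<=` fixed_set X g & ~ smooth_rational_curve C].
Proof.
move=> d4 Xs glin gord [p [_ bel]]; have [F XF] := smooth_hypersurface_form (ltnW (ltnW (ltnW d4))) Xs.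
have [A [Au gE gX]] := linear_automorphism_matrix glin.
have [lam [l hom]] := galois_homology XF d4 Au gE gX bel gord.
have [_ l0 _] := hom; have /cV0Pn [k lk] := l0.
have [Gp Gs] := homology_section_prime XF d4 Au gE gX gord hom lk.
have Hfree := kerbasis_free lk; have hG : axis_section F l k \is d.-homog.
  by apply: lsub_homog; case: XF.
exists (ProjVar (plane_curve_irr Hfree hG Gp)); split.
- exact: (plane_curve_dim Hfree hG Gp).
- exact: (section_fixed XF Au gE hom lk).
- move=> [_]; exact: (plane_curve_not_rational Hfree (ltnW d4) hG Gp Gs).
Qed.

Theorem theorem1p8 (R : realType) (n d : nat) (X : projvar R[i] n.+1)
  (g : pspace R[i] n.+1 -> pspace R[i] n.+1) :
  (4 <= d)%N ->
  smooth_hypersurface d X ->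
  linear_automorphism X g ->
  automorphism_order X g d.-1 ->
  (n = 2%N ->
    ((exists C : projvar R[i] n.+1,
        [/\ dim_is C 1, C `<=` fixed_set X g & ~ smooth_rational_curve C]) <->
     (exists p, inner_galois_point X p /\ belongs_to_galois_point X p g))) /\
  ((3 <= n)%N ->
    (codim_is (fixed_set X g) X 1 <->
     (exists p, inner_galois_point X p /\ belongs_to_galois_point X p g))).
Proof.
move=> d4 Xs glin gord; split.
  move=> n2; subst n; split; last exact: fixed_plane_curve d4 Xs glin gord.
  move=> [C [dimC Cfix nrat]].
  have [//|[V rk CV]] := galois_of_fixed d4 Xs glin gord (projvarP C) Cfix.
  by case: nrat; apply: curve_in_line_is_rational dimC CV rk.
case: n X g Xs glin gord => [|[|[|n]]] // X g Xs glin gord _.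
split; last exact: (@fixed_codim _ n.+1 d X d4 Xs g glin gord).
(* Codimension 1 supplies an irreducible set [Z] of fixed points with no chain of length 2 above it;
   inside a linear subspace of codimension 2 there would be one. *)
move=> [_ _ [Z [irrZ Zfix nchain]]].
have [//|[V rk ZV]] := galois_of_fixed d4 Xs glin gord irrZ Zfix.
have [F XF] := smooth_hypersurface_form (ltnW (ltnW (ltnW d4))) Xs.
case: nchain; apply: (chain_above_linear XF (ltnW (ltnW d4)) irrZ _ ZV rk).
by move=> q /Zfix [].
Qed.
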